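(* Let $K$ be a field equipped with the trivial absolute value, and let $X$ be a regular projective curve over $\operatorname{Spec}K$ such that $\dim_{\mathbb Q}(\operatorname{Pic}(X)\otimes\mathbb Q)=1$. Let $\overline D=(D,g)$ be an adelic $\mathbb R$-Cartier divisor on $X$ such that $D$ is big. Then for all but a finite number of $x\in X^{(1)}$ one has $\mu_x(g)\leqslant0$. Moreover, with $$\mu_{\mathrm{tot}}(g):=\sum_{x\in X^{(1)}}\mu_x(g)[\kappa(x):K],$$ where $\kappa(x)$ denotes the residue field of $x$, the following hold. (1) $\overline D$ is pseudo-effective if and only if $\mu_{\mathrm{tot}}(g)\geqslant0$. (2) $\overline D$ satisfies the Dirichlet property if and only if $\mu_x(g)\geqslant0$ for all but a finite number of $x\in X^{(1)}$, and $\mu_{\mathrm{tot}}(g)\geqslant0$.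
   Context: Basic notation. $X$ is an integral regular projective scheme of dimension $1$ over $K$; $X^{(1)}$ is its set of closed points; $\operatorname{Rat}(X)^\times_{\mathbb R}:=\operatorname{Rat}(X)^\times\otimes_{\mathbb Z}\mathbb R$. An $\mathbb R$-Cartier divisor is an element of $\operatorname{Div}(X)\otimes\mathbb R$; $(s)$ is the divisor of $s\in\operatorname{Rat}(X)_{\mathbb R}^\times$; a divisor is effective ($\geqslant 0$) if it is a combination of effective Cartier divisors with positive real coefficients. Berkovich space. $X^{\mathrm{an}}$ is the Berkovich analytification over the trivially valued field $K$. It is an infinite tree of depth $1$: a root $\eta_0$ (generic point with the trivial absolute value on $\operatorname{Rat}(X)$), and for each $x\in X^{(1)}$ a branch $[\eta_0,x]$ parametrised by a homeomorphism $t:[\eta_0,x]\to[0,+\infty]$ with $t(\eta_0)=0$, $t(x)=+\infty$; a point $\xi\in[\eta_0,x[$ is the generic point with absolute value $|\cdot|_\xi=e^{-t(\xi)\operatorname{ord}_x(\cdot)}$ on $\operatorname{Rat}(X)$, and the leaf $x$ is the closed point with the trivial absolute value on $\kappa(x)$. A subset $U$ is open iff $U\cap[\eta_0,x]$ is open for every $x$ and, if $\eta_0\in U$, $[\eta_0,x]\subseteq U$ for all but finitely many $x$. Green functions and adelic divisors. A Green function of $D$ is a continuous real function $g$ on the analytification of a non-empty Zariski open subset (modulo agreement on a smaller one) such that for every local equation $f\in\operatorname{Rat}(X)^\times_{\mathbb R}$ of $D$ on a Zariski open $U$, $g+\log|f|$ extends to a continuous function on $U^{\mathrm{an}}$. In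 particular $g$ is real-valued on every $[\eta_0,x[$. An adelic $\mathbb R$-Cartier divisor is a pair $(D,g)$ with $g$ a Green function of $D$. It is effective if $D\geqslant0$ and $g\geqslant0$ as a function $X^{\mathrm{an}}\to\mathbb R\cup\{+\infty\}$. For $s\in\operatorname{Rat}(X)^\times_{\mathbb R}$, $\widehat{(s)}:=((s),-\log|s|)$. $(D,g)$ satisfies the Dirichlet property if $(D,g)+\widehat{(s)}$ is effective for some $s\in \operatorname{Rat}(X)^\times_{\mathbb R}$. Invariants $\mu$. For $x\in X^{(1)}$, $\mu_x(g):=\inf_{\xi\in\,]\eta_0,x[}\frac{g(\xi)}{t(\xi)}\in\mathbb R\cup\{-\infty\}$. Since only finitely many $\mu_x(g)$ are positive, $\mu_{\mathrm{tot}}(g)$ is well defined in $[-\infty,+\infty[$ (it is $-\infty$ if uncountably many $\mu_x(g)$ are negative). Positivity. $H^0(D):=\{s\in\operatorname{Rat}(X)^\times: D+(s)\geqslant0\}\cup\{0\}$, a finite dimensional $K$-vector space. $D$ is big if $\operatorname{vol}(D)=\limsup_n \dim_K H^0(nD)/n>0$. For $s\in H^0(D)\setminus\{0\}$, $\|s\|_g:=\sup_{X^{\mathrm{an}}}|s|e^{-g}$ and $\|0\|_g=0$; for $t\in\mathbb R$, $\mathcal F^t(H^0(D)):=\{s:\|s\|_g\leqslant e^{-t}\}$ (a $K$-subspace). $\widehat{\deg}_+(D,g):=\int_0^{+\infty}\dim_K\mathcal F^t(H^0(D))\,dt$, and $\widehat{\operatorname{vol}}(D,g):=\limsup_{n\to+\infty}\frac{\widehat{\deg}_+(nD,ng)}{n^2/2}$.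 $(D,g)$ is big if $\widehat{\operatorname{vol}}(D,g)>0$, and $(D,g)$ is pseudo-effective if $(D+D',g+g')$ is big for every big adelic $\mathbb R$-Cartier divisor $(D',g')$. *)

(* Defs.v *)
From HB Require Import structures.
From mathcomp Require Import all_boot all_order all_algebra.
From mathcomp Require Import all_classical all_reals all_analysis.

Set Implicit Arguments.
Unset Strict Implicit.
Unset Printing Implicit Defensive.

Import Order.TTheory GRing.Theory Num.Theory.
Import numFieldNormedType.Exports.

Local Open Scope classical_set_scope.
Local Open Scope ring_scope.

(* V / W has dimension n over k, for the scalar action sc of k on M: some
   b_1, ..., b_n in V map to a basis of V / W. *)
Definition quot_dim (k : fieldType) (M : zmodType) (sc : k -> M -> M)
    (V W : set M) (n : nat) : Prop :=
  exists b : 'I_n -> M,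
    [/\ forall i, V (b i),
        forall c : 'I_n -> k, W (\sum_i sc (c i) (b i)) -> forall i, c i = 0
      & forall v, V v -> exists c : 'I_n -> k, W (v - \sum_i sc (c i) (b i))].

(* The supremum of the lengths d of chains c_0 < ... < c_d in P is n. *)
Definition has_chain (T : Type) (P : set (set T)) (d : nat) : Prop :=
  exists c : nat -> set T,
    (forall i, (i <= d)%N -> P (c i)) /\
    (forall i, (i < d)%N -> c i `<` c i.+1).

Definition chain_dim (T : Type) (P : set (set T)) (n : nat) : Prop :=
  has_chain P n /\ ~ has_chain P n.+1.

Section LocalAlgebra.
Variable F : fieldType.
Implicit Types (A O I p : set F) (h : F).

Definition subring A : Prop :=
  A 1 /\ forall a b, A a -> A b -> A (a - b) /\ A (a * b).

Definition ideal A I : Prop :=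
  [/\ I `<=` A, I 0, forall a b, I a -> I b -> I (a + b)
    & forall a b, A a -> I b -> I (a * b)].

Definition prime_ideal A p : Prop :=
  [/\ ideal A p, ~ p 1
    & forall a b, A a -> A b -> p (a * b) -> p a \/ p b].

Definition localization A p : set F :=
  [set h | exists a b, [/\ A a, A b, ~ p b & h = a / b]].

Definition is_unit O h : Prop := [/\ h != 0, O h & O h^-1].

(* The maximal ideal, when O is a local ring. *)
Definition max_ideal O : set F := [set h | O h /\ ~ is_unit O h].

Definition regular_local O : Prop :=
  exists d : nat, chain_dim (prime_ideal O) d /\
    exists g : 'I_d -> F, max_ideal O =
      [set h | exists c : 'I_d -> F,
         (forall i, O (c i)) /\ h = \sum_i c i * g i].

(* The normalized valuation of a discrete valuation ring O with fraction
   field F; the value at h = 0 is irrelevant. *)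
Definition ord_of O h : int :=
  xget 0 [set n : int | exists pi u,
    [/\ max_ideal O = [set a * pi | a in O], is_unit O u & h = u * pi ^ n]].

End LocalAlgebra.

(* An integral closed subscheme X of P^N_K, given by its function field
   [ffield], as an extension of K via [emb], and by the homogeneous coordinates
   [hcoord] (z_0 : ... : z_N) of its generic point. The trace of X on the
   standard affine open where the i-th coordinate is invertible is empty if
   z_i = 0, and otherwise is the spectrum of K[z_0/z_i, ..., z_N/z_i], whose
   fraction field must be [ffield]. *)
Definition affine_coord_ring (K F : fieldType) (e : K -> F) (N : nat)
    (z : 'I_N.+1 -> F) (i : 'I_N.+1) : set F :=
  smallest (fun A => subring A /\ forall c, A (e c)) [set z j / z i | j in setT].

Record proj_scheme (K : fieldType) := ProjScheme {
  ffield : fieldType;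
  emb : {rmorphism K -> ffield};
  pdim : nat;
  hcoord : 'I_pdim.+1 -> ffield;
  hcoord_neq0 : exists i, hcoord i != 0;
  hcoord_frac : forall i, hcoord i != 0 -> forall h, exists a b,
    [/\ affine_coord_ring emb hcoord i a, affine_coord_ring emb hcoord i b,
        b != 0 & h = a / b]
}.

Section Points.
Variables (K : fieldType) (X : proj_scheme K).

Definition chart := affine_coord_ring (@emb K X) (@hcoord K X).

(* A point of an integral separated scheme is determined by its local ring,
   viewed inside the function field. *)
Definition is_local_ring (O : set (ffield X)) : Prop :=
  exists i p, [/\ hcoord i != 0, prime_ideal (chart i) p &
                  O = localization (chart i) p].

Record point := Point {
  stalk : set (ffield X);
  stalkP : is_local_ring stalk
}.

HB.instance Definition _ := gen_eqMixin point.
HB.instance Definition _ := gen_choiceMixin point.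

(* The Zariski topology: a basis is given by the sets of points at which
   finitely many given rational functions are regular. Indeed the affine open
   [chart i] consists of the points where all z_j/z_i are regular, and its
   principal open defined by h of those where moreover h^-1 is regular. *)
Definition zariski_open (U : set point) : Prop :=
  forall x, U x -> exists s : seq (ffield X),
    (forall h, h \in s -> stalk x h) /\
    [set y | forall h, h \in s -> stalk y h] `<=` U.

Lemma zariski_openT : zariski_open setT.
Proof. by move=> x _; exists [::]; split. Qed.

Lemma zariski_openI : setI_closed zariski_open.
Proof.
move=> U V oU oV x [/oU[s [sx sU]] /oV[t [tx tV]]]; exists (s ++ t); split.
  by move=> h; rewrite mem_cat => /orP[/sx|/tx].
move=> y yst; split.
  by apply: sU => h hs; apply: yst; rewrite mem_cat hs.
by apply: tV => h ht; apply: yst; rewrite mem_cat ht orbT.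
Qed.

Lemma zariski_open_bigU (I : Type) (f : I -> set point) :
  (forall i, zariski_open (f i)) -> zariski_open (\bigcup_i f i).
Proof.
move=> of_ x [i _ /of_[s [sx sf]]]; exists s; split => // y /sf yi.
by exists i.
Qed.

HB.instance Definition _ := @isOpenTopological.Build point zariski_open
  zariski_openT zariski_openI zariski_open_bigU.

Lemma generic_stalkP : is_local_ring setT.
Proof.
have [i zi] := hcoord_neq0 X; exists i, [set 0]; split => //.
  have A0 : chart i 0.
    move=> A [[[A1 AB] _] _].
    by rewrite -(subrr (1 : ffield X)); case: (AB _ _ A1 A1).
  split; first by split=> // [x -> //|a b -> ->|a b _ ->];
    rewrite /= ?addr0 ?mulr0.
  - by move/eqP; rewrite oner_eq0.
  - by move=> a b _ _ /eqP; rewrite mulf_eq0 => /orP[] /eqP; [left|right].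
apply/seteqP; split => // h _.
have [a [b [Aa Ab b0 ->]]] := hcoord_frac zi h.
by exists a, b; split => //; apply/eqP.
Qed.

Definition generic_point : point := Point generic_stalkP.

Definition irreducible_set (Z : set point) : Prop :=
  Z !=set0 /\ forall A B, closed A -> closed B ->
    Z `<=` A `|` B -> Z `<=` A \/ Z `<=` B.

Definition has_dimension (n : nat) : Prop :=
  chain_dim [set Z : set point | closed Z /\ irreducible_set Z] n.

Definition regular_scheme : Prop := forall x : point, regular_local (stalk x).

Record closed_point := ClosedPoint {
  cpt :> point;
  cptP : closed [set cpt]
}.

HB.instance Definition _ := gen_eqMixin closed_point.
HB.instance Definition _ := gen_choiceMixin closed_point.

Definition ord_at (x : closed_point) (h : ffield X) : int := ord_of (stalk x) h.

Definition kscale (c : K) (h : ffield X) : ffield X := emb X c * h.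

(* [kappa(x) : K] *)
Definition res_deg (x : closed_point) : nat :=
  xget 0%N (quot_dim kscale (stalk x) (max_ideal (stalk x))).

Definition kdim (V : set (ffield X)) : nat :=
  xget 0%N (quot_dim kscale V [set 0]).

End Points.

Section Divisors.
Variables (K : fieldType) (X : proj_scheme K).

(* A global section of the sheaf Rat(X)^* / O_X^*, by representatives of its
   germs. *)
Record cartier := Cartier {
  loc_eqn : point X -> ffield X;
  loc_eqn_neq0 : forall x, loc_eqn x != 0;
  loc_eqn_glue : forall x, \forall y \near x,
    is_unit (stalk y) (loc_eqn x / loc_eqn y)
}.

(* On a regular curve, multiplicities at the closed points identify Div(X) with
   a group of integer-valued functions of finite support on X^(1). Hence, for k
   of characteristic 0, Div(X) (x) k is the k-span of these functions. *)
Definition mult (E : cartier) (x : closed_point X) : int :=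
  ord_at x (loc_eqn E x).

Definition effective_cartier (E : cartier) : Prop :=
  forall x, stalk x (loc_eqn E x).

Definition prdiv (h : ffield X) (x : closed_point X) : int := ord_at x h.

Definition zspan (k : fieldType) (G : set (closed_point X -> int)) :
    set (closed_point X -> k) :=
  [set D | exists n (a : 'I_n -> k) (E : 'I_n -> closed_point X -> int),
     (forall i, G (E i)) /\ forall x, D x = \sum_i a i * (E i x)%:~R].

Definition divisors (k : fieldType) : set (closed_point X -> k) :=
  zspan (range mult).
Arguments divisors k : clear implicits.

(* The image of Rat(X)^* (x) k in Div(X) (x) k. *)
Definition principal_divisors (k : fieldType) : set (closed_point X -> k) :=
  zspan [set prdiv h | h in [set h | h != 0]].
Arguments principal_divisors k : clear implicits.

(* dim_Q (Pic(X) (x) Q) = n, where Pic(X) is the group of Cartier divisors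
   modulo principal ones, so that Pic(X) (x) Q is the cokernel of
   Rat(X)^* (x) Q -> Div(X) (x) Q. *)
Definition dim_PicQ (n : nat) : Prop :=
  quot_dim (fun (c : rat) (D : closed_point X -> rat) => fun x => c * D x)
    (divisors rat) (principal_divisors rat) n.

Variable R : realType.

Definition effective (D : closed_point X -> R) : Prop :=
  exists n (a : 'I_n -> R) (E : 'I_n -> cartier),
    [/\ forall i, 0 < a i, forall i, effective_cartier (E i)
      & forall x, D x = \sum_i a i * (mult (E i) x)%:~R].

(* A representative \sum_i a_i (x) f_i of an element of Rat(X)^* (x) R. Only
   its divisor and the functions log|.| it induces are ever used, and these
   depend on the class in the tensor product alone. *)
Record ratR := RatR {
  ratR_terms :> seq (R * ffield X);
  ratRP : all (fun af => af.2 != 0) ratR_terms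
}.

Definition divR (s : ratR) (x : closed_point X) : R :=
  \sum_(af <- s) af.1 * (ord_at x af.2)%:~R.

Definition H0 (D : closed_point X -> R) : set (ffield X) :=
  [set s | s = 0 \/
    s != 0 /\ effective (D + (fun x => (prdiv s x)%:~R))].

Definition big_divisor (D : closed_point X -> R) : Prop :=
  (0 < limn_esup (fun n => ((kdim (H0 (D *+ n)))%:R / n%:R : R)%:E))%E.

End Divisors.

Arguments divisors {K X} k.
Arguments principal_divisors {K X} k.

Section Berkovich.
Variables (R : realType) (K : fieldType) (X : proj_scheme K).

(* The point of parameter t in ]0, +oo] on the branch of x is [branch x t]. *)
Inductive berk :=
  | eta0
  | branch (x : closed_point X) (t : \bar R) of (0 < t)%E.

HB.instance Definition _ := gen_eqMixin berk.
HB.instance Definition _ := gen_choiceMixin berk.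

(* The inverse of the parametrisation t : [eta0, x] -> [0, +oo], extended by
   the value eta0 to negative t. *)
Definition seg (x : closed_point X) (t : \bar R) : berk :=
  match @idP (0 < t)%E with
  | ReflectT h => branch x h
  | ReflectF _ => eta0
  end.

(* As t |-> max(t, 0) is a retraction of \bar R onto [0, +oo], the preimage of
   U under [seg x] is open iff the trace of U on [eta0, x] is. *)
Definition berk_open (U : set berk) : Prop :=
  (forall x, open (seg x @^-1` U)) /\
  (U eta0 -> finite_set [set x | ~ range (seg x) `<=` U]).

Lemma berk_openT : berk_open setT.
Proof.
split=> [x|_]; first by rewrite preimage_setT; exact: openT.
by apply: (sub_finite_set _ (@finite_set0 (closed_point X))) => x /=; apply.
Qed.

Lemma berk_openI : setI_closed berk_open.
Proof.
move=> U V [oU fU] [oV fV]; split=> [x|[Ue Ve]].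
  by rewrite preimage_setI; exact: openI.
have fUV : finite_set ([set x | ~ range (seg x) `<=` U] `|`
                       [set x | ~ range (seg x) `<=` V]).
  by rewrite finite_setU; split; [exact: fU|exact: fV].
apply: (sub_finite_set _ fUV) => x /= nUV.
have [xU|nU] := pselect (range (seg x) `<=` U); last by left.
by right=> xV; apply: nUV => y yx; split; [exact: xU|exact: xV].
Qed.

Lemma berk_open_bigU (I : Type) (f : I -> set berk) :
  (forall i, berk_open (f i)) -> berk_open (\bigcup_i f i).
Proof.
move=> of_; split=> [x|[i _ fie]].
  by rewrite preimage_bigcup; apply: bigcup_open => i _; exact: (of_ i).1.
apply: (sub_finite_set _ ((of_ i).2 fie)) => x /= nf xf.
by apply: nf => y /xf; exists i.
Qed.

HB.instance Definition _ := @isOpenTopological.Build berk berk_open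
  berk_openT berk_openI berk_open_bigU.

Definition is_leaf (xi : berk) : Prop :=
  if xi is branch _ t _ then t = +oo%E else False.

(* The underlying scheme point. *)
Definition center (xi : berk) : point X :=
  if xi is branch x t _ then
    if t == +oo%E then cpt x else generic_point X
  else generic_point X.

Definition an (U : set (point X)) : set berk := center @^-1` U.

(* log|s|; recall that +oo * 0 = 0 in \bar R, so the value at a leaf x is 0
   when ord_x(s) = 0. *)
Definition log_abs (s : ratR X R) (xi : berk) : \bar R :=
  (if xi is branch x t _ then - (t * (divR s x)%:E) else 0)%E.

(* A continuous function on the analytification of a non-empty Zariski open
   subset is determined by its values outside the leaves. [an_ext h] is the
   extension by continuity to all of X^an, with values in [-oo, +oo], of h
   restricted to the complement of the leaves. *)
Definition an_ext (h : berk -> R) (xi : berk) : \bar R :=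
  match xi with
  | eta0 => (h eta0)%:E
  | branch x t _ =>
      if t == +oo%E then lim ((h (seg x r%:E))%:E @[r --> +oo%R])
      else (h xi)%:E
  end.

Definition local_equation (D : closed_point X -> R) (U : set (point X))
    (f : ratR X R) : Prop :=
  forall x : closed_point X, U x -> D x = divR f x.

(* The values of g outside of V^an, for V as below, are irrelevant. Since
   V^an contains the complement of the leaves, which is dense, two
   representatives of a Green function agree outside the leaves, and
   conversely. *)
Definition green (D : closed_point X -> R) (g : berk -> R) : Prop :=
  (exists V : set (point X),
     [/\ open V, V !=set0 & {within an V, continuous g}]) /\
  (forall (U : set (point X)) (f : ratR X R),
     open U -> local_equation D U f ->
     exists phi : berk -> R,
       {within an U, continuous phi} /\
       forall xi, an U xi -> ~ is_leaf xi ->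
         phi xi = g xi + fine (log_abs f xi)).

Definition adelic (D : closed_point X -> R) (g : berk -> R) : Prop :=
  divisors R D /\ green D g.

Definition effective_adelic (D : closed_point X -> R) (g : berk -> R) : Prop :=
  effective D /\ forall xi, (0 <= an_ext g xi)%E.

Definition dirichlet (D : closed_point X -> R) (g : berk -> R) : Prop :=
  exists s : ratR X R,
    effective_adelic (D + divR s) (g - (fun xi => fine (log_abs s xi))).

Definition mu (g : berk -> R) (x : closed_point X) : \bar R :=
  ereal_inf [set (g (seg x t%:E) / t)%:E | t in [set t : R | 0 < t]].

(* The sum of the positive parts, minus the sum of the negative parts. *)
Definition mu_tot (g : berk -> R) : \bar R :=
  let m := (fun x => mu g x * (res_deg x)%:R%:E)%E in
  (\esum_(x in [set: closed_point X]) (m^\+ x) -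
   \esum_(x in [set: closed_point X]) (m^\- x))%E.

Definition abs_an (s : ffield X) (xi : berk) : R :=
  if s == 0 then 0
  else if xi is branch x t _ then expR (- (fine t * (ord_at x s)%:~R)) else 1.

Definition sup_norm (g : berk -> R) (s : ffield X) : \bar R :=
  if s == 0 then 0%E
  else ereal_sup (range (an_ext (fun xi => abs_an s xi * expR (- g xi)))).

Definition filt (D : closed_point X -> R) (g : berk -> R) (t : R) :
    set (ffield X) :=
  [set s | H0 D s /\ (sup_norm g s <= (expR (- t))%:E)%E].

Definition deg_plus (D : closed_point X -> R) (g : berk -> R) : \bar R :=
  (\int[lebesgue_measure]_(t in `[0%R, +oo[) (kdim (filt D g t))%:R%:E)%E.

Definition avol (D : closed_point X -> R) (g : berk -> R) : \bar R :=
  limn_esup (fun n =>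
    deg_plus (D *+ n)%R (g *+ n)%R * ((n%:R ^+ 2 / 2)^-1)%:E)%E.

Definition big_adelic (D : closed_point X -> R) (g : berk -> R) : Prop :=
  (0 < avol D g)%E.

Definition pseudo_effective (D : closed_point X -> R) (g : berk -> R) : Prop :=
  forall (D' : closed_point X -> R) (g' : berk -> R),
    adelic D' g' -> big_adelic D' g' -> big_adelic (D + D') (g + g').

End Berkovich.

(* Main.v *)
(* By the valuative criterion, every proper valuation ring of Rat(X) over K is
   the local ring of a closed point.  Hence a nonzero function has finitely many
   zeros (an ultrafilter of zeros would have a proper valuation ring as limit),
   and a function without poles has no zeros.  As Pic(X) has rank one, any two
   closed points x and y carry a function f with divisor a x - b y; comparing
   the independent functions f^k v, for v in a family of suitable orders at x,
   with the room left by a pole at y gives a [kappa(x):K] = b [kappa(y):K].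
   So principal R-divisors have degree zero, and conversely an R-divisor of
   degree zero is principal.
   A nonzero section s of nD lies in F^{nt} iff (s) + n mu(g - t) >= 0 and
   t <= g(eta_0).  Counting sections by degree, (D, g) is big iff
   g(eta_0) > 0 and mu_tot(g) > 0.  Pseudo-effectivity is the closure of this
   condition: adding two slopes is superadditive, and adding a small tent
   function changes mu_tot by as little as we want.  Finally (D, g) + (s) is
   effective iff ord_x(s) >= - mu_x(g) for all x, and if mu_tot(g) >= 0 with
   almost all mu_x(g) zero one finds such an s of degree zero. *)
Require Import Defs.
From HB Require Import structures.
From mathcomp Require Import all_boot all_order all_algebra.
From mathcomp Require Import all_classical all_reals all_analysis.
From mathcomp Require Import measurable_realfun ring lra zify.
Set Implicit Arguments.
Unset Strict Implicit.
Unset Printing Implicit Defensive.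
Import Order.TTheory GRing.Theory Num.Theory.
Import numFieldNormedType.Exports.
Local Open Scope classical_set_scope.
Local Open Scope ring_scope.

(** * Valuation rings *)

(** All global information comes from two sources: Zorn's lemma, which produces valuation rings and
    hence closed points, and the rank of Pic(X), which produces functions with a single zero x and a
    single pole y. Powers of the latter push every divisor to a fixed base point, with a rounding
    error that does not grow with its multiples. There dimensions are bounded by counting leading
    coefficients. Estimates up to such errors are enough, because the arithmetic volume only sees
    growth of order n^2: a positive total slope gives order n sections on an interval of order n,
    while a zero total slope leaves boundedly many. The other obstacle is that [mu_tot] is a
    difference of possibly uncountable sums of infima. It is replaced by finite samples: [mu_tot g]
    is at least r iff, for every finite list of branches containing those of positive slope and
    every choice of one point on each, the weighted sum of the slopes at these points is at least r.
    These inequalities are linear in g, so adding Green functions is harmless, and a failure is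
    witnessed by finitely many points, which a small tent cannot repair. *)

Section ValuationRings.
Variable F : fieldType.
Implicit Types (A B C V : set F) (h s : F).

Lemma subring0 A : subring A -> A 0.
Proof. by case=> A1 AB; rewrite -(subrr 1); case: (AB _ _ A1 A1). Qed.

Lemma subringN A a : subring A -> A a -> A (- a).
Proof.
by move=> sA Aa; rewrite -sub0r; case: (sA.2 _ _ (subring0 sA) Aa).
Qed.

Lemma subringD A a b : subring A -> A a -> A b -> A (a + b).
Proof.
by move=> sA Aa Ab; rewrite -(opprK b); case: (sA.2 _ _ Aa (subringN sA Ab)).
Qed.

Lemma subringB A a b : subring A -> A a -> A b -> A (a - b).
Proof. by move=> sA Aa Ab; case: (sA.2 _ _ Aa Ab). Qed.

Lemma subringM A a b : subring A -> A a -> A b -> A (a * b).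
Proof. by move=> sA Aa Ab; case: (sA.2 _ _ Aa Ab). Qed.

Lemma subringX A a n : subring A -> A a -> A (a ^+ n).
Proof.
move=> sA Aa; elim: n => [|n IHn]; first exact: sA.1.
by rewrite exprS; exact: subringM.
Qed.

Lemma subring_sum A (I : Type) (r : seq I) (P : pred I) (f : I -> F) :
  subring A -> (forall i, P i -> A (f i)) -> A (\sum_(i <- r | P i) f i).
Proof.
move=> sA Af; elim/big_ind: _ => //; first exact: subring0.
by move=> a b; exact: subringD.
Qed.

Definition adjoin C h : set F :=
  [set a | exists2 p : {poly F}, forall k, C p`_k & a = p.[h]].

Lemma adjoin_subring C h : subring C -> subring (adjoin C h).
Proof.
move=> sC; split.
  exists 1; last by rewrite hornerC.
  by move=> k; rewrite coef1; case: (k == _); [exact: sC.1|exact: subring0].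
move=> _ _ [p Cp ->] [q Cq ->]; split.
  by exists (p - q) => [k|]; rewrite ?hornerE// coefB; exact: subringB.
exists (p * q) => [k|]; last by rewrite hornerM.
by rewrite coefM; apply: subring_sum => // i _; exact: subringM.
Qed.

Lemma sub_adjoin C h : subring C -> C `<=` adjoin C h.
Proof.
move=> sC c Cc; exists c%:P; last by rewrite hornerC.
by move=> k; rewrite coefC; case: (k == _) => //; exact: subring0.
Qed.

Lemma adjoin_gen C h : subring C -> adjoin C h h.
Proof.
move=> sC; exists 'X; last by rewrite hornerX.
by move=> k; rewrite coefX; case: (k == _); [exact: sC.1|exact: subring0].
Qed.

Definition valuation_ring V := subring V /\ forall h, h != 0 -> V h \/ V h^-1.

(* Eliminating the leading term of p by means of q, one gets relations
   of ever smaller degree. *)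
Lemma no_two_relations C s h (p q : {poly F}) : subring C -> C s -> s != 0 ->
  ~ C s^-1 -> h != 0 -> (forall k, C p`_k) -> (forall k, C q`_k) ->
  p.[h] = s^-1 -> q.[h^-1] = s^-1 -> False.
Proof.
move=> sC Cs s0 nCs; move: {2}(size p + size q)%N (leqnn (size p + size q)) => N.
elim: N h p q => [|N IHN] h p q szN h0 Cp Cq ph qh.
  have /eqP : size p = 0%N by lia.
  rewrite size_poly_eq0 => /eqP p0; move: ph; rewrite p0 horner0.
  by move/esym/eqP; rewrite invr_eq0 (negPf s0).
(* Exchanging h and h^-1 exchanges p and q. *)
wlog qp : h p q szN h0 Cp Cq ph qh / (size q <= size p)%N.
  move=> W; have [|/ltnW] := leqP (size q) (size p); first exact: (W h p q).
  by apply: (W h^-1 q p); rewrite ?invrK ?invr_eq0// addnC.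
have [q1|q1] := leqP (size q) 1.
  apply: nCs; rewrite -qh (size1_polyC q1) hornerC; exact: Cq.
have [m qm] : exists m, size q = m.+2 by exists (size q).-2; lia.
have [n pn] : exists n, size p = n.+1 by exists (size p).-1; lia.
have mn : (m.+1 <= n)%N by lia.
pose p' := \poly_(k < n) p`_k; pose r := \poly_(j < m.+1) q`_(m.+1 - j).
have Cr k : C r`_k by rewrite coef_poly; case: ifP => _ //; exact: subring0.
have Cp' k : C p'`_k by rewrite coef_poly; case: ifP => _ //; exact: subring0.
(* The relation for q, multiplied by s h^(m+1); r is q reversed, without its constant term. *)
have hr : (1 - s * q`_0) * h ^+ m.+1 = s * r.[h].
  have : s^-1 * h ^+ m.+1 = q.[h^-1] * h ^+ m.+1 by rewrite qh.
  rewrite horner_coef qm big_ord_recl expr0 mulr1 mulrDl => e.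
  have -> : r.[h] = s^-1 * h ^+ m.+1 - q`_0 * h ^+ m.+1.
    rewrite e addrC addKr /r horner_poly mulr_suml (reindex_inj rev_ord_inj) /=.
    apply: eq_bigr => i _; rewrite /bump /= add1n.
    have lim : (i < m.+1)%N by [].
    have -> : (m.+1 - (m.+1 - i.+1) = i.+1)%N by lia.
    have -> : h ^+ m.+1 = h ^+ i.+1 * h ^+ (m.+1 - i.+1).
      by rewrite -exprD; congr (_ ^+ _); lia.
    by rewrite exprVn mulrA mulfVK// expf_neq0.
  by field.
have ph' : p.[h] = p'.[h] + p`_n * h ^+ n.
  by rewrite horner_coef pn big_ord_recr /= /p' horner_poly.
(* In s^-1 = q_0 + (1 - s q_0) s^-1, expand the last s^-1 as p(h) and rewrite its leading term by
   [hr]: p2 still takes the value s^-1, with smaller degree than p. *)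
pose p2 := (q`_0)%:P + (1 - s * q`_0) *: p' + (s * p`_n) *: ('X^(n - m.+1) * r).
have Cc : C (1 - s * q`_0) by apply: subringB (subringM _ _ _) => //; exact: sC.1.
apply: (IHN h p2 q) => //.
- have : (size p2 <= n)%N.
    rewrite /p2; apply: leq_trans (size_polyD _ _) _; rewrite geq_max; apply/andP; split.
      apply: leq_trans (size_polyD _ _) _; rewrite geq_max; apply/andP; split.
        by apply: leq_trans (size_polyC_leq1 _) _; lia.
      by apply: leq_trans (size_scale_leq _ _) _; exact: size_poly.
    apply: leq_trans (size_scale_leq _ _) _; apply: leq_trans (size_polyMleq _ _) _.
    by rewrite size_polyXn; have := size_poly m.+1 (fun j => q`_(m.+1 - j)); rewrite -/r; lia.
  lia.
- move=> k; rewrite !coefD !coefZ coefXnM; apply: subringD => //; last first.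
    apply: subringM => //; first exact: subringM.
    by case: ifP => _ //; exact: subring0.
  apply: subringD => //; last exact: subringM.
  by rewrite coefC; case: ifP => _ //; exact: subring0.
- rewrite /p2 !(hornerD, hornerZ, hornerM, hornerC, hornerXn).
  have -> : s * p`_n * (h ^+ (n - m.+1) * r.[h]) =
      (1 - s * q`_0) * (p`_n * h ^+ n).
    have -> : h ^+ n = h ^+ (n - m.+1) * h ^+ m.+1.
      by rewrite -exprD; congr (_ ^+ _); lia.
    transitivity (p`_n * h ^+ (n - m.+1) * (s * r.[h])); first by ring.
    by rewrite -hr; ring.
  have -> : p`_n * h ^+ n = s^-1 - p'.[h] by rewrite -ph ph' addrC addKr.
  by field.
Qed.

(** Take C maximal among the rings containing B but not s^-1. If it missed both h and h^-1, then
    s^-1 would be a polynomial in h and one in h^-1 over C, which [no_two_relations] excludes. *)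
Lemma exists_valuation_ring B s : subring B -> B s -> s != 0 -> ~ B s^-1 ->
  exists V, [/\ valuation_ring V, B `<=` V & ~ V s^-1].
Proof.
move=> sB Bs s0 nBs.
pose P C := C = set0 \/ [/\ subring C, B `<=` C & ~ C s^-1].
have [|C [PC maxC]] := @Zorn_bigcup F P.
  move=> Fm FmP tot.
  have [[C0 [FC0 C0ne]]|none] := pselect (exists C, Fm C /\ C !=set0); last first.
    left; apply/seteqP; split => // x [C FC Cx]; apply: none.
    by exists C; split => //; exists x.
  right; have good C x : Fm C -> C x -> [/\ subring C, B `<=` C & ~ C s^-1].
    by move=> /FmP [->|].
  case: C0ne => x0 C0x0; have [sC0 BC0 _] := good _ _ FC0 C0x0.
  split; [split|..].
  - by exists C0 => //; exact: sC0.1.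
  - move=> a b [Ca FCa Caa] [Cb FCb Cbb].
    have [ab|ba] := tot _ _ FCa FCb.
      have [[_ sC] _ _] := good _ _ FCb Cbb.
      by have [? ?] := sC _ _ (ab _ Caa) Cbb; split; exists Cb.
    have [[_ sC] _ _] := good _ _ FCa Caa.
    by have [? ?] := sC _ _ Caa (ba _ Cbb); split; exists Ca.
  - by move=> b /BC0 Cb; exists C0.
  - by move=> [C FC Cs]; have [_ _ /(_ Cs)] := good _ _ FC Cs.
case: PC => [C0|[sC BC nCs]].
  exfalso; apply: (maxC B); last by right; split.
  by rewrite C0; split=> [x []|/(_ _ Bs) []].
exists C; split => //; split => // h h0.
apply: contrapT => /not_orP [nCh nCh'].
have adj k : ~ C k -> adjoin C k s^-1.
  move=> nCk; apply: contrapT => nad; apply: (maxC (adjoin C k)).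
    split; first exact: sub_adjoin.
    by move/(_ _ (adjoin_gen _ sC)).
  right; split => //; first exact: adjoin_subring.
  by move=> x /BC; exact: sub_adjoin.
have [p Cp ph] := adj _ nCh; have [q Cq qh] := adj _ nCh'.
exact: (no_two_relations sC (BC _ Bs) s0 nCs h0 Cp Cq (esym ph) (esym qh)).
Qed.

End ValuationRings.

(** * Linear algebra over K modulo a subspace *)

Section LinearAlgebra.
Variables (K F : fieldType) (e : {rmorphism K -> F}).
Implicit Types V W : set F.

Definition ksubspace W :=
  [/\ W 0, forall a b, W a -> W b -> W (a + b) & forall c a, W a -> W (e c * a)].

Definition lcomb m (c : 'I_m -> K) (a : 'I_m -> F) : F := \sum_i e (c i) * a i.

Definition indep_mod W m (a : 'I_m -> F) :=
  forall c : 'I_m -> K, W (lcomb c a) -> forall i, c i = 0.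

Lemma ksubspaceN W a : ksubspace W -> W a -> W (- a).
Proof. by case=> _ _ WZ /(WZ (-1)); rewrite rmorphN rmorph1 mulN1r. Qed.

Lemma ksubspaceB W a b : ksubspace W -> W a -> W b -> W (a - b).
Proof. by move=> sW Wa /(ksubspaceN sW); case: sW => _ WD _; exact: WD. Qed.

Lemma ksubspace_sum W (I : Type) (r : seq I) (P : pred I) (f : I -> F) :
  ksubspace W -> (forall i, P i -> W (f i)) -> W (\sum_(i <- r | P i) f i).
Proof. by case=> W0 WD _ Wf; elim/big_ind: _. Qed.

Lemma ksubspace_lcomb W m (c : 'I_m -> K) (a : 'I_m -> F) :
  ksubspace W -> (forall i, W (a i)) -> W (lcomb c a).
Proof.
by move=> sW Wa; apply: ksubspace_sum => // i _; case: sW => _ _; apply.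
Qed.

(** If m > n, the coordinate matrix of the a_j has a nonzero vector in its left kernel, that is, a
    linear relation modulo W. *)
Lemma indep_mod_le V W n m (b : 'I_n -> F) (a : 'I_m -> F) : ksubspace W ->
  (forall v, V v -> exists c : 'I_n -> K, W (v - lcomb c b)) ->
  (forall j, V (a j)) -> indep_mod W a -> (m <= n)%N.
Proof.
move=> sW gen Va ia; rewrite leqNgt; apply/negP => nm.
have [c cP] := choice (fun j => gen _ (Va j)).
pose C := \matrix_(j < m, i < n) c j i.
have kC : kermx C != 0.
  rewrite -mxrank_eq0 mxrank_ker -lt0n subn_gt0.
  exact: leq_ltn_trans (rank_leq_col C) nm.
have [j kj] : exists j, row j (kermx C) != 0.
  apply: contrapT => none; move/negP: kC; apply; apply/eqP/row_matrixP => j.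
  by rewrite row0; apply: contrapT => /eqP ?; apply: none; exists j.
pose r := row j (kermx C).
have rC : r *m C = 0 by apply/sub_kermxP; exact: row_sub.
have : forall i, r ord0 i = 0.
  apply: ia; have -> : lcomb (r ord0) a =
      \sum_k e (r ord0 k) * (a k - lcomb (c k) b).
    rewrite (eq_bigr (fun k => e (r ord0 k) * a k - e (r ord0 k) * lcomb (c k) b)).
      rewrite big_split /= sumrN (_ : \sum_k _ * lcomb _ _ = 0) ?subr0//.
      under eq_bigr do rewrite mulr_sumr; rewrite exchange_big big1//= => i _.
      under eq_bigr do rewrite mulrA -rmorphM.
      rewrite -mulr_suml -rmorph_sum/=.
      have rCi : \sum_k r ord0 k * c k i = 0.
        have /matrixP/(_ ord0 i) := rC; rewrite [LHS]mxE [RHS]mxE; apply: etrans.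
        by apply: eq_bigr => k _; rewrite [C _ _]mxE.
      by rewrite rCi rmorph0 mul0r.
    by move=> k _; rewrite mulrBr.
  apply: ksubspace_sum => // k _; case: sW => _ _; apply; exact: cP.
move=> r0; move/negP: kj; apply; apply/eqP/rowP => i.
by rewrite [RHS]mxE; exact: r0.
Qed.

(** A longest independent family spans. The bound is what makes the choices in [res_deg] and [kdim]
    genuine dimensions rather than the default 0. *)
Lemma quot_dim_exists V W B : ksubspace W ->
  (forall m (a : 'I_m -> F), (forall j, V (a j)) -> indep_mod W a -> (m <= B)%N) ->
  exists2 n, (n <= B)%N & quot_dim (fun c h => e c * h) V W n.
Proof.
move=> sW bnd.
pose P n := `[< exists a : 'I_n -> F, (forall j, V (a j)) /\ indep_mod W a >].
have P0 : exists n, P n.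
  by exists 0%N; apply/asboolP; exists (fun=> 0); split; [case|move=> c _ []].
have Pb n : P n -> (n <= B)%N by move/asboolP => [a [? ?]]; exact: (bnd _ a).
case: (ex_maxnP P0 Pb) => n /asboolP [a [Va ia]] maxn.
exists n; first by apply: (bnd _ a).
exists a; split => // v Vv; apply: contrapT => nspan.
suff : P n.+1 by move/maxn; rewrite ltnn.
pose a' (i : 'I_n.+1) := oapp a v (unlift ord_max i).
have a'l i : a' (widen_ord (leqnSn n) i) = a i.
  rewrite /a' (_ : widen_ord _ _ = lift ord_max i) ?liftK//.
  by apply: val_inj; rewrite /= /bump leqNgt ltn_ord.
have a'm : a' ord_max = v by rewrite /a' unlift_none.
apply/asboolP; exists a'; split.
  by move=> j; rewrite /a'; case: unlift.
move=> c; rewrite /lcomb big_ord_recr /= a'm.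
under eq_bigr do rewrite a'l.
move=> Wc; have cm : c ord_max = 0.
  apply: contrapT => /eqP cm; apply: nspan.
  exists (fun i => - (c ord_max)^-1 * c (widen_ord (leqnSn n) i)).
  case: (sW) => _ _ /(_ (c ord_max)^-1 _ Wc).
  rewrite mulrDr mulrA -rmorphM mulVf// rmorph1 mul1r mulr_sumr.
  rewrite addrC -sumrN; congr (W (_ + _)); apply: eq_bigr => i _.
  by rewrite rmorphM rmorphN; ring.
move: Wc; rewrite cm rmorph0 mul0r addr0 => Wc i.
have [il|] := ltnP i n.
  have := ia (fun i => c (widen_ord (leqnSn n) i)) Wc (Ordinal il).
  by move=> <-; congr c; exact: val_inj.
move=> ni; rewrite -cm; congr c; apply: val_inj => /=.
by apply/eqP; rewrite eqn_leq ni andbT -ltnS.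
Qed.

End LinearAlgebra.

(** * Discrete valuation rings inside a field *)

Section DiscreteValuationRings.
Variable F : fieldType.
Implicit Types (O V : set F) (h u pi : F).

Definition uniformizer O pi := [/\ subring O, O pi, ~ O pi^-1
  & forall h, h != 0 -> exists n : int, exists2 u, is_unit O u & h = u * pi ^ n].

Lemma is_unit1 O : subring O -> is_unit O 1.
Proof. by move=> [HO1 _]; split; rewrite ?oner_neq0 ?invr1. Qed.

Lemma is_unitM O u v : subring O -> is_unit O u -> is_unit O v -> is_unit O (u * v).
Proof.
move=> sO [u0 Ou Ou'] [v0 Ov Ov']; split; first by rewrite mulf_neq0.
  exact: subringM.
by rewrite invfM; exact: subringM.
Qed.

Lemma is_unitV O u : is_unit O u -> is_unit O u^-1.
Proof. by move=> [u0 Ou Ou']; split; rewrite ?invr_eq0 ?invrK. Qed.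

Lemma is_unitXz O u n : subring O -> is_unit O u -> is_unit O (u ^ n).
Proof.
move=> sO uu; have uX k : is_unit O (u ^+ k).
  elim: k => [|k IHk]; first by rewrite expr0; exact: is_unit1.
  by rewrite exprS; exact: is_unitM.
case: n => n; first exact: uX.
by rewrite NegzE -exprnN; exact: is_unitV.
Qed.

Section Uniformizer.
Variables (O : set F) (pi : F).
Hypothesis Opi : uniformizer O pi.

Let sO : subring O. Proof. by case: Opi. Qed.

Lemma uniformizer_neq0 : pi != 0.
Proof.
case: Opi => _ _ nO _; apply/eqP => pi0; apply: nO.
by rewrite pi0 invr0; exact: subring0.
Qed.

Let pi0 := uniformizer_neq0.

Lemma uniformizer_mem u n : is_unit O u -> O (u * pi ^ n) <-> (0 <= n)%R.
Proof.
case: Opi => _ Opi1 nOpi _ [u0 Ou Ou']; split; last first.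
  by case: n => // n _; apply: subringM => //; exact: subringX.
rewrite leNgt => Oun; apply/negP => n0; apply: nOpi.
have -> : pi^-1 = u * pi ^ n * u^-1 * pi ^ (- n - 1).
  by rewrite [u * _]mulrC mulfK// -expfzDr// addrA subrr sub0r.
apply: subringM => //; first exact: subringM.
have : (0 <= - n - 1)%R by lia.
by case: (- n - 1) => // k _; exact: subringX.
Qed.

Lemma uniformizer_max : max_ideal O = [set a * pi | a in O].
Proof.
case: Opi => _ Opi1 nOpi dec; apply/seteqP; split => h; last first.
  move=> [a Oa <-]; split; first exact: subringM.
  move=> [ap0 _]; rewrite invfM => Oap; apply: nOpi.
  have /negPf a0 : a != 0 by apply: contraNneq ap0 => ->; rewrite mul0r.
  by have := subringM sO Oa Oap; rewrite mulrA divff ?a0// mul1r.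
move=> [hO nu]; have [->|h0] := eqVneq h 0.
  by exists 0; rewrite ?mul0r//; exact: subring0.
have [n [u uu hE]] := dec _ h0.
have n0 : (0 <= n)%R by apply/(uniformizer_mem n uu); rewrite -hE.
have n1 : (1 <= n)%R.
  rewrite -gtz0_ge1 lt_neqAle n0 andbT; apply: contra_notN nu => /eqP n00.
  by rewrite hE -n00 expr0z mulr1.
exists (u * pi ^ (n - 1)); first by apply/(uniformizer_mem _ uu); lia.
by rewrite -mulrA -[X in _ * (_ * X)]expr1z -expfzDr// subrK hE.
Qed.

Lemma uniformizer_inj u v m n : is_unit O u -> is_unit O v ->
  u * pi ^ m = v * pi ^ n -> m = n.
Proof.
move=> uu uv e.
have key u' v' m' n' : is_unit O u' -> is_unit O v' ->
    u' * pi ^ m' = v' * pi ^ n' -> (m' <= n')%R.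
  move=> uu' [v0 Ov Ov'] e'.
  rewrite -subr_ge0; apply/(uniformizer_mem _ (is_unitV uu')).
  have pm : pi ^ m' != 0 by rewrite expfz_neq0.
  rewrite expfzDr// -[pi ^ n'](mulKf v0) -e' -invr_expz.
  have -> : u'^-1 * (v'^-1 * (u' * pi ^ m') * (pi ^ m')^-1) = v'^-1 => //.
  by case: uu' => u0 _ _; field; rewrite v0 u0 pm.
by apply/eqP; rewrite eq_le (key u v) ?(key v u).
Qed.

(** [ord_of] picks some generator of the maximal ideal. It and pi divide each other, hence differ by
    a unit and define the same exponent. *)
Lemma ord_ofE u n : is_unit O u -> ord_of O (u * pi ^ n) = n.
Proof.
move=> uu; rewrite /ord_of; case: xgetP => [m _ [pi' [v [maxE uv e]]]|]; last first.
  by move=> /(_ n); case; exists pi, u; rewrite uniformizer_max.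
have : max_ideal O pi' by rewrite maxE; exists 1; rewrite ?mul1r//; exact: sO.1.
rewrite uniformizer_max => -[a Oa pi'E].
have : max_ideal O pi by rewrite uniformizer_max; exists 1; rewrite ?mul1r//; exact: sO.1.
rewrite maxE => -[b Ob piE].
have ab : b * a = 1.
  by apply: (mulIf pi0); rewrite -mulrA pi'E piE mul1r.
have a0 : a != 0 by apply: contra_eq_neq ab => ->; rewrite mulr0 eq_sym oner_neq0.
have ua : is_unit O a.
  by split => //; rewrite (_ : a^-1 = b)//; apply: (mulIf a0); rewrite mulVf.
move: e; rewrite -pi'E expfzMl mulrA => /esym.
apply: uniformizer_inj => //.
by apply: is_unitM => //; exact: is_unitXz.
Qed.

Lemma ord_of_decomp h : h != 0 -> exists2 u, is_unit O u & h = u * pi ^ ord_of O h.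
Proof.
case: Opi => _ _ _ dec /dec [n [u uu ->]].
by exists u; rewrite // ord_ofE.
Qed.

Lemma ord_ofM h k : h != 0 -> k != 0 -> ord_of O (h * k) = ord_of O h + ord_of O k.
Proof.
move=> /ord_of_decomp [u uu hE] /ord_of_decomp [v uv kE].
rewrite {1}hE {1}kE mulrACA -expfzDr// ord_ofE//; exact: is_unitM.
Qed.

Lemma ord_of1 : ord_of O 1 = 0.
Proof. by have := ord_ofE 0 (is_unit1 sO); rewrite mul1r expr0z. Qed.

Lemma ord_ofV h : h != 0 -> ord_of O h^-1 = - ord_of O h.
Proof.
move=> h0; apply: (addIr (ord_of O h)); rewrite addNr -ord_of1.
by rewrite -(mulVf h0) ord_ofM// invr_eq0.
Qed.

Lemma ord_of_mem h : h != 0 -> O h <-> (0 <= ord_of O h)%R.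
Proof. by move=> /ord_of_decomp [u uu hE]; rewrite {1}hE; exact: uniformizer_mem. Qed.

Lemma ord_of_max h : h != 0 -> max_ideal O h <-> (0 < ord_of O h)%R.
Proof.
move=> h0; have hV := ord_ofV h0.
split=> [[/(ord_of_mem h0) oh nu]|oh].
  rewrite lt_neqAle oh andbT; apply: contra_notN nu => /eqP o0.
  split => //; first by apply/(ord_of_mem h0); rewrite -o0.
  by apply/ord_of_mem; rewrite ?invr_eq0// hV -o0 oppr0.
split; first by apply/(ord_of_mem h0); exact: ltW.
move=> [_ _ /ord_of_mem]; rewrite invr_eq0 => /(_ h0).
by rewrite hV oppr_ge0 leNgt oh.
Qed.

(** An element of V of negative order puts pi^-1 in V, and O together with pi^-1 generates F. *)
Lemma uniformizer_maximal V : subring V -> O `<=` V -> V != setT -> V = O.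
Proof.
move=> sV OV VT; apply/seteqP; split => // h Vh.
have [->|h0] := eqVneq h 0; first exact: subring0.
have [u uu hE] := ord_of_decomp h0.
apply/(ord_of_mem h0); rewrite leNgt; apply/negP => oh.
move/eqP: VT; apply; apply/seteqP; split => // k _.
case: Opi => _ Opi1 _ dec.
have Vpi : V pi^-1.
  have -> : pi^-1 = h * u^-1 * pi ^ (- ord_of O h - 1).
    rewrite {1}hE [u * _]mulrC mulfK -?expfzDr ?(uniformizer_neq0 Opi)//; last by case: uu.
    by rewrite addrA subrr sub0r.
  apply: subringM => //; first by apply: subringM => //; apply: OV; case: uu.
  have : (0 <= - ord_of O h - 1)%R by lia.
  by case: (- ord_of O h - 1) => // n _; apply: subringX => //; exact: OV.
have [->|k0] := eqVneq k 0; first exact: subring0.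
have [n [v [_ Ov _] ->]] := dec _ k0.
apply: subringM; [by []|exact: OV|].
case: n => n; first by apply: subringX => //; exact: OV.
by rewrite NegzE -exprnN -exprVn; exact: subringX.
Qed.

End Uniformizer.
End DiscreteValuationRings.

(** * Local rings of closed points *)

Section Stalks.
Variables (K : fieldType) (X : proj_scheme K).
Local Notation F := (ffield X).
Local Notation pt := (Defs.point X).
Implicit Types (x y : pt) (h : F) (i j : 'I_(pdim X).+1).

Lemma chart_subring i : subring (chart i).
Proof.
split=> [B [[sB _] _]|a b ca cb]; first exact: sB.1.
by split=> B BP; have [[sB _] _] := BP; [apply: subringB|apply: subringM];
  by [|exact: ca|exact: cb].
Qed.

Lemma chart_const i c : chart i (emb X c).
Proof. by move=> B [[_ Bc] _]. Qed.

Lemma chart_gen i j : chart i (hcoord j / hcoord i).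
Proof. by move=> B [_]; apply; exists j. Qed.

Lemma chart_min i (B : set F) : subring B -> (forall c, B (emb X c)) ->
  (forall j : 'I_(pdim X).+1, B (hcoord j / hcoord i)) -> chart i `<=` B.
Proof. by move=> sB cB gB h; apply; split=> // _ [j _ <-]. Qed.

Lemma localization_subring (A p : set F) : subring A -> prime_ideal A p ->
  subring (localization A p).
Proof.
move=> sA [[pA p0 pD pM] p1 pP]; split.
  by exists 1, 1; split; rewrite ?divr1//; exact: sA.1.
have nz b : ~ p b -> b != 0 by move=> nb; apply/eqP => b0; apply: nb; rewrite b0.
move=> _ _ [a [b [Aa Ab nb ->]]] [c [d [Ac Ad nd ->]]].
have nbd : ~ p (b * d) by move=> /pP [].
have [b0 d0] := (nz _ nb, nz _ nd); split.
  exists (a * d - c * b), (b * d); split => //; last by field; rewrite b0 d0.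
    by apply: subringB => //; exact: subringM.
  exact: subringM.
exists (a * c), (b * d); split => //; last by field; rewrite b0 d0.
  exact: subringM.
exact: subringM.
Qed.

Lemma sub_localization (A p : set F) : subring A -> prime_ideal A p ->
  A `<=` localization A p.
Proof.
by move=> sA [_ p1 _] a Aa; exists a, 1; split; rewrite ?divr1//; exact: sA.1.
Qed.

Lemma stalk_subring x : subring (stalk x).
Proof.
case: (stalkP x) => i [p [_ pp ->]]; apply: localization_subring => //.
exact: chart_subring.
Qed.

Lemma stalk_const x c : stalk x (emb X c).
Proof.
case: (stalkP x) => i [p [_ pp ->]].
by apply: sub_localization => //; [exact: chart_subring|exact: chart_const].
Qed.

Lemma stalk_frac x h : exists a b, [/\ stalk x a, stalk x b, b != 0 & h = a / b].
Proof.
case: (stalkP x) => i [p [zi pp ->]].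
have [a [b [ca cb b0 ->]]] := hcoord_frac zi h.
by exists a, b; split => //; apply: sub_localization => //; exact: chart_subring.
Qed.

Lemma point_eq x y : stalk x = stalk y -> x = y.
Proof.
case: x y => [A pA] [B pB] /= e; case: _ / e pB => pB.
by congr Point; exact: Prop_irrelevance.
Qed.

(** Localizing A_p at q amounts to localizing A at the contraction of q, since the elements of A
    outside p are units of A_p and so avoid q. *)
Lemma stalk_prime x (q : set F) : prime_ideal (stalk x) q ->
  exists y, stalk y = localization (stalk x) q.
Proof.
case: (stalkP x) => i [p [zi pp xE]]; rewrite xE => pq.
have sA := chart_subring i; have AO := sub_localization sA pp.
have sO := localization_subring sA pp.
case: (pq) => -[qO q0 qD qM] q1 qP.
have pA : prime_ideal (chart i) (chart i `&` q).
  split; last 1 first.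
  - move=> a b Aa Ab [_ qab].
    by have [qa|qb] := qP _ _ (AO _ Aa) (AO _ Ab) qab; [left|right].
  - split; [by move=> ? []|by split => //; exact: (subring0 sA)|..].
      by move=> a b [Aa qa] [Ab qb]; split; [exact: (subringD sA)|exact: qD].
    by move=> a b Aa [Ab qb]; split; [exact: (subringM sA)|apply: qM => //; exact: AO].
  - by move=> [].
have lP : is_local_ring (localization (chart i) (chart i `&` q)).
  by exists i, (chart i `&` q).
exists (Point lP) => /=; apply/seteqP; split => h.
  move=> [a [b [Aa Ab nb ->]]]; exists a, b; split => //; try exact: AO.
  by move=> qb; apply: nb.
case: pp => -[pA' p0 pD pM] p1 pP.
have nzp b : ~ p b -> b != 0 by move=> nb; apply/eqP => b0; apply: nb; rewrite b0.
have nzq b : ~ q b -> b != 0 by move=> nb; apply/eqP => b0; apply: nb; rewrite b0.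
move=> [_ [_ [[a [b [Aa Ab nb ->]]] [c [d [Ac Ad nd ->]]] nq ->]]].
have [b0 d0] := (nzp _ nb, nzp _ nd).
have c0 : c != 0 by have := nzq _ nq; apply: contraNneq => ->; rewrite mul0r.
have nqu e : chart i e -> ~ p e -> ~ q e.
  move=> Ae ne qe; apply: q1; rewrite -(divff (nzp _ ne)) mulrC; apply: qM => //.
  by exists 1, e; split; rewrite ?mul1r//; exact: sA.1.
exists (a * d), (b * c); split; [exact: (subringM sA)|exact: (subringM sA)| |].
  move=> [_ qbc]; have [|qc] := qP _ _ (AO _ Ab) (AO _ Ac) qbc; first exact: nqu.
  apply: nq; rewrite mulrC; apply: qM => //.
  by exists 1, d; split; rewrite ?mul1r//; exact: sA.1.
by field; rewrite b0 d0 c0.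
Qed.

Lemma zariski_openE (U : set pt) : open U = zariski_open U.
Proof. by []. Qed.

(** This set is the closure of x: a specialization of x has a smaller local ring. *)
Lemma specializations_closed x : closed [set y : pt | stalk y `<=` stalk x].
Proof.
rewrite -openC zariski_openE => y /= nyx.
have [h [yh nh]] : exists h, stalk y h /\ ~ stalk x h.
  by apply: contrapT => none; apply: nyx => h yh; apply: contrapT => nh; apply: none; exists h.
exists [:: h]; split; first by move=> k; rewrite inE => /eqP ->.
by move=> z /= zh zx; apply/nh/zx/zh; rewrite inE.
Qed.

Lemma specializations_irreducible x :
  irreducible_set [set y : pt | stalk y `<=` stalk x].
Proof.
split; first by exists x.
suff key (A B : set pt) : closed A -> A x -> [set y : pt | stalk y `<=` stalk x] `<=` A.
  move=> A B cA cB xAB; have [Ax|Bx] := xAB x (fun _ => id).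
    by left; exact: key.
  by right; exact: key.
rewrite -openC zariski_openE => oA Ax y yx; apply: contrapT => nAy.
have [s [sy sA]] := oA y nAy.
by apply: (sA x) => // h hs; exact/yx/sy.
Qed.

Hypotheses (X_curve : has_dimension X 1) (X_regular : regular_scheme X).

(** Localizing at larger primes gives smaller rings, hence smaller closures: a chain of primes read
    backwards is a chain of irreducible closed sets. *)
Lemma no_prime_chain x : ~ has_chain (prime_ideal (stalk x)) 2.
Proof.
move=> [q [pq sq]]; case: X_curve => _; apply.
have /choice[w wP] k : exists y : pt, (k <= 2)%N ->
    stalk y = localization (stalk x) (q k).
  have [k2|k2] := leqP k 2; last by exists x.
  by have [y yE] := stalk_prime (pq k k2); exists y.
exists (fun k => [set y : pt | stalk y `<=` stalk (w (2 - k)%N)]); split.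
  by move=> k _; split; [exact: specializations_closed|exact: specializations_irreducible].
move=> k k2; have kE : (2 - k = (2 - k.+1).+1)%N by lia.
have [l2 l3] : (2 - k.+1 < 2)%N /\ ((2 - k.+1).+1 <= 2)%N by lia.
rewrite kE; move: (2 - k.+1)%N l2 l3 => l l2 l3.
have [sql nsql] := sq l l2.
have w1 : stalk (w l.+1) = _ := wP _ l3.
have w0 : stalk (w l) = _ := wP _ (ltnW l2).
have sw : stalk (w l.+1) `<=` stalk (w l).
  rewrite w1 w0 => h [a [b [Oa Ob nb ->]]]; exists a, b; split => //.
  by move/sql.
split; first by move=> y yl; exact: subset_trans yl sw.
move=> /(_ (w l) (fun _ => id)) /=; rewrite w1 w0; apply/existsNP.
have [a [qa nqa]] : exists a, q l.+1 a /\ ~ q l a.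
  by apply: contrapT => none; apply: nsql => a qa; apply: contrapT => nqa; apply: none; exists a.
have [[qO q0 qD qM] q1 qP] := pq _ l3; have [[_ ql0 _ _] _ _] := pq _ (ltnW l2).
have a0 : a != 0 by apply/eqP => a0; apply: nqa; rewrite a0.
exists a^-1 => /(_ _)-[].
  exists 1, a; split; rewrite ?mul1r//; [exact: (stalk_subring x).1|exact: qO].
move=> u [v [Ou Ov nv e]]; apply: nv.
have -> : v = u * a.
  have v0 : v != 0.
    by apply/eqP => v0; move: e; rewrite v0 invr0 mulr0 => /eqP; rewrite invr_eq0 (negPf a0).
  by rewrite -[v]mulr1 -(divff a0) e; field; rewrite v0.
exact: qM.
Qed.

Lemma has_chainW (T : Type) (P : set (set T)) m n :
  (m <= n)%N -> has_chain P n -> has_chain P m.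
Proof.
move=> mn [c [Pc sc]]; exists c; split=> i im.
  by apply: Pc; exact: leq_trans mn.
by apply: sc; exact: leq_trans mn.
Qed.

Lemma stalk_units_setT x :
  (forall h, h != 0 -> stalk x h -> is_unit (stalk x) h) -> stalk x = setT.
Proof.
move=> U; apply/seteqP; split=> // h _.
have [a [b [Oa Ob b0 ->]]] := stalk_frac x h.
by apply: subringM (stalk_subring x) Oa _; case: (U _ b0 Ob).
Qed.

(** Regularity generates the maximal ideal m by d elements, d being the length of prime chains, so d
    <= 1 on a curve. For d = 1 the intersection q of the powers of m is prime; were it nonzero, 0 <
    q < m would be a chain of length 2. Hence q = 0, and every nonzero element is divisible by an
    exact power of pi. *)
Lemma stalk_uniformizer x :
  stalk x = setT \/ exists pi, uniformizer (stalk x) pi.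
Proof.
have sO := stalk_subring x.
have [nT|nT] := pselect (stalk x = setT); [by left|right].
have [h0 [h00 mh0]] : exists h, h != 0 /\ max_ideal (stalk x) h.
  apply: contrapT => none; apply: nT; apply: stalk_units_setT => h h0 xh.
  by apply: contrapT => nu; apply: none; exists h.
have [[|[|d]] [[ch _] [g gE]]] := X_regular x.
- by move: mh0; rewrite gE => -[c [_]]; rewrite big_ord0 => /eqP; rewrite (negPf h00).
- pose pi := g ord0.
  have mE h : max_ideal (stalk x) h <-> exists2 c, stalk x c & h = c * pi.
    rewrite gE; split=> [[c [Oc ->]]|[c Oc ->]]; last first.
      by exists (fun=> c); rewrite big_ord1.
    by exists (c ord0); rewrite ?big_ord1.
  have pi0 : pi != 0.
    apply/eqP => p0; move/mE: mh0 => [c _]; rewrite p0 mulr0 => /eqP.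
    by rewrite (negPf h00).
  have [Opi npi] : max_ideal (stalk x) pi by apply/mE; exists 1; rewrite ?mul1r//; exact: sO.1.
  have {}npi : ~ stalk x pi^-1 by move=> Opi'; apply: npi.
  (* The intersection of the powers of the maximal ideal. For h outside q, the quotient of h by the
     highest power of pi dividing it is a unit. *)
  pose q := [set h | forall n, exists2 a, stalk x a & h = a * pi ^+ n].
  have dec h : stalk x h -> ~ q h -> exists n, exists2 u, is_unit (stalk x) u & h = u * pi ^+ n.
    move=> Oh /existsNP nq.
    have exn : exists n, `[< ~ exists2 a, stalk x a & h = a * pi ^+ n >].
      by case: nq => n nq; exists n; apply/asboolP.
    case: (ex_minnP exn) => -[|n] /asboolP nn minn.
      by exfalso; apply: nn; exists h; rewrite ?expr0 ?mulr1.
    have [a Oa hE] : exists2 a, stalk x a & h = a * pi ^+ n.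
      apply: contrapT => nq'; have := minn n; rewrite ltnn => W.
      by have : false by apply: W; apply/asboolP.
    exists n, a => //; apply: contrapT => nu; apply: nn.
    have /mE [c Oc aE] : max_ideal (stalk x) a by split.
    by exists c; rewrite // hE aE exprS mulrA.
  have q1 : ~ q pi.
    move=> /(_ 2%N) [a Oa]; rewrite expr2 mulrA -{1}[pi]mul1r => /(mulIf pi0) e.
    apply: npi; suff -> : pi^-1 = a by [].
    by apply: (mulIf pi0); rewrite mulVf.
  have q0 h : q h -> h = 0.
    move=> qh; apply: contrapT => /eqP hn0; apply: (@no_prime_chain x).
    exists (fun k => if k is k'.+1 then if k' is _.+1 then max_ideal (stalk x) else q else [set 0]).
    split=> [[|[|[|//]]] _|[|[|//]] _].
    + split; last 1 first.
      * by move=> a b _ _ /eqP; rewrite mulf_eq0 => /orP[] /eqP; [left|right].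
      * split; [by move=> _ ->; exact: (subring0 sO)|by []|..].
          by move=> a b -> ->; rewrite /= addr0.
        by move=> a b _ ->; rewrite /= mulr0.
      * by move=> /eqP; rewrite oner_eq0.
    + split; last 1 first.
      * move=> a b Oa Ob qab; apply: contrapT => /not_orP [nqa nqb].
        have [m [u uu aE]] := dec _ Oa nqa; have [n [v uv bE]] := dec _ Ob nqb.
        have [c Oc] := qab (m + n).+1.
        have [_ _ uv'] := is_unitM sO uu uv; have [uv0 _ _] := is_unitM sO uu uv.
        rewrite aE bE mulrACA -exprD exprS mulrA => /(mulIf (expf_neq0 _ pi0)) e.
        apply: npi; have -> : pi^-1 = (u * v)^-1 * c.
          by apply: (mulfI uv0); rewrite mulrA divff// mul1r {1}e mulfK.
        exact: (subringM sO).
      * split.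
        - by move=> a /(_ 0%N) [b Ob ->]; rewrite expr0 mulr1.
        - by move=> n; exists 0; rewrite ?mul0r//; exact: (subring0 sO).
        - move=> a b qa qb n; have [c Oc ->] := qa n; have [d Od ->] := qb n.
          by exists (c + d); rewrite ?mulrDl//; exact: (subringD sO).
        - move=> a b Oa qb n; have [d Od ->] := qb n.
          by exists (a * d); rewrite ?mulrA//; exact: (subringM sO).
      * move=> /(_ 1%N) [a Oa]; rewrite expr1 => e; apply: npi.
        by rewrite -[pi^-1]mul1r e mulfK.
    + split; last 1 first.
      * move=> a b Oa Ob mab; apply: contrapT => /not_orP [na nb].
        have [ua ub] : is_unit (stalk x) a /\ is_unit (stalk x) b.
          by split; apply: contrapT => nu; [apply: na|apply: nb].
        by case: mab => _; apply; exact: is_unitM.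
      * split; [by move=> a []|apply/mE; exists 0; rewrite ?mul0r//; exact: (subring0 sO)|..].
          move=> a b /mE [c Oc ->] /mE [d Od ->]; apply/mE.
          by exists (c + d); rewrite ?mulrDl//; exact: (subringD sO).
        move=> a b Oa /mE [d Od ->]; apply/mE.
        by exists (a * d); rewrite ?mulrA//; exact: (subringM sO).
      * by move=> [_]; apply; exact: is_unit1.
    + split=> [_ ->|]; last by move=> /(_ _ qh) /= /eqP; rewrite (negPf hn0).
      by move=> n; exists 0; rewrite ?mul0r//; exact: (subring0 sO).
    + split=> [a qa|]; last first.
        by move=> W; apply: q1; apply: W; apply/mE; exists 1; rewrite ?mul1r//; exact: sO.1.
      by have [c Oc ->] := qa 1%N; apply/mE; exists c; rewrite ?expr1.
  have decO h : stalk x h -> h != 0 -> exists n, exists2 u, is_unit (stalk x) u & h = u * pi ^+ n.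
    by move=> Oh hn0; apply: dec => // /q0 /eqP; rewrite (negPf hn0).
  exists pi; split => // h hn0.
  have [a [b [Oa Ob b0 hE]]] := stalk_frac x h.
  have a0 : a != 0 by move: hn0; rewrite hE; apply: contraNneq => ->; rewrite mul0r.
  have [m [u uu aE]] := decO _ Oa a0; have [n [v uv bE]] := decO _ Ob b0.
  exists (m%:Z - n%:Z), (u * v^-1); first exact: is_unitM (is_unitV _).
  rewrite hE aE bE expfzDr// -invr_expz invfM mulrACA.
  by [].
- by case: (@no_prime_chain x); apply: has_chainW ch.
Qed.

(** A point with local ring F lies in every nonempty open set; if closed, it would be the only
    point, against dimension 1. *)
Lemma closed_stalk_neqT (x : closed_point X) : stalk x <> setT.
Proof.
move=> xT; have clx := @cptP _ _ x.
have all y : y = x.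
  apply: contrapT => nyx; move: clx; rewrite -openC zariski_openE.
  move=> /(_ y nyx) [s [sy sx]]; apply: (sx x) => //.
  by move=> h _; rewrite xT.
case: X_curve => -[c [cP sc]] _.
have [_ n01] := sc 0%N isT; apply: n01 => y _.
by have [_ [[z cz] _]] := cP 0%N isT; rewrite (all y) -(all z).
Qed.

Lemma closed_uniformizer (x : closed_point X) : exists pi, uniformizer (stalk x) pi.
Proof. by case: (stalk_uniformizer x) => // /closed_stalk_neqT. Qed.

(** The local ring of a point in the closure of y lies inside [stalk y]. It is a discrete valuation
    ring, so it equals [stalk y] by maximality. *)
Lemma stalk_closed_point y : stalk y <> setT -> exists x : closed_point X, cpt x = y.
Proof.
move=> nT; case: (stalk_uniformizer y) => // -[pi upi].
suff cy : closed [set y] by exists (ClosedPoint cy).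
rewrite (_ : [set y] = [set z | stalk z `<=` stalk y]).
  exact: specializations_closed.
apply/seteqP; split=> z /=; first by move=> ->.
move=> zy; apply: point_eq; case: (stalk_uniformizer z) => [zT|[pi' upi']].
  by exfalso; apply: nT; apply/seteqP; split => // h _; apply: zy; rewrite zT.
apply/esym; apply: (uniformizer_maximal upi') => //; first exact: stalk_subring.
by apply/eqP.
Qed.

Lemma closed_point_eq (x y : closed_point X) : stalk x = stalk y -> x = y.
Proof.
move=> /point_eq; case: x y => [a ca] [b cb] /= e; case: _ / e cb => cb.
by congr ClosedPoint; exact: Prop_irrelevance.
Qed.

Lemma sub_stalk_eq (x y : closed_point X) : stalk x `<=` stalk y -> x = y.
Proof.
move=> xy; apply: closed_point_eq; have [pi upi] := closed_uniformizer x.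
symmetry; apply: (uniformizer_maximal upi) => //; first exact: stalk_subring.
by apply/eqP; exact: closed_stalk_neqT.
Qed.

Lemma closed_point_exists : exists x : closed_point X, True.
Proof.
case: X_curve => -[c [cP sc]] _.
have [s01 n01] := sc 0%N isT.
have [y [c1y nc0y]] : exists y, c 1%N y /\ ~ c 0%N y.
  apply: contrapT => none; apply: n01 => y c1y; apply: contrapT => nc0y.
  by apply: none; exists y.
have [_ [[z c0z] _]] := cP 0%N isT.
suff [w nw] : exists w : pt, stalk w <> setT.
  by have [x _] := stalk_closed_point nw; exists x.
apply: contrapT => none.
have tT (w : pt) : stalk w = setT by apply: contrapT => nT; apply: none; exists w.
by apply: nc0y; rewrite (_ : y = z)//; apply: point_eq; rewrite !tT.
Qed.

(** The valuative criterion. A coordinate of least value makes V contain a chart; the local ring of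
    the center of V on that chart lies in V, and being a maximal proper subring it is V. *)
Lemma valuation_ring_stalk (V : set F) : valuation_ring V ->
  (forall c, V (emb X c)) -> V <> setT -> exists x : closed_point X, stalk x = V.
Proof.
move=> [sV VP] cV nVT.
have V0 := subring0 sV.
(* Run through the coordinates, keeping an index whose coordinate has the least value so far. *)
have [i [zi iP]] : exists i, hcoord i != 0 /\ forall j, V (hcoord j / hcoord (p := X) i).
  suff [i [zi iP]] : exists i, hcoord (p := X) i != 0 /\
      forall j, j \in enum 'I_(pdim X).+1 -> V (hcoord j / hcoord (p := X) i).
    by exists i; split => // j; apply: iP; rewrite mem_enum.
  elim: (enum _) => [|j s [i [zi iP]]].
    by have [i zi] := hcoord_neq0 X; exists i; split.
  have [zj|zj] := eqVneq (hcoord (p := X) j) 0.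
    exists i; split => // k; rewrite inE => /orP[/eqP ->|]; last exact: iP.
    by rewrite zj mul0r.
  have zij0 : hcoord (p := X) j / hcoord i != 0 by rewrite mulf_neq0// invr_eq0.
  have [Vji|] := VP _ zij0.
    by exists i; split => // k; rewrite inE => /orP[/eqP ->|]; last exact: iP.
  rewrite invfM invrK mulrC => Vij; exists j; split => // k.
  rewrite inE => /orP[/eqP ->|/iP Vki]; first by rewrite divff//; exact: sV.1.
  have -> : hcoord (p := X) k / hcoord j = hcoord k / hcoord i * (hcoord i / hcoord j).
    by field; rewrite zi zj.
  exact: subringM.
have AV : chart i `<=` V by exact: chart_min.
pose m := [set h | V h /\ ~ is_unit V h].
have mM a b : V a -> m b -> m (a * b).
  move=> Va [Vb nu]; split; first exact: subringM.
  move=> [ab0 _ Vab]; apply: nu; split => //.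
    by move: ab0; rewrite mulf_eq0 negb_or => /andP[].
  have a0 : a != 0 by move: ab0; rewrite mulf_eq0 negb_or => /andP[].
  suff -> : b^-1 = a * (a * b)^-1 by exact: subringM.
  by rewrite invfM mulrA divff// mul1r.
have mD a b : m a -> m b -> m (a + b).
  wlog Vba : a b / a != 0 -> V (b / a).
    move=> W ma mb; have [a0|a0] := eqVneq a 0.
      by apply: W => //; rewrite a0 eqxx.
    have [b0|b0] := eqVneq b 0; first by rewrite addrC; apply: W => //; rewrite b0 eqxx.
    have [V1|] := VP (b / a) (mulf_neq0 b0 (invr_neq0 a0)); first exact: W.
    by rewrite invf_div => V2; rewrite addrC; apply: W.
  move=> ma mb; have [->|a0] := eqVneq a 0; first by rewrite add0r.
  have -> : a + b = (1 + b / a) * a by field.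
  by apply: mM => //; apply: subringD => //; [exact: sV.1|exact: Vba].
have sA := chart_subring i.
(* The center of V on the chart. *)
have pA : prime_ideal (chart i) (chart i `&` m).
  split; last 1 first.
  - move=> a b Aa Ab [_ [_ nab]]; apply: contrapT => /not_orP [na nb].
    have [ua ub] : is_unit V a /\ is_unit V b.
      by split; apply: contrapT => nu; [apply: na|apply: nb]; split => //; split => //; exact: AV.
    by apply: nab; exact: is_unitM.
  - split; [by move=> a []|split; first exact: (subring0 sA)|..].
    + by split=> // -[]; rewrite eqxx.
    + by move=> a b [Aa ma] [Ab mb]; split; [exact: (subringD sA)|exact: mD].
    + by move=> a b Aa [Ab mb]; split; [exact: (subringM sA)|apply: mM => //; exact: AV].
  - by move=> [_ [_]]; apply; exact: is_unit1.
have lP : is_local_ring (localization (chart i) (chart i `&` m)).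
  by exists i, (chart i `&` m).
have lV : stalk (Point lP) `<=` V.
  move=> _ [a [b [Aa Ab nb ->]]]; apply: subringM => //; first exact: AV.
  have [] : is_unit V b.
    by apply: contrapT => nu; apply: nb; split => //; split => //; exact: AV.
  by [].
have [|x xE] := @stalk_closed_point (Point lP).
  by move=> lT; apply: nVT; apply/seteqP; split => // h _; apply: lV; rewrite lT.
exists x; have [pi upi] := closed_uniformizer x.
by apply/esym; apply: (uniformizer_maximal upi) => //; [rewrite xE|apply/eqP].
Qed.

End Stalks.

(** * Orders of functions at closed points *)

Section Orders.
Variables (K : fieldType) (X : proj_scheme K).
Hypotheses (X_curve : has_dimension X 1) (X_regular : regular_scheme X).
Local Notation F := (ffield X).
Implicit Types (x y : closed_point X) (h k s u : F).

Let unif x := closed_uniformizer X_curve X_regular x.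

Lemma ord_at1 x : ord_at x 1 = 0.
Proof. by have [pi upi] := unif x; exact: (ord_of1 upi). Qed.

Lemma ord_atM x h k : h != 0 -> k != 0 -> ord_at x (h * k) = ord_at x h + ord_at x k.
Proof. by have [pi upi] := unif x; exact: (ord_ofM upi). Qed.

Lemma ord_atV x h : h != 0 -> ord_at x h^-1 = - ord_at x h.
Proof. by have [pi upi] := unif x; exact: (ord_ofV upi). Qed.

Lemma ord_atX x h n : h != 0 -> ord_at x (h ^+ n) = ord_at x h *+ n.
Proof.
move=> h0; elim: n => [|n IHn]; first by rewrite expr0 ord_at1.
by rewrite exprS ord_atM ?expf_neq0// IHn mulrS.
Qed.

Lemma ord_atXz x h (n : int) : h != 0 -> ord_at x (h ^ n) = ord_at x h * n.
Proof.
move=> h0; case: n => n; first by rewrite -exprnP ord_atX// -mulr_natr natz.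
rewrite NegzE -exprnN ord_atV ?expf_neq0// ord_atX// mulrN -mulr_natr natz//.
Qed.

Lemma ord_at_prod x (I : Type) (r : seq I) (P : pred I) (f : I -> F) :
  (forall i, f i != 0) ->
  ord_at x (\prod_(i <- r | P i) f i) = \sum_(i <- r | P i) ord_at x (f i).
Proof.
move=> f0; elim: r => [|i r IHr]; first by rewrite !big_nil ord_at1.
rewrite !big_cons; case: (P i) => //; rewrite ord_atM// ?IHr//.
by elim/big_ind: _ => // [|a b a0 b0]; rewrite ?oner_neq0// mulf_neq0.
Qed.

(** [ord_at] carries no information at 0, whose order should be infinite; the first disjunct
    accounts for it. *)
Definition vge x (r : int) h := h = 0 \/ (r <= ord_at x h)%R.

Lemma vge_neq0 x r h : h != 0 -> vge x r h <-> (r <= ord_at x h)%R.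
Proof. by move=> h0; split=> [[h00|//]|]; [rewrite h00 eqxx in h0|right]. Qed.

Lemma stalkE x h : stalk x h <-> vge x 0 h.
Proof.
have [pi upi] := unif x; have [->|h0] := eqVneq h 0.
  by split=> _; [left|exact: subring0 (stalk_subring x)].
by rewrite vge_neq0//; exact: (ord_of_mem upi).
Qed.

Lemma max_idealE x h : max_ideal (stalk x) h <-> vge x 1 h.
Proof.
have [pi upi] := unif x; have [->|h0] := eqVneq h 0.
  split=> _; first by left.
  by split; [exact: subring0 (stalk_subring x)|case; rewrite eqxx].
by rewrite vge_neq0//; exact: (ord_of_max upi).
Qed.

Lemma is_unitE x h : h != 0 -> is_unit (stalk x) h <-> ord_at x h = 0.
Proof.
move=> h0; split=> [[_ /stalkE + /stalkE]|oh].
  rewrite !vge_neq0 ?invr_eq0// ord_atV// oppr_ge0 => a b.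
  by apply/eqP; rewrite eq_le a b.
by split => //; apply/stalkE; rewrite vge_neq0 ?invr_eq0// ?ord_atV// oh ?oppr0.
Qed.

Lemma exists_uniformizer x : exists2 pi, pi != 0 & ord_at x pi = 1.
Proof.
have [pi upi] := unif x; exists pi; first exact: (uniformizer_neq0 upi).
by have := ord_ofE upi 1 (is_unit1 (stalk_subring x)); rewrite mul1r expr1z.
Qed.

Lemma vge_mul x r t h k : vge x r h -> vge x t k -> vge x (r + t) (h * k).
Proof.
move=> [->|rh]; first by left; rewrite mul0r.
move=> [->|tk]; first by left; rewrite mulr0.
have [->|h0] := eqVneq h 0; first by left; rewrite mul0r.
have [->|k0] := eqVneq k 0; first by left; rewrite mulr0.
by right; rewrite ord_atM// lerD.
Qed.

Lemma vge_le x r t h : (r <= t)%R -> vge x t h -> vge x r h.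
Proof. by move=> rt [|th]; [left|right; exact: le_trans th]. Qed.

Lemma vge_add x r h k : vge x r h -> vge x r k -> vge x r (h + k).
Proof.
move=> rh rk; have [pi pi0 pi1] := exists_uniformizer x.
have shift l : vge x r l -> stalk x (l * pi ^ (- r)).
  move=> rl; apply/stalkE; rewrite -[0](subrr r); apply: vge_mul => //.
  by right; rewrite ord_atXz// pi1 mul1r.
have -> : h + k = (h * pi ^ (- r) + k * pi ^ (- r)) * pi ^ r.
  by rewrite -mulrDl -mulrA -expfzDr// addNr expr0z mulr1.
rewrite -[r in vge x r]add0r; apply: vge_mul.
  by apply/stalkE/(subringD (stalk_subring x)); exact: shift.
by right; rewrite ord_atXz// pi1 mul1r.
Qed.

Lemma vge_const x c : vge x 0 (emb X c).
Proof. by apply/stalkE; exact: stalk_const. Qed.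

Lemma ord_const x c : c != 0 -> ord_at x (emb X c) = 0.
Proof.
move=> c0; apply/is_unitE; rewrite ?fmorph_eq0//; split; rewrite ?fmorph_eq0//.
  exact: stalk_const.
by rewrite -fmorphV; exact: stalk_const.
Qed.

Lemma vge_subspace x r : ksubspace (emb X) (vge x r).
Proof.
split; [by left|by move=> a b; exact: vge_add|].
by move=> c a ra; rewrite -[r]add0r; apply: vge_mul => //; exact: vge_const.
Qed.

Lemma ord_at_addr x h k : h != 0 -> vge x (ord_at x h + 1) k ->
  h + k != 0 /\ ord_at x (h + k) = ord_at x h.
Proof.
move=> h0 kh; have nh : ~ vge x (ord_at x h + 1) h.
  by rewrite vge_neq0// => /=; rewrite -ltzD1 ltxx.
have n1 : ~ vge x (ord_at x h + 1) (h + k).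
  by move=> W; apply: nh; have := ksubspaceB (vge_subspace _ _) W kh; rewrite addrK.
have hk0 : h + k != 0 by apply/eqP => hk0; apply: n1; left.
split => //; apply/eqP; rewrite eq_le; apply/andP; split.
  rewrite leNgt; apply/negP => l; apply: n1; right; lia.
apply/(vge_neq0 _ _ hk0)/vge_add; first by right.
by apply: vge_le kh; lia.
Qed.

Definition evalK (q : {poly K}) u : F := (map_poly (emb X) q).[u].

Lemma evalK_subring u : subring [set evalK q u | q in setT].
Proof.
split; first by exists 1; rewrite // /evalK rmorph1 hornerC.
move=> _ _ [p _ <-] [q _ <-]; split.
  by exists (p - q); rewrite // /evalK rmorphB hornerD hornerN.
by exists (p * q); rewrite // /evalK rmorphM hornerM.
Qed.

Lemma evalKX u : evalK 'X u = u.
Proof. by rewrite /evalK map_polyX hornerX. Qed.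

Lemma evalKC c u : evalK c%:P u = emb X c.
Proof. by rewrite /evalK map_polyC hornerC. Qed.

Lemma evalKMX q c u : evalK (q * 'X + c%:P) u = evalK q u * u + emb X c.
Proof.
by rewrite /evalK rmorphD rmorphM /= map_polyX map_polyC hornerD hornerMX hornerC.
Qed.

Lemma evalK_stalk q x u : stalk x u -> stalk x (evalK q u).
Proof.
move=> xu; have sO := stalk_subring x; elim/poly_ind: q => [|q c IHq].
  by rewrite /evalK rmorph0 horner0; exact: (subring0 sO).
rewrite evalKMX; apply: (subringD sO); last exact: stalk_const.
exact: (subringM sO).
Qed.

(** Let m_x be the maximal ideal at x. If u had a transcendental residue, K[u] + m_x would be a ring
    without u^-1, and some valuation ring V above it would omit u^-1. V is the local ring of a point
    y; as it contains m_x it contains the local ring of x, so y = x, where u is a unit. *)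
Lemma algebraic_residue x u : stalk x u ->
  exists2 q : {poly K}, q != 0 & vge x 1 (evalK q u).
Proof.
move=> xu; have [mu|nmu] := pselect (vge x 1 u).
  by exists 'X; rewrite ?polyX_eq0// evalKX.
have u0 : u != 0 by apply/eqP => u0; apply: nmu; left.
have ou : ord_at x u = 0.
  move/stalkE: xu; rewrite vge_neq0// => ou; apply/eqP; rewrite eq_le ou andbT.
  by rewrite leNgt; apply/negP => l; apply: nmu; right; rewrite -gtz0_ge1.
apply: contrapT => none.
pose B := [set a | exists q m, vge x 1 m /\ a = evalK q u + m].
have sm := vge_subspace x 1.
have mO m a : vge x 1 m -> stalk x a -> vge x 1 (a * m).
  by move=> m1 /stalkE a0; rewrite -[1]add0r; exact: vge_mul.
have sB : subring B.
  have [K1 KBM] := evalK_subring u.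
  split.
    by have [q _ q1] := K1; exists q, 0; rewrite addr0 q1; split => //; left.
  move=> _ _ [p [m [m1 ->]]] [q [n [n1 ->]]].
  have [[r _ rE] [t _ tE]] := KBM (evalK p u) (evalK q u)
    (ex_intro2 _ _ p I erefl) (ex_intro2 _ _ q I erefl).
  split.
    exists r, (m - n); rewrite rE; split; first exact: (ksubspaceB sm).
    by ring.
  exists t, (evalK p u * n + evalK q u * m + n * m); rewrite tE; split; last by ring.
  case: (sm) => _ mD _; apply: (mD); first by apply: mD; apply: mO => //; exact: evalK_stalk.
  apply: mO => //; apply/stalkE; apply: vge_le n1; lia.
have Bu : B u by exists 'X, 0; rewrite evalKX addr0; split => //; left.
have nBu : ~ B u^-1.
  move=> [q [m [m1 e]]]; apply: none; exists (q * 'X + (-1)%:P).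
    apply/eqP => /(congr1 (fun p : {poly K} => p`_0)); rewrite coefD coefMX coefC coef0 /= add0r.
    by move=> /eqP; rewrite oppr_eq0 oner_eq0.
  rewrite evalKMX rmorphN rmorph1 (_ : _ - 1 = - (u * m)).
    by apply: (ksubspaceN sm); exact: mO.
  have -> : m = u^-1 - evalK q u by rewrite e; ring.
  by field.
have [V [vV BV nV]] := exists_valuation_ring sB Bu u0 nBu.
have [y yV] : exists y, stalk y = V.
  apply: (valuation_ring_stalk X_curve X_regular) => //.
    move=> c; apply: BV; exists c%:P, 0; rewrite evalKC addr0; split=> //; by left.
  by move=> VT; apply: nV; rewrite VT.
have mV m : vge x 1 m -> stalk y m.
  by move=> m1; rewrite yV; apply: BV; exists 0, m; rewrite /evalK rmorph0 horner0 add0r.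
suff xy : x = y by apply: nV; rewrite -yV -xy; apply/stalkE; right; rewrite ord_atV// ou.
apply: (sub_stalk_eq X_curve X_regular) => w xw; apply/stalkE.
have [->|w0] := eqVneq w 0; [by left|right]; rewrite leNgt; apply/negP => ow.
have [pi pi0 pi1] := exists_uniformizer x.
(* Large enough for w^n pi to have a pole at y if w has one, although it lies in the maximal ideal
   at x. *)
pose n := `|ord_at y pi|%N.+1.
have : stalk y (w ^+ n * pi).
  apply: mV; apply: mO; first by right; rewrite pi1.
  exact: subringX (stalk_subring x) xw.
move/stalkE; rewrite vge_neq0 ?mulf_neq0 ?expf_neq0// ord_atM ?expf_neq0// ord_atX//.
rewrite -mulr_natr natz /n; move: (ord_at y pi) (ord_at y w) ow => a b b0 H.
have : (b * (`|a|%N.+1)%:Z <= - (`|a|%N.+1)%:Z)%R by nia.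
lia.
Qed.

(** As u is a unit, an algebraic relation for its residue can be divided by powers of u until its
    constant term is nonzero, then solved for the inverse. A polynomial inverse stays in any ring
    containing K and u, so it creates no new poles. *)
Lemma unit_inverse_mod x u : u != 0 -> ord_at x u = 0 ->
  exists r : {poly K}, vge x 1 (evalK r u * u - 1).
Proof.
move=> u0 ou; have xu : stalk x u by apply/stalkE; right; rewrite ou.
have [q q0 qu] := algebraic_residue xu; have [_ _ mZ] := vge_subspace x 1.
elim/poly_ind: q q0 qu => [|q c IHq]; first by rewrite eqxx.
have [->|c0] := eqVneq c 0.
  rewrite addr0 => qX0; have q0 : q != 0 by apply: contraNneq qX0 => ->; rewrite mul0r.
  rewrite -[_ * _]addr0 -(polyC0 K) evalKMX rmorph0 addr0 => qu; apply: IHq => //.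
  rewrite -(mulfK u0 (evalK q u)) -[1]addr0; apply: vge_mul => //.
  by right; rewrite ord_atV// ou.
move=> _; rewrite evalKMX => qu; exists (- c^-1 *: q).
have -> : evalK (- c^-1 *: q) u = emb X (- c^-1) * evalK q u.
  by rewrite /evalK map_polyZ hornerZ.
have -> : emb X (- c^-1) * evalK q u * u - 1 = emb X (- c^-1) * (evalK q u * u + emb X c).
  by rewrite rmorphN fmorphV; field; rewrite fmorph_eq0.
exact: mZ.
Qed.

Lemma evalK_pole x t (q : {poly K}) : t != 0 -> ord_at x t < 0 -> q != 0 ->
  evalK q t != 0 /\ (ord_at x (evalK q t) <= 0)%R.
Proof.
move=> t0 ot; elim/poly_ind: q => [|q c IHq]; first by rewrite eqxx.
have [->|q0] := eqVneq q 0.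
  rewrite mul0r add0r polyC_eq0 evalKC => c0.
  by rewrite fmorph_eq0 ord_const.
move=> _; rewrite evalKMX; have [e0 eo] := IHq q0.
have oM : ord_at x (evalK q t * t) = ord_at x (evalK q t) + ord_at x t by exact: ord_atM.
have [|-> ->] := @ord_at_addr x (evalK q t * t) (emb X c) (mulf_neq0 e0 t0).
  by apply: vge_le (vge_const x c); lia.
by split => //; lia.
Qed.

(** At a zero of s the inverse has a pole, so no polynomial in s^-1 equals s, by [evalK_pole]. A
    valuation ring containing K[s^-1] but not s would then be the local ring of a pole of s. *)
Lemma no_pole_ord s : s != 0 -> (forall x, stalk x s) -> forall x, ord_at x s = 0.
Proof.
move=> s0 regs x; have /stalkE := regs x; rewrite vge_neq0// le_eqVlt => /orP[/eqP //|os].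
have t0 : s^-1 != 0 by rewrite invr_eq0.
have sB := evalK_subring s^-1.
have nB : ~ [set evalK q s^-1 | q in setT] s^-1^-1.
  rewrite invrK => -[q _ qs].
  have q0 : q != 0 by apply: contra_neqN s0 => /eqP q0; rewrite -qs q0 /evalK rmorph0 horner0.
  have [] := @evalK_pole x s^-1 q t0 _ q0; first by rewrite ord_atV// oppr_lt0.
  by rewrite qs leNgt os.
have [V [vV BV nV]] := exists_valuation_ring sB (ex_intro2 _ _ 'X I (evalKX _)) t0 nB.
have [y yV] : exists y, stalk y = V.
  apply: (valuation_ring_stalk X_curve X_regular) => //.
    by move=> c; apply: BV; exists c%:P; rewrite ?evalKC.
  by move=> VT; apply: nV; rewrite VT.
by exfalso; apply: nV; rewrite -yV invrK; exact: regs.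
Qed.

End Orders.

(** * Residue fields and finiteness of zeros *)

Section ResidueFields.
Variables (K : fieldType) (X : proj_scheme K).
Hypotheses (X_curve : has_dimension X 1) (X_regular : regular_scheme X).
Local Notation F := (ffield X).
Implicit Types (x y : closed_point X) (h : F).

Let stalkE x h : stalk x h <-> vge x 0 h. Proof. exact: stalkE. Qed.
Let vge_sub x r : ksubspace (emb X) (vge x r). Proof. exact: vge_subspace. Qed.
Let vge_mul x r t h k : vge x r h -> vge x t k -> vge x (r + t) (h * k).
Proof. exact: vge_mul. Qed.

(** The K-span of b and the maximal ideal, as an intersection of subspaces: stability properties
    follow by choosing [W], and coordinates are extracted only at the end. *)
Definition span_mod x (b : seq F) : set F :=
  [set h | forall W : set F, ksubspace (emb X) W -> vge x 1 `<=` W ->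
     (forall a, a \in b -> W a) -> W h].

Lemma span_mod_subspace x b : ksubspace (emb X) (span_mod x b).
Proof.
split=> [W [] //|h l hb lb W sW mW bW|c h hb W sW mW bW]; case: (sW) => _ WD WZ.
  by apply: WD; [exact: hb|exact: lb].
by apply: WZ; exact: hb.
Qed.

Lemma span_mod_lcomb x b h : span_mod x b h ->
  exists c : 'I_(size b) -> K, vge x 1 (h - lcomb (emb X) c (fun i => b`_i)).
Proof.
have [v0 vD vZ] := vge_sub x 1.
move=> /(_ [set h | exists c : 'I_(size b) -> K, vge x 1 (h - lcomb (emb X) c (fun i => b`_i))]).
apply.
- split.
  + exists (fun=> 0); rewrite /lcomb big1 ?subr0//.
    by move=> i _; rewrite rmorph0 mul0r.
  + move=> h1 h2 [c1 h1c] [c2 h2c]; exists (fun i => c1 i + c2 i).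
    have -> : lcomb (emb X) (fun i => c1 i + c2 i) (fun i => b`_i) =
       lcomb (emb X) c1 (fun i => b`_i) + lcomb (emb X) c2 (fun i => b`_i).
      by rewrite -big_split; apply: eq_bigr => i _; rewrite rmorphD mulrDl.
    by rewrite opprD addrACA; exact: vD.
  + move=> a h1 [c1 h1c]; exists (fun i => a * c1 i).
    have -> : lcomb (emb X) (fun i => a * c1 i) (fun i => b`_i) =
       emb X a * lcomb (emb X) c1 (fun i => b`_i).
      by rewrite mulr_sumr; apply: eq_bigr => i _; rewrite rmorphM mulrA.
    by rewrite -mulrBr; exact: vZ.
- move=> a va; exists (fun=> 0); rewrite /lcomb big1 ?subr0// => i _.
  by rewrite rmorph0 mul0r.
- move=> a ab; have ib : (index a b < size b)%N by rewrite index_mem.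
  exists (fun i => (i == Ordinal ib)%:R); rewrite /lcomb (bigD1 (Ordinal ib))//=.
  rewrite eqxx rmorph1 mul1r nth_index// big1 ?addr0 ?subrr; first by left.
  by move=> i /negPf ->; rewrite rmorph0 mul0r.
Qed.

Lemma span_mod_max x b : vge x 1 `<=` span_mod x b.
Proof. by move=> h h1 W _ mW _; exact: mW. Qed.

Lemma span_mod_gen x b a : a \in b -> span_mod x b a.
Proof. by move=> ab W _ _; apply. Qed.

Lemma span_mod_mul x b b' (f : F) : stalk x f ->
  (forall a, a \in b -> span_mod x b' (f * a)) ->
  forall h, span_mod x b h -> span_mod x b' (f * h).
Proof.
move=> /stalkE xf fb h /(_ [set h | span_mod x b' (f * h)]); apply => //.
  have [s0 sD sZ] := span_mod_subspace x b'; split.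
  - by rewrite /= mulr0.
  - by move=> a c /= sa sc; rewrite mulrDr; exact: sD.
  - by move=> c a /= sa; rewrite mulrCA; exact: sZ.
by move=> a va; apply: span_mod_max; rewrite -[1]add0r; exact: vge_mul.
Qed.

Lemma span_mod_stalk x b : (forall a, a \in b -> stalk x a) ->
  span_mod x b `<=` stalk x.
Proof.
move=> bx h hb; apply/stalkE; apply: hb => [|h1|a /bx /stalkE //]; first exact: vge_sub.
by apply: vge_le; lia.
Qed.

(** The functions are added one at a time. The residue of f is algebraic, so multiplying the
    previous b by the powers of f below the size of a relation gives a span stable under f. *)
Lemma finite_span_mod x (fs : seq F) : (forall f, f \in fs -> stalk x f) ->
  exists b : seq F, [/\ forall a, a \in b -> stalk x a, span_mod x b 1 &
    forall f, f \in fs -> forall h, span_mod x b h -> span_mod x b (f * h)].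
Proof.
have sO := stalk_subring x.
elim: fs => [|f fs IHfs] fsx.
  exists [:: 1]; split => //; last by apply: span_mod_gen; rewrite inE.
  by move=> a; rewrite inE => /eqP ->; exact: sO.1.
have [|b [bx b1 bfs]] := IHfs; first by move=> z zfs; apply: fsx; rewrite inE zfs orbT.
have xf : stalk x f by apply: fsx; rewrite inE eqxx.
have [q q0 qf] := algebraic_residue X_curve X_regular xf.
pose d := size q; pose b' := [seq f ^+ k * a | a <- b, k <- iota 0 d].
have [sb0 sbD sbZ] := span_mod_subspace x b'.
have d0 : (0 < d)%N by rewrite size_poly_gt0.
have b'x a : a \in b' -> stalk x a.
  move=> /allpairsP [[a0 k] /= [a0b _ ->]]; apply: (subringM sO); last exact: bx.
  exact: subringX.
have claim k h : span_mod x b h -> span_mod x b' (f ^+ k * h).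
  move: h; have [n] := ubnP k; elim: n k => // n IHn k kn h.
  have [kd|dk] := ltnP k d.
    apply: span_mod_mul; first exact: subringX.
    move=> a ab; apply: span_mod_gen; apply/allpairsP.
    by exists (a, k); rewrite mem_iota.
  move=> hb; have qE : evalK q f = \sum_(i < d) emb X q`_i * f ^+ i.
    rewrite /evalK horner_coef size_map_poly; apply: eq_bigr => i _.
    by rewrite coef_map.
  have [d' dE] : exists d', d = d'.+1 by exists d.-1; rewrite prednK.
  have lq : q`_d' != 0 by rewrite -[d']/(d'.+1.-1) -dE -lead_coefE lead_coef_eq0.
  have [l kE] : exists l, k = (l + d')%N by exists (k - d')%N; lia.
  (* As q(f) vanishes at x, f^d' is a combination of lower powers modulo the maximal ideal. *)
  have -> : f ^+ k * h = emb X (q`_d')^-1 * (evalK q f * (f ^+ l * h)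
      + \sum_(i < d') emb X (- q`_i) * (f ^+ (l + i) * h)).
    rewrite qE dE big_ord_recr /= mulrDl mulr_suml addrAC -big_split /= big1.
      by rewrite add0r kE exprD fmorphV; field; rewrite fmorph_eq0.
    by move=> i _; rewrite rmorphN exprD; ring.
  apply: (sbZ); apply: sbD.
    apply: span_mod_max; rewrite -[1]addr0; apply: vge_mul => //; apply/stalkE.
    by apply: subringM (subringX _ _ _) (span_mod_stalk bx hb).
  apply: ksubspace_sum; first exact: span_mod_subspace.
  by move=> i _; apply: (sbZ); apply: IHn => //; have := ltn_ord i; lia.
exists b'; split => //; first by have := claim 0%N 1 b1; rewrite expr0 mul1r.
move=> z; rewrite inE => /orP[/eqP ->|zfs].
  apply: span_mod_mul => // a /allpairsP [[a0 k] /= [a0b _ ->]].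
  by rewrite mulrA -exprS; apply: claim; exact: span_mod_gen.
apply: span_mod_mul; first by apply: fsx; rewrite inE zfs orbT.
move=> a /allpairsP [[a0 k] /= [a0b _ ->]].
by rewrite mulrCA; apply: claim; apply: bfs => //; exact: span_mod_gen.
Qed.

Lemma chart_stable i (S : set F) : ksubspace (emb X) S ->
  (forall j h, S h -> S (hcoord (p := X) j / hcoord i * h)) ->
  forall a h, chart i a -> S h -> S (a * h).
Proof.
move=> sS gS a h ca; move: h.
apply: (ca [set a | forall h, S h -> S (a * h)]); split.
  split; last by move=> c h Sh; case: sS => _ _; apply.
  split=> [h|b c Sb Sc]; first by rewrite mul1r.
  split=> h Sh; first by rewrite mulrBl; apply: (ksubspaceB sS); [exact: Sb|exact: Sc].
  by rewrite -mulrA; apply: Sb; exact: Sc.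
by move=> _ [j _ <-] h; exact: gS.
Qed.

Lemma chart_evalK i (q : {poly K}) (b : F) : chart i b -> chart i (evalK q b).
Proof.
have sA := chart_subring i.
move=> cb; elim/poly_ind: q => [|q c IHq].
  by rewrite /evalK rmorph0 horner0; exact: (subring0 sA).
rewrite evalKMX; apply: (subringD sA); last exact: chart_const.
exact: (subringM sA).
Qed.

(* The residue field of x is already the image of the chart. *)
Lemma stalk_span x : exists b, stalk x `<=` span_mod x b.
Proof.
have [i [p [zi pp xE]]] := stalkP x.
have sA := chart_subring i.
have Ax : chart i `<=` stalk x by rewrite xE; exact: sub_localization.
have [|b [bx b1 bfs]] := @finite_span_mod x [seq hcoord (p := X) j / hcoord i | j : 'I_(pdim X).+1].
  by move=> _ /codomP [j ->]; apply: Ax; exact: chart_gen.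
exists b; have sb := span_mod_subspace x b.
have Ab : chart i `<=` span_mod x b.
  move=> a ca; rewrite -[a]mulr1; apply: (chart_stable sb) ca b1 => j h.
  by apply: bfs; apply/codomP; exists j.
move=> h xh; move: (xh); rewrite xE => -[a [c [Aa Ac nc hE]]].
have c0 : c != 0.
  by case: pp => -[_ p0 _ _] _ _; apply/eqP => c0; apply: nc; rewrite c0.
have oc : ord_at x c = 0.
  apply/(is_unitE X_curve X_regular) => //; split=> //; first exact: Ax.
  by rewrite xE; exists 1, c; split; rewrite ?mul1r//; exact: sA.1.
have [r rc] := unit_inverse_mod X_curve X_regular c0 oc.
(* The first term lies in the chart, as r(c) stands in for the inverse of c; the second is in the
   maximal ideal. *)
have -> : h = a * evalK r c - h * (evalK r c * c - 1) by rewrite hE; field.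
apply: (ksubspaceB sb); first by apply: Ab; apply: (subringM sA) => //; exact: chart_evalK.
by apply: span_mod_max; rewrite -[1]add0r; apply: vge_mul => //; apply/stalkE.
Qed.

Lemma res_degP x :
  quot_dim (@kscale K X) (stalk x) (max_ideal (stalk x)) (res_deg x).
Proof.
have [b bP] := stalk_span x.
have mE : max_ideal (stalk x) = vge x 1.
  by apply/seteqP; split=> h /(max_idealE X_curve X_regular).
rewrite /res_deg; case: xgetP => [n //|none]; exfalso.
have [|n _] := @quot_dim_exists _ _ (emb X) (stalk x) (vge x 1) (size b) (vge_sub _ _).
  move=> m a xa; apply: indep_mod_le; first exact: vge_sub.
    by move=> v /bP; exact: span_mod_lcomb.
  exact: xa.
by rewrite -mE => /(none n).
Qed.

Lemma res_deg_basis x : exists e : 'I_(res_deg x) -> F,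
  [/\ forall i, stalk x (e i), indep_mod (emb X) (vge x 1) e &
   forall h, stalk x h -> exists c, vge x 1 (h - lcomb (emb X) c e)].
Proof.
have [e [ex ei eg]] := res_degP x; exists e; split => //.
  by move=> c /(max_idealE X_curve X_regular); exact: ei.
by move=> h /eg [c /(max_idealE X_curve X_regular)]; exists c.
Qed.

Lemma res_deg_gt0 x : (0 < res_deg x)%N.
Proof.
have [e [_ _ eg]] := res_deg_basis x; rewrite lt0n; apply/negP => /eqP d0.
have [c] := eg 1 (stalk_subring x).1.
rewrite /lcomb big1 ?subr0; last by move=> [i il]; exfalso; rewrite d0 in il.
by rewrite vge_neq0 ?oner_neq0// ord_at1.
Qed.

(** Take for s the affine coordinates z_j and a basis e of the residue field, for g the relations
    modulo the maximal ideal expressing 1 and the products z_j e_k in this basis. Under these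
    conditions a chart element vanishing at x also vanishes at y. Being finite in number, they pass
    to ultrafilters and to open neighbourhoods. *)
Lemma point_determined x : exists s g : seq F,
  [/\ forall f, f \in s -> stalk x f, forall f, f \in g -> vge x 1 f
    & forall y, (forall f, f \in s -> stalk y f) -> (forall f, f \in g -> vge y 1 f) ->
       y = x].
Proof.
have [i [p [zi pp xE]]] := stalkP x.
have sA := chart_subring i.
have Ax : chart i `<=` stalk x by rewrite xE; exact: sub_localization.
have [e [ex ei eg]] := res_deg_basis x.
have [c1 c1P] := eg 1 (stalk_subring x).1.
pose z (j : 'I_(pdim X).+1) := hcoord (p := X) j / hcoord i.
have xz j : stalk x (z j) by apply: Ax; exact: chart_gen.
have /choice[c cP] (t : 'I_(pdim X).+1 * 'I_(res_deg x)) :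
    exists c, vge x 1 (z t.1 * e t.2 - lcomb (emb X) c e).
  by apply: eg; exact: subringM (stalk_subring x) (xz _) (ex _).
exists (codom z ++ codom e),
  ((1 - lcomb (emb X) c1 e) :: codom (fun t => z t.1 * e t.2 - lcomb (emb X) (c t) e)).
split.
- by move=> f; rewrite mem_cat => /orP[] /codomP [k ->].
- by move=> f; rewrite inE => /orP[/eqP -> //|/codomP [k ->]].
move=> y sy gy.
have yz j : stalk y (z j) by apply: sy; rewrite mem_cat codom_f.
have ye k : stalk y (e k) by apply: sy; rewrite mem_cat codom_f orbT.
have y1 : vge y 1 (1 - lcomb (emb X) c1 e) by apply: gy; rewrite inE eqxx.
have yg t : vge y 1 (z t.1 * e t.2 - lcomb (emb X) (c t) e).
  by apply: gy; rewrite inE; apply/orP; right;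
    exact: (codom_f (fun t => z t.1 * e t.2 - lcomb (emb X) (c t) e)).
(* Elements with common coordinates in e modulo both maximal ideals; e need not stay independent at
   y. *)
pose Q := [set a | exists c, vge x 1 (a - lcomb (emb X) c e) /\ vge y 1 (a - lcomb (emb X) c e)].
have [vx0 vxD vxZ] := vge_sub x 1; have [vy0 vyD vyZ] := vge_sub y 1.
have sQ : ksubspace (emb X) Q.
  split.
  - exists (fun=> 0); rewrite /lcomb big1 ?subr0//.
    by move=> k _; rewrite rmorph0 mul0r.
  - move=> h1 h2 [d1 [h1x h1y]] [d2 [h2x h2y]]; exists (fun i => d1 i + d2 i).
    have -> : lcomb (emb X) (fun i => d1 i + d2 i) e = lcomb (emb X) d1 e + lcomb (emb X) d2 e.
      by rewrite -big_split; apply: eq_bigr => k _; rewrite rmorphD mulrDl.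
    by rewrite opprD addrACA; split; [exact: vxD|exact: vyD].
  - move=> a h1 [d1 [h1x h1y]]; exists (fun i => a * d1 i).
    have -> : lcomb (emb X) (fun i => a * d1 i) e = emb X a * lcomb (emb X) d1 e.
      by rewrite mulr_sumr; apply: eq_bigr => k _; rewrite rmorphM mulrA.
    by rewrite -mulrBr; split; [exact: vxZ|exact: vyZ].
have [Q0 QD QZ] := sQ.
have Qsum (f : 'I_(res_deg x) -> F) : (forall k, Q (f k)) -> Q (\sum_k f k).
  by move=> Qf; elim/big_ind: _ => //; exact: QD.
have Qm h : vge x 1 h -> vge y 1 h -> Q h.
  move=> hx hy; exists (fun=> 0); rewrite /lcomb big1 ?subr0// => k _.
  by rewrite rmorph0 mul0r.
have Q1 : Q 1 by exists c1.
have AQ : chart i `<=` Q.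
  move=> a ca; rewrite -[a]mulr1; apply: (chart_stable sQ) ca Q1 => j h [d [hx hy]].
  rewrite -(subrK (lcomb (emb X) d e) h) mulrDr; apply: (QD).
    by apply: Qm; rewrite -[1]add0r; apply: vge_mul => //; apply/stalkE; [exact: xz|exact: yz].
  rewrite mulr_sumr; apply: Qsum => k; rewrite mulrCA; apply: (QZ).
  by exists (c (j, k)); split; [exact: (cP (j, k))|exact: (yg (j, k))].
have my a : chart i a -> vge x 1 a -> vge y 1 a.
  move=> /AQ [d [ax ay]] xa.
  have d0 : forall k, d k = 0.
    apply: ei; rewrite -(subKr a (lcomb _ _ _)); exact: (ksubspaceB (vge_sub _ _)).
  move: ay; rewrite /lcomb big1 ?subr0// => k _.
  by rewrite d0 rmorph0 mul0r.
have Ay : chart i `<=` stalk y.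
  by apply: chart_min; [exact: stalk_subring|exact: stalk_const|exact: yz].
symmetry; apply: (sub_stalk_eq X_curve X_regular).
move=> h; rewrite {1}xE => -[a [b [Aa Ab nb ->]]].
have b0 : b != 0.
  by case: pp => -[_ p0 _ _] _ _; apply/eqP => b0; apply: nb; rewrite b0.
have ob : ord_at x b = 0.
  apply/(is_unitE X_curve X_regular) => //; split=> //; first exact: Ax.
  by rewrite xE; exists 1, b; split; rewrite ?mul1r//; exact: sA.1.
(* r(b) b - 1 is a chart element vanishing at x, hence at y: a denominator that is a unit at x is a
   unit at y. *)
have [r rb] := unit_inverse_mod X_curve X_regular b0 ob.
have Arb : chart i (evalK r b) by exact: chart_evalK.
have yrb : vge y 1 (evalK r b * b - 1).
  by apply: my => //; apply: (subringB sA); [exact: (subringM sA)|exact: sA.1].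
have nyb : ~ vge y 1 b.
  move=> yb; have : vge y 1 1.
    rewrite -[X in vge y _ X](subKr (evalK r b * b)); apply: (ksubspaceB (vge_sub _ _)) yrb.
    by rewrite -[1]add0r; apply: vge_mul => //; apply/stalkE; exact: Ay.
  by rewrite vge_neq0 ?oner_neq0// ord_at1.
have oyb : ord_at y b = 0.
  have /stalkE := Ay _ Ab; rewrite vge_neq0// => oyb; apply/eqP; rewrite eq_le oyb andbT.
  by rewrite leNgt; apply/negP => l; apply: nyb; right; rewrite -gtz0_ge1.
apply: (subringM (stalk_subring y)); first exact: Ay.
by apply/stalkE; right; rewrite ord_atV// oyb.
Qed.

(** If there were infinitely many zeros, some ultrafilter of zeros would avoid each single point.
    The functions regular along it form a valuation ring without h^-1, the local ring of some x. The
    conditions of [point_determined] then hold along the ultrafilter, which therefore contains the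
    singleton of x. *)
Lemma finite_zeros h : h != 0 -> finite_set [set x | (0 < ord_at x h)%R].
Proof.
move=> h0; apply: contrapT => infZ; set Z := [set x | _] in infZ.
pose G := [set A : set (closed_point X) | finite_set (Z `\` A)].
have PG : ProperFilter G.
  apply: Build_ProperFilter; first by rewrite /G /= setD0.
  split.
  - by rewrite /G /= setDT.
  - by move=> A B /= fA fB; rewrite /G /= setDIr finite_setU.
  - by move=> A B AB /=; apply: sub_finite_set => x [Zx nB]; split => // /AB.
have [U [uU GU]] := ultraFilterLemma PG.
have PU : ProperFilter U := @ultra_proper _ _ uU.
have FU : Filter U := @filter_filter _ _ PU.
have UZ : U Z by apply: GU; rewrite /G /= setDv.
have U1 x : U (~` [set x]).
  apply: GU; rewrite /G /=; apply: (sub_finite_set _ (finite_set1 x)).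
  by move=> y [_ /contrapT].
have Uproper A : U A -> ~ U (~` A).
  by move=> UA UnA; have /filter_ex[z [Az]] : U (A `&` ~` A) by exact: filterI.
pose V := [set f : F | U [set x : closed_point X | stalk x f]].
have sV : subring V.
  split; first by apply: (filterS _ (@filterT _ U _)) => x _; exact: (stalk_subring x).1.
  move=> a b Va Vb; split; rewrite /V /=; apply: filterS (filterI Va Vb) => x [xa xb].
    exact: subringB (stalk_subring x) xa xb.
  exact: subringM (stalk_subring x) xa xb.
have vV : valuation_ring V.
  split => // f f0.
  case: (in_ultra_setVsetC [set x : closed_point X | stalk x f] uU) => [|nV]; [by left|right].
  rewrite /V /=; apply: filterS nV => x /= nxf; apply/stalkE; right.
  rewrite ord_atV// oppr_ge0 leNgt; apply/negP => l; apply: nxf; apply/stalkE; right.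
  exact: ltW.
have nVh : ~ V h^-1.
  move=> Vh; have /filter_ex[x [/stalkE + Zx]] :
    U ([set x : closed_point X | stalk x h^-1] `&` Z) by exact: filterI.
  rewrite vge_neq0 ?invr_eq0// ord_atV//.
  by rewrite oppr_ge0 leNgt Zx.
have [x xV] : exists x, stalk x = V.
  apply: (valuation_ring_stalk X_curve X_regular) => //.
    by move=> c; rewrite /V /=; apply: (filterS _ (@filterT _ U _)) => x _; exact: stalk_const.
  by move=> VT; apply: nVh; rewrite VT.
have [s [g [sx gx det]]] := point_determined x.
have Uall (P : F -> closed_point X -> Prop) (t : seq F) :
    (forall f, f \in t -> U [set y : closed_point X | P f y]) ->
    U [set y : closed_point X | forall f, f \in t -> P f y].
  elim: t => [|f t IHt] tP; first by apply: (filterS _ (@filterT _ U _)).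
  have Uf : U [set y : closed_point X | P f y] by apply: tP; rewrite inE eqxx.
  have /IHt Ut k : k \in t -> U [set y : closed_point X | P k y]
    by move=> kt; apply: tP; rewrite inE kt orbT.
  by apply: filterS (filterI Uf Ut) => y [yf yt] k; rewrite inE => /orP[/eqP ->|/yt].
have Us : U [set y : closed_point X | forall f, f \in s -> stalk y f].
  by apply: Uall => f /sx; rewrite xV.
have Ug : U [set y : closed_point X | forall f, f \in g -> vge y 1 f].
  apply: Uall => f /gx fx; have [->|f0] := eqVneq f 0.
    by apply: (filterS _ (@filterT _ U _)) => y _; left.
  have nf : ~ V f^-1.
    rewrite -xV => /stalkE; rewrite vge_neq0 ?invr_eq0// ord_atV// oppr_ge0.
    by move: fx; rewrite vge_neq0// => l1 l2; have := le_trans l1 l2.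
  case: (in_ultra_setVsetC [set y : closed_point X | stalk y f^-1] uU) => // nV.
  apply: filterS nV => y /= nyf; right; rewrite leNgt; apply/negP => l; apply: nyf.
  by apply/stalkE; right; rewrite ord_atV//; lia.
apply: (Uproper _ (U1 x)); rewrite setCK.
by apply: filterS (filterI Us Ug) => y [ys yg] /=; exact: det.
Qed.

Lemma finite_ord_support h : h != 0 -> finite_set [set x | ord_at x h != 0].
Proof.
move=> h0; have := finite_zeros h0; have := @finite_zeros h^-1; rewrite invr_eq0 => /(_ h0) f1 f2.
have : finite_set ([set x | (0 < ord_at x h)%R] `|` [set x | (0 < ord_at x h^-1)%R]).
  by rewrite finite_setU.
apply: sub_finite_set => x /=; rewrite neq_lt ord_atV// oppr_gt0.
by move=> /orP[]; [right|left].
Qed.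

End ResidueFields.

(** * Cartier divisors and functions supported at two points *)

Section PicardFunctions.
Variables (K : fieldType) (X : proj_scheme K).
Hypotheses (X_curve : has_dimension X 1) (X_regular : regular_scheme X).
Local Notation F := (ffield X).
Local Notation pt := (Defs.point X).
Implicit Types (x y z : closed_point X) (h f : F).

Let stalkE x h : stalk x h <-> vge x 0 h. Proof. exact: stalkE. Qed.
Let is_unitE x h : h != 0 -> is_unit (stalk x) h <-> ord_at x h = 0.
Proof. exact: is_unitE. Qed.

Lemma zariski_open_basic (s : seq F) : open [set y : pt | forall h, h \in s -> stalk y h].
Proof. by rewrite zariski_openE => y ys; exists s; split. Qed.

(** A uniformizer pi may have zeros and poles away from x, so it serves as equation at x only, with
    1 elsewhere. *)
Lemma exists_point_cartier x : exists E : cartier X,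
  effective_cartier E /\ forall y, mult E y = (y == x)%:Z.
Proof.
have [pi pi0 pi1] := exists_uniformizer X_curve X_regular x.
pose eqn (p : pt) := if `[< p = cpt x >] then pi else 1.
have eqnx : eqn (cpt x) = pi by rewrite /eqn asboolT.
have eqnN (p : pt) : p <> cpt x -> eqn p = 1 by move=> np; rewrite /eqn asboolF.
have eqn0 p : eqn p != 0 by rewrite /eqn; case: ifP => _ //; exact: oner_neq0.
have glue (p : pt) : \forall q \near p, is_unit (stalk q) (eqn p / eqn q).
  have [->|npx] := pselect (p = cpt x); last first.
    rewrite (eqnN _ npx).
    have : open_nbhs p (~` [set cpt x]) by split=> //; rewrite openC; exact: cptP.
    move=> /open_nbhs_nbhs; apply: filterS => q nq.
    by rewrite (eqnN _ nq) divr1; exact: is_unit1 (stalk_subring q).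
  have [s [g [sx gx det]]] := point_determined X_curve X_regular x.
  (* Where pi, s and all h / pi with h in g are regular, a zero of pi makes every h in g vanish, so
     it is x by [det]. *)
  pose t := pi :: s ++ [seq h / pi | h <- g].
  have tx : open_nbhs (cpt x) [set y : pt | forall h, h \in t -> stalk y h].
    split; first exact: zariski_open_basic.
    move=> h; rewrite inE mem_cat => /orP[/eqP ->|/orP[/sx //|/mapP [k kg ->]]].
      by apply/stalkE; right; rewrite pi1.
    apply/stalkE; rewrite -[0](subrr 1); apply: vge_mul => //; first exact: gx.
    by right; rewrite ord_atV// pi1.
  move: tx => /open_nbhs_nbhs; apply: filterS => q qt; rewrite eqnx.
  have [->|nqx] := pselect (q = cpt x).
    by rewrite eqnx divff//; exact: is_unit1 (stalk_subring _).
  rewrite eqnN// divr1.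
  have [qT|nqT] := pselect (stalk q = setT); first by split=> //; rewrite qT.
  have [y yq] := stalk_closed_point X_curve X_regular nqT.
  have qpi : stalk y pi by rewrite yq; apply: qt; rewrite inE eqxx.
  rewrite -yq; apply/is_unitE => //; apply/eqP; rewrite eq_le andbC.
  move/stalkE: (qpi); rewrite vge_neq0// => -> /=; rewrite leNgt; apply/negP => opi.
  apply: nqx; rewrite -yq; congr (cpt _); apply: det => h hs.
    by rewrite yq; apply: qt; rewrite inE mem_cat hs orbT.
  have -> : h = h / pi * pi by rewrite mulfVK.
  rewrite -[1]add0r; apply: vge_mul => //; last by right; rewrite -gtz0_ge1.
  apply/stalkE; rewrite yq; apply: qt; rewrite inE mem_cat.
  by apply/orP; right; apply/orP; right; apply/mapP; exists h.
exists (Cartier eqn0 glue); split=> [p|y]; rewrite /mult /=.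
  have [->|np] := pselect (p = cpt x).
    by rewrite eqnx; apply/stalkE; right; rewrite pi1.
  by rewrite eqnN//; exact: (stalk_subring p).1.
have [->|nyx] := eqVneq y x; first by rewrite eqnx.
rewrite eqnN ?(ord_at1 X_curve X_regular)// => e; move/eqP: nyx; apply.
by apply: closed_point_eq; rewrite e.
Qed.

Lemma finite_support_seq (s : seq F) :
  finite_set [set x | exists h, [/\ h \in s, h != 0 & ord_at x h != 0]].
Proof.
elim: s => [|h s IHs].
  by apply: (sub_finite_set _ (@finite_set0 (closed_point X))) => x [h []].
have fh : finite_set [set x | h != 0 /\ ord_at x h != 0].
  have [->|h0] := eqVneq h 0.
    by apply: (sub_finite_set _ (@finite_set0 (closed_point X))) => x [].
  by apply: (sub_finite_set _ (finite_ord_support X_curve X_regular h0)) => x [].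

have : finite_set ([set x | h != 0 /\ ord_at x h != 0] `|`
   [set x | exists h, [/\ h \in s, h != 0 & ord_at x h != 0]]) by rewrite finite_setU.
apply: sub_finite_set => x [k [+ k0 ok]]; rewrite inE => /orP[/eqP kh|ks].
  by left; rewrite /= -kh.
by right; exists k.
Qed.

(** Near the generic point one function l is a local equation, so multiplicities are orders of l. A
    point outside this neighbourhood is a pole of one of the finitely many functions that define
    it. *)
Lemma mult_finite (E : cartier X) : finite_set [set x | mult E x != 0].
Proof.
set l := loc_eqn E (generic_point X).
have l0 : l != 0 by exact: loc_eqn_neq0.
have : nbhs (generic_point X) [set y | is_unit (stalk y) (l / loc_eqn E y)].
  exact: loc_eqn_glue.
rewrite nbhsE => -[B [oB Bg] BE].
have [s [_ sB]] : exists s : seq F, (forall h, h \in s -> stalk (generic_point X) h) /\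
    [set y : pt | forall h, h \in s -> stalk y h] `<=` B.
  exact: (oB _ Bg).
apply: (sub_finite_set _ (finite_support_seq (l :: s))) => x /= mx.
have [Bx|nBx] := pselect (B (cpt x)).
  exists l; split => //; rewrite ?inE ?eqxx//; apply: contra_neq mx => ol.
  have /is_unitE := BE _ Bx; rewrite mulf_neq0 ?invr_eq0 ?loc_eqn_neq0// => /(_ isT).
  rewrite ord_atM ?invr_eq0 ?loc_eqn_neq0// ord_atV ?loc_eqn_neq0// -/l ol.
  by move=> /eqP; rewrite sub0r oppr_eq0 => /eqP.
have [h [hs nh]] : exists h, h \in s /\ ~ stalk x h.
  apply: contrapT => none; apply: nBx; apply: sB => h hs; apply: contrapT => nh.
  by apply: none; exists h.
exists h; split; first by rewrite inE hs orbT.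
  by apply: contra_notN nh => /eqP ->; apply/stalkE; left.
by apply: contra_notN nh => /eqP oh; apply/stalkE; right; rewrite oh.
Qed.

Lemma divisors_finite (k : fieldType) (D : closed_point X -> k) :
  Defs.divisors k D -> finite_set [set x | D x != 0].
Proof.
move=> [n [a [E [Ed DE]]]].
have : finite_set (\bigcup_(i in [set: 'I_n]) [set x | E i x != 0]).
  apply: bigcup_finite => // i _; have [C _ <-] := Ed i; exact: mult_finite.
apply: sub_finite_set => x /= Dx; apply: contrapT => none; move/eqP: Dx; apply.
rewrite DE big1// => i _; suff -> : E i x = 0 by rewrite mulr0.
by apply: contrapT => /eqP ne; apply: none; exists i.
Qed.

Lemma point_divisor (k : fieldType) x :
  Defs.divisors k (fun z => (z == x)%:R : k).
Proof.
have [E [_ Em]] := exists_point_cartier x.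
exists 1%N, (fun=> 1), (fun=> mult E); split; first by exists E.
by move=> z; rewrite big_ord1 mul1r Em; case: (z == x).
Qed.

Lemma common_denominator n (a : 'I_n -> rat) : exists (N : int) (m : 'I_n -> int),
  N != 0 /\ forall i, N%:~R * a i = (m i)%:~R.
Proof.
exists (\prod_i denq (a i)), (fun i => numq (a i) * \prod_(j | j != i) denq (a j)).
split; first by apply/prodf_neq0 => i _; exact: denq_neq0.
move=> i; rewrite (bigD1 i)//= !intrM -[X in _ * X = _]divq_num_den.
by field; rewrite intr_eq0 denq_neq0.
Qed.

Lemma principal_divisor_multiple (D : closed_point X -> rat) :
  principal_divisors rat D -> exists (N : int) (f : F),
  [/\ N != 0, f != 0 & forall z, N%:~R * D z = (ord_at z f)%:~R].
Proof.
move=> [n [a [E [Ed DE]]]].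
have [N [m [N0 Nm]]] := common_denominator a.
have /choice[h hP] i : exists h, h != 0 /\ prdiv h = E i.
  by have [h h0 <-] := Ed i; exists h.
have hm0 i : h i ^ m i != 0 by rewrite expfz_neq0//; case: (hP i).
exists N, (\prod_i (h i ^ m i)); split=> //; first by apply/prodf_neq0 => i _.
move=> z; rewrite ord_at_prod// DE mulr_sumr rmorph_sum; apply: eq_bigr => i _ /=.
rewrite mulrA Nm ord_atXz ?(hP i).1// -(hP i).2 /prdiv mulrC.
by rewrite -intrM.
Qed.

Hypothesis X_pic : dim_PicQ X 1.

(** Rationally, the classes of x and y are multiples c and d of one generator. Neither is zero,
    since a function vanishing at a single point must have a pole. Eliminating the generator leaves
    a function supported at x and y, and for the same reason its orders there have opposite
    signs. *)
Lemma pic_function x y : x != y -> exists f (a b : nat),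
  [/\ f != 0, (0 < a)%N, (0 < b)%N & forall z,
   ord_at z f = if z == x then a%:Z else if z == y then - b%:Z else 0].
Proof.
move=> xy; case: X_pic => B [_ _ gen].
have key w : exists (c : rat) (N : int) (f : F), [/\ N != 0, f != 0, c != 0 &
    forall z, N%:~R * ((z == w)%:R - c * B ord0 z) = (ord_at z f)%:~R].
  have [c pc] := gen _ (point_divisor rat w).
  have [N [f [N0 f0 fP]]] := principal_divisor_multiple pc.
  have {}fP z : N%:~R * ((z == w)%:R - c ord0 * B ord0 z) = (ord_at z f)%:~R.
    by rewrite -fP big_ord1.
  exists (c ord0), N, f; split => //; apply/eqP => c0.
  have {}fP z : ord_at z f = N * (z == w)%:Z.
    apply: (@intr_inj rat); rewrite -fP c0 mul0r subr0 intrM.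
    by case: (z == w).
  wlog Npos : N f N0 f0 fP / (0 < N)%R.
    move=> W; have [Np|Nn|N00] := ltgtP 0 N; first exact: (W N f).
      apply: (W (- N) f^-1); rewrite ?oppr_eq0 ?invr_eq0 ?oppr_gt0//.
      by move=> z; rewrite ord_atV// fP mulNr.
    by rewrite -N00 eqxx in N0.
  have := @no_pole_ord _ _ X_curve X_regular f f0 _ w.
  rewrite fP eqxx mulr1 => W; move/eqP: N0; apply; apply: W => z.
  by apply/stalkE; right; rewrite fP mulr_ge0// ltW.
have [c [M [f [M0 f0 c0 fP]]]] := key x; have [d [N [g [N0 g0 d0 gP]]]] := key y.
(* These exponents clear the denominators of c and d and cancel the generator of Pic(X) in k. *)
pose A := N * numq d * denq c; pose B' := M * numq c * denq d.
pose k := f ^ A * g ^ (- B').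
have A0 : A * M != 0 by rewrite !mulf_neq0// ?numq_eq0// denq_neq0.
have B0 : B' * N != 0 by rewrite !mulf_neq0// ?numq_eq0// denq_neq0.
have k0 : k != 0 by rewrite mulf_neq0// expfz_neq0.
have kP z : ord_at z k = A * M * (z == x)%:Z - B' * N * (z == y)%:Z.
  rewrite ord_atM ?expfz_neq0// !ord_atXz//; apply: (@intr_inj rat).
  rewrite intrD !intrM -fP -gP intrB !intrM intrN !intrM.
  have -> : ((z == x)%:Z%:~R = (z == x)%:R :> rat) by case: (z == x).
  have -> : ((z == y)%:Z%:~R = (z == y)%:R :> rat) by case: (z == y).
  by rewrite !numqE; ring.
clearbody k.
move: (A * M) (B' * N) A0 B0 kP => {}A {}B' A0 B0 kP.
wlog Apos : A B' k k0 A0 B0 kP / (0 < A)%R.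
  move=> W; have [Ap|An|A00] := ltgtP 0 A; first exact: (W A B' k).
    apply: (W (- A) (- B') k^-1); rewrite ?oppr_eq0 ?invr_eq0 ?oppr_gt0//.
    by move=> z; rewrite ord_atV// kP; lia.
  by rewrite -A00 eqxx in A0.
have Bpos : (0 < B')%R.
  rewrite ltNge; apply/negP => Bn.
  have := @no_pole_ord _ _ X_curve X_regular k k0 _ x; rewrite kP eqxx (negPf xy).
  rewrite mulr1 mulr0 subr0 => W; move/eqP: A0; apply; apply: W => z.
  by apply/stalkE; right; rewrite kP; nia.
exists k, `|A|%N, `|B'|%N; split; rewrite ?absz_gt0//.
move=> z; rewrite kP !gtz0_abs//; have [->|nzx] := eqVneq z x.
  by rewrite (negPf xy); lia.
by case: (z == y); lia.
Qed.

End PicardFunctions.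

(** * Degrees of principal divisors *)

Section Degree.
Variables (K : fieldType) (X : proj_scheme K).
Hypotheses (X_curve : has_dimension X 1) (X_regular : regular_scheme X).
Hypothesis X_pic : dim_PicQ X 1.
Local Notation F := (ffield X).
Implicit Types (x y z : closed_point X) (h f : F).

Let stalkE x h : stalk x h <-> vge x 0 h. Proof. exact: stalkE. Qed.
Let vge_sub x r : ksubspace (emb X) (vge x r). Proof. exact: vge_subspace. Qed.
Let vge_mul x r t h k : vge x r h -> vge x t k -> vge x (r + t) (h * k).
Proof. exact: vge_mul. Qed.
Let ord_atM x h k : h != 0 -> k != 0 -> ord_at x (h * k) = ord_at x h + ord_at x k.
Proof. exact: ord_atM. Qed.

Definition regular_off y h := forall z, z != y -> vge z 0 h.

(* Modulo functions vanishing at y, and without poles elsewhere, hence zero,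
   a pole of order at most M leaves room for (M+1) [kappa(y):K] dimensions. *)
Lemma indep_pole_bound y M m (a : 'I_m -> F) :
  (forall j, regular_off y (a j)) -> (forall j, vge y (- M%:Z) (a j)) ->
  indep_mod (emb X) [set 0] a -> (m <= M.+1 * res_deg y)%N.
Proof.
move=> areg apole aind.
have [pi pi0 pi1] := exists_uniformizer X_curve X_regular y.
have [e [ey _ eg]] := res_deg_basis X_curve X_regular y.
(* Leading coefficients for the pole orders 0, ..., M; hence the factor [M.+1]. *)
pose b := [seq pi ^ (- k%:Z) * e i | k <- iota 0 M.+1, i <- enum 'I_(res_deg y)].
have [sb0 sbD sbZ] := span_mod_subspace y b.
have span k h : (k <= M.+1)%N -> vge y (1 - k%:Z) h -> span_mod y b h.
  elim: k h => [|k IHk] h kM hk; first by apply: span_mod_max; rewrite subr0 in hk.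
  have xh : stalk y (h * pi ^ k%:Z).
    apply/stalkE; rewrite (_ : 0 = (1 - k.+1%:Z) + k%:Z); last lia.
    by apply: vge_mul => //; right; rewrite ord_atXz// pi1 mul1r.
  have [c cP] := eg _ xh.
  have -> : h = (h * pi ^ k%:Z - lcomb (emb X) c e) * pi ^ (- k%:Z)
       + \sum_i emb X (c i) * (pi ^ (- k%:Z) * e i).
    rewrite mulrBl -mulrA -expfzDr// addrN expr0z mulr1 /lcomb mulr_suml.
    rewrite -[LHS]addr0 -addrA; congr (_ + _); rewrite addrC -sumrB big1// => i _.
    by rewrite mulrA mulrAC subrr.
  apply: (sbD).
    apply: IHk; first exact: ltnW.
    by apply: vge_mul => //; right; rewrite ord_atXz// pi1 mul1r.
  apply: ksubspace_sum; first exact: span_mod_subspace.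
  move=> i _; apply: (sbZ); apply: span_mod_gen; apply/allpairsP; exists (k, i).
  by rewrite mem_iota mem_enum /= add0n.
have -> : (M.+1 * res_deg y = size b)%N by rewrite size_allpairs size_iota size_enum_ord.
apply: (@indep_mod_le _ _ (emb X) (vge y (- M%:Z)) (vge y 1) _ _
  (fun i => b`_i) a (vge_sub _ _)) => //.
  by move=> v yv; apply: span_mod_lcomb; apply: (span M.+1 v) => //; apply: vge_le yv; lia.
move=> c yc; apply: aind => /=; apply: contrapT => /eqP c0.
have := no_pole_ord X_curve X_regular c0; set s := lcomb _ _ _ in yc c0 *.
have oy : (1 <= ord_at y s)%R by apply/vge_neq0.
have W z : stalk z s.
  apply/stalkE; have [->|zy] := eqVneq z y; first by right; apply: le_trans oy.
  rewrite /s; apply: ksubspace_lcomb; first exact: vge_sub.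
  by move=> i; exact: areg.
by move=> /(_ W y) oy0; rewrite oy0 in oy.
Qed.

(** Multiply h by a function P that has order 0 at x, poles at y only, and enough zeros to cancel
    the other poles of h. A polynomial in P inverting it modulo the maximal ideal at x then restores
    h up to order j + 1. *)
Lemma approximation x y j h : x != y -> (0 <= j)%R -> vge x j h ->
  exists v, regular_off y v /\ vge x (j + 1) (v - h).
Proof.
move=> xy j0; have [->|h0] := eqVneq h 0.
  by move=> _; exists 0; rewrite subr0; split=> [z _|]; left.
move=> hj; have oj : (j <= ord_at x h)%R by apply/vge_neq0.
have /finite_seqP [S SE] := finite_ord_support X_curve X_regular h0.
have /choice[f fP] z : exists f, f != 0 /\ (forall w, w != y -> (0 <= ord_at w f)%R)
    /\ (z != x -> ord_at x f = 0) /\ (z != y -> (0 < ord_at z f)%R).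
  have [->|zy] := eqVneq z y.
    exists 1; rewrite oner_neq0; split => //; split; last by rewrite ord_at1.
    by move=> w _; rewrite ord_at1.
  have [f [a [b [f0 a0 b0 fP]]]] := pic_function X_curve X_regular X_pic zy.
  exists f; split => //; split.
    by move=> w /negPf wy; rewrite fP wy; case: ifP.
  split=> [zx|_]; last by rewrite fP eqxx; lia.
  by rewrite fP eq_sym (negPf zx) (negPf xy).
pose P := \prod_(z <- S | z != x) f z ^+ `|ord_at z h|%N.
have fX0 z : f z ^+ `|ord_at z h|%N != 0 by rewrite expf_neq0; case: (fP z).
have P0 : P != 0 by rewrite prodf_seq_neq0; apply/allP => z _; apply/implyP.
have oP w : ord_at w P = \sum_(z <- S | z != x) ord_at w (f z) *+ `|ord_at z h|%N.
  rewrite ord_at_prod//; apply: eq_bigr => z _; rewrite ord_atX//.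
  by case: (fP z).
have oPx : ord_at x P = 0.
  by rewrite oP big1// => z zx; case: (fP z) => _ [_ [-> //]]; rewrite mul0rn.
have oPw w : w != y -> (0 <= ord_at w P)%R.
  move=> wy; rewrite oP; apply: sumr_ge0 => z _; rewrite mulrn_wge0//.
  by case: (fP z) => _ [-> //].
have hP w : w != y -> vge w 0 (h * P).
  move=> wy; right; rewrite ord_atM//; have [->|wx] := eqVneq w x.
    by rewrite oPx addr0 (le_trans j0).
  have [w0|ow] := leP 0 (ord_at w h); first by rewrite addr_ge0// oPw.
  have wS : w \in S.
    by have : [set` S] w by rewrite -SE /=; exact: ltr0_neq0.
  rewrite oP (big_rem w)//= wx addrA.
  have fw : (0 < ord_at w (f w))%R by case: (fP w) => _ [_ [_]]; apply.
  apply: addr_ge0.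
    rewrite -mulr_natr natz abszE ltr0_norm//.
    by move: fw ow; move: (ord_at w h) (ord_at w (f w)) => o p; nia.
  apply: sumr_ge0 => z _; rewrite mulrn_wge0//.
  by case: (fP z) => _ [-> //].
have [r rP] := unit_inverse_mod X_curve X_regular P0 oPx.
exists (h * P * evalK r P); split.
  move=> w wy; rewrite -[0]addr0; apply: vge_mul; first exact: hP.
  by apply/stalkE/evalK_stalk/stalkE; right; exact: oPw.
have -> : h * P * evalK r P - h = h * (evalK r P * P - 1) by ring.
exact: vge_mul.
Qed.

(** At x the leading part of [w r i] is t_r e_i. The part of lowest order in a relation, divided by
    t_r, is a relation among the e_i modulo the maximal ideal. *)
Lemma indep_of_order x (w : nat -> 'I_(res_deg x) -> F) (t : nat -> F) e :
  indep_mod (emb X) (vge x 1) e -> (forall r, t r != 0) ->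
  (forall r, ord_at x (t r) = r%:Z) -> (forall i, stalk x (e i)) ->
  (forall r i, vge x (r.+1) (w r i - t r * e i)) ->
  forall R (c : nat -> 'I_(res_deg x) -> K),
  \sum_(r < R) \sum_i emb X (c r i) * w r i = 0 ->
  forall r, (r < R)%N -> forall i, c r i = 0.
Proof.
move=> ei t0 ot ex wP R c cE.
have wr (r : nat) i : vge x r (w r i).
  rewrite -(subrK (t r * e i) (w r i)); apply: vge_add => //.
    by apply: vge_le (wP r i); lia.
  rewrite -[r%:Z]addr0; apply: vge_mul; last exact/stalkE.
  by right; rewrite ot.
suff claim n : (n <= R)%N -> forall r, (r < n)%N -> forall i, c r i = 0 by exact: claim.
elim: n => // n IHn nR r; rewrite ltnS leq_eqVlt => /orP[/eqP ->|rn]; last exact: IHn (ltnW nR) _ rn.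
apply: ei; have [_ _ vZ] := vge_sub x n.+1.
have S1 : vge x n.+1 (\sum_i emb X (c n i) * w n i).
  have := cE; rewrite (bigD1 (Ordinal nR))//= => /eqP; rewrite addr_eq0 => /eqP ->.
  apply: (ksubspaceN (vge_sub _ _)); apply: ksubspace_sum => [|r' nr']; first exact: vge_sub.
  apply: ksubspace_sum => [|i _]; first exact: vge_sub.
  have [rn|nr] := ltnP r' n.
    by rewrite (IHn (ltnW nR) _ rn) rmorph0 mul0r; left.
  apply: (vZ); apply: vge_le (wr _ _).
  have : nat_of_ord r' != n by apply: contraNneq nr' => e'; apply/eqP/val_inj.
  lia.
have -> : lcomb (emb X) (c n) e = (t n)^-1 * (\sum_i emb X (c n i) * w n i -
     \sum_i emb X (c n i) * (w n i - t n * e i)).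
  rewrite -sumrB /lcomb mulr_sumr; apply: eq_bigr => i _.
  by field.
rewrite (_ : 1 = - n%:Z + n.+1%:Z); last lia.
apply: vge_mul; first by right; rewrite ord_atV// ot.
apply: (ksubspaceB (vge_sub _ _)) => //.
by apply: ksubspace_sum => [|i _]; [exact: vge_sub|exact: vZ].
Qed.

(* The functions f^k v_(j,i) are independent, as their orders at x are
   k a + j, while their poles at y have order k b + O(1). *)
Lemma degree_le x y f (a b : nat) : x != y -> f != 0 -> (0 < a)%N ->
  (forall z, ord_at z f = if z == x then a%:Z else if z == y then - b%:Z else 0) ->
  (a * res_deg x <= b * res_deg y)%N.
Proof.
move=> xy f0 a0 fP.
have [pi pi0 pi1] := exists_uniformizer X_curve X_regular x.
have [e [ex ei _]] := res_deg_basis X_curve X_regular x.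
set d := res_deg x in e ex ei *.
have /choice[v vP] (p : nat * 'I_d) : exists v,
    regular_off y v /\ vge x (p.1%:Z + 1) (v - pi ^+ p.1 * e p.2).
  apply: approximation => //; rewrite -[p.1%:Z]addr0; apply: vge_mul; last exact/stalkE.
  by right; rewrite ord_atX// pi1 -mulr_natr natz mul1r.
(* A crude common bound for the poles at y of all v (j, i) with j < a. *)
pose C := (\sum_(j < a) \sum_(i < d) `|ord_at y (v (nat_of_ord j, i))|)%N.
have vC j i : (j < a)%N -> vge y (- C%:Z) (v (j, i)).
  move=> ja; right; have : (`|ord_at y (v (j, i))| <= C)%N.
    rewrite /C (bigD1 (Ordinal ja))//= (bigD1 i)//= -addnA; exact: leq_addr.
  lia.
(* Euclidean division r = k a + j makes every order r at x occur once. *)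
pose w r i := f ^+ (r %/ a) * v ((r %% a)%N, i).
pose t r := f ^+ (r %/ a) * pi ^+ (r %% a).
have t0 r : t r != 0 by rewrite mulf_neq0 ?expf_neq0.
have fx : ord_at x f = a by rewrite fP eqxx.
have ot r : ord_at x (t r) = r.
  rewrite /t ord_atM ?expf_neq0// !ord_atX// pi1 fx.
  rewrite -[a%:Z *+ _]mulr_natr -[1 *+ _]mulr_natr !natz.
  by rewrite mul1r -PoszM -PoszD mulnC -divn_eq.
have wP (r : nat) i : vge x r.+1 (w r i - t r * e i).
  rewrite /w /t -mulrA -mulrBr (_ : r.+1%:Z = (r %/ a * a)%N%:Z + ((r %% a)%N%:Z + 1)).
    apply: vge_mul; last by have [_] := vP ((r %% a)%N, i).
    by right; rewrite ord_atX// fx -mulr_natr natz mulnC PoszM.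
  by have := divn_eq r a; lia.
have bound l : (l.+1 * a * d <= (l * b + C).+1 * res_deg y)%N.
  pose T := ('I_(l.+1 * a) * 'I_d)%type.
  pose u (k : 'I_#|{: T}|) := w (enum_val k).1 (enum_val k).2.
  have <- : #|{: T}| = (l.+1 * a * d)%N by rewrite card_prod !card_ord.
  apply: (@indep_pole_bound y _ _ u).
  - move=> k z zy; rewrite /u /w -[0]addr0; apply: vge_mul; last first.
      by have [+ _] := vP (((enum_val k).1 %% a)%N, (enum_val k).2); apply.
    right; rewrite ord_atX// mulrn_wge0// fP (negPf zy).
    by case: ifP.
  - move=> k; rewrite /u /w PoszD opprD; apply: vge_mul; last first.
      by apply: vC; rewrite ltn_mod.
    right; rewrite ord_atX// fP eq_sym (negPf xy) eqxx -mulr_natr natz.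
    rewrite PoszM mulNr lerN2 mulrC ler_wpM2r//.
    have := ltn_ord (enum_val k).1; move: (nat_of_ord _) => r rl.
    by rewrite lez_nat -ltnS ltn_divLR.
  - move=> c cE k; pose c' r i := oapp (fun r' : 'I_(l.+1 * a) => c (enum_rank (r', i))) 0 (insub r).
    have c'E (r : 'I_(l.+1 * a)) i : c' r i = c (enum_rank (r, i)).
      by rewrite /c' valK.
    have := @indep_of_order x w t e ei t0 ot ex wP (l.+1 * a)%N c' _
      (enum_val k).1 (ltn_ord _) (enum_val k).2.
    rewrite c'E -surjective_pairing enum_valK; apply.
    rewrite pair_big /= -[RHS]cE /lcomb (reindex (@enum_val T {: T})) /=; last first.
      exact: onW_bij (enum_val_bij T).
    apply: eq_bigr => k' _; rewrite c'E -surjective_pairing enum_valK.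
    by [].
rewrite leqNgt; apply/negP => lt.
(* If a [kappa(x):K] exceeds b [kappa(y):K], the left side of [bound] gains at least 1 on the right
   side with each step of l; this l outweighs the constant terms. *)
have := bound ((C.+1) * res_deg y).+1.
move: lt; move: (res_deg y) => dy.
set l := (C.+1 * dy).+1 => lt.
rewrite leqNgt => /negP; apply.
apply: (@leq_trans (l.+1 * (b * dy).+1)); last by rewrite -mulnA leq_mul2l.
by rewrite /l; nia.
Qed.

Lemma degree_balanced x y f (a b : nat) : x != y -> f != 0 -> (0 < a)%N -> (0 < b)%N ->
  (forall z, ord_at z f = if z == x then a%:Z else if z == y then - b%:Z else 0) ->
  (a * res_deg x = b * res_deg y)%N.
Proof.
move=> xy f0 a0 b0 fP; apply/eqP; rewrite eqn_leq (degree_le xy f0 a0 fP) /=.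
apply: (@degree_le y x f^-1); rewrite ?invr_eq0// 1?eq_sym// => z.
rewrite ord_atV// fP; have [->|zx] := eqVneq z x; first by rewrite (negPf xy).
by case: (z == y); rewrite ?opprK ?oppr0.
Qed.

End Degree.

(** * Degree, principal R-divisors and spaces of sections *)

Section DivisorDegree.
Variables (K : fieldType) (X : proj_scheme K).
Hypotheses (X_curve : has_dimension X 1) (X_regular : regular_scheme X).
Hypothesis X_pic : dim_PicQ X 1.
Local Notation F := (ffield X).
Local Notation cp := (closed_point X).
Implicit Types (x y z w : cp) (h f : F) (T : seq cp).

Let ord_atM x h k : h != 0 -> k != 0 -> ord_at x (h * k) = ord_at x h + ord_at x k.
Proof. exact: ord_atM. Qed.
Let ord_atXz x h n : h != 0 -> ord_at x (h ^ n) = ord_at x h * n.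
Proof. exact: ord_atXz. Qed.
Let ord_atX x h n : h != 0 -> ord_at x (h ^+ n) = ord_at x h *+ n.
Proof. exact: ord_atX. Qed.

(** With the base point y fixed, the functions f x move every divisor to y. *)
Lemma balanced_functions y : exists (f : cp -> F) (a b : cp -> nat), forall x, x != y ->
  [/\ f x != 0, (0 < a x)%N, (0 < b x)%N, (a x * res_deg x = b x * res_deg y)%N
    & forall z, ord_at z (f x) =
        if z == x then (a x)%:Z else if z == y then - (b x)%:Z else 0].
Proof.
have /choice[t tP] x : exists t : F * nat * nat, x != y ->
    [/\ t.1.1 != 0, (0 < t.1.2)%N, (0 < t.2)%N,
     (t.1.2 * res_deg x = t.2 * res_deg y)%N & forall z, ord_at z t.1.1 =
        if z == x then t.1.2%:Z else if z == y then - t.2%:Z else 0].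
  have [_|xy] := eqVneq x y; first by exists (1, 0%N, 0%N).
  have [f [a [b [f0 a0 b0 fP]]]] := pic_function X_curve X_regular X_pic xy.
  exists (f, a, b) => _; split => //.
  exact: (degree_balanced X_curve X_regular X_pic xy f0 a0 b0 fP).
by exists (fun x => (t x).1.1), (fun x => (t x).1.2), (fun x => (t x).2).
Qed.

Lemma ord_at_single y h : h != 0 -> (forall x, x != y -> ord_at x h = 0) -> ord_at y h = 0.
Proof.
move=> h0 hy; have [hp|hn] := leP 0 (ord_at y h).
  apply: (no_pole_ord X_curve X_regular h0) => x; apply/stalkE => //; right.
  by have [->//|/hy ->] := eqVneq x y.
apply/eqP; rewrite -oppr_eq0 -(ord_atV X_curve X_regular)//; apply/eqP.
apply: (no_pole_ord X_curve X_regular) => [|x]; rewrite ?invr_eq0//.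
apply/stalkE => //; right; rewrite ord_atV// oppr_ge0.
by have [->|/hy ->] := eqVneq x y; first exact: ltW.
Qed.

(** Induction on the support: h^(a x) f_x^(- ord_x h) has order 0 at x, and f_x has degree 0, so the
    degree of h is only multiplied by a x > 0. *)
Lemma degree_principal_off y T h : h != 0 -> uniq T -> y \notin T ->
  (forall x, x \notin T -> x != y -> ord_at x h = 0) ->
  \sum_(x <- T) ord_at x h * (res_deg x)%:Z + ord_at y h * (res_deg y)%:Z = 0.
Proof.
have [f [a [b fP]]] := balanced_functions y.
elim: T h => [|x T IHT] h h0.
  by move=> _ _ hT; rewrite big_nil add0r (ord_at_single h0) ?mul0r// => x; exact: hT.
move=> /= /andP[xT uT]; rewrite inE negb_or eq_sym => /andP[xy yT] hT.
have [fx0 a0 b0 ab fo] := fP _ xy.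
pose h' := h ^ (a x)%:Z * f x ^ (- ord_at x h).
have h'0 : h' != 0 by rewrite mulf_neq0// expfz_neq0.
have oh' z : ord_at z h' = ord_at z h * (a x)%:Z - ord_at x h * ord_at z (f x).
  by rewrite ord_atM ?expfz_neq0// !ord_atXz// mulrN mulrC [_ * ord_at x h]mulrC; ring.
have h'x : ord_at x h' = 0 by rewrite oh' fo eqxx subrr.
have := IHT h' h'0 uT yT _; rewrite !oh' fo eq_sym (negPf xy) eqxx.
have -> : \sum_(z <- T) ord_at z h' * (res_deg z)%:Z =
    (a x)%:Z * \sum_(z <- T) ord_at z h * (res_deg z)%:Z.
  rewrite mulr_sumr; apply: eq_big_seq => z zT; rewrite oh' fo.
  have /negPf-> : z != x by apply: contraNneq xT => <-.
  have /negPf-> : z != y by apply: contraNneq yT => <-.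
  by rewrite mulr0 subr0; ring.
move=> W; have {}W := W _; rewrite big_cons; apply: (@mulfI _ (a x)%:Z); first by lia.
rewrite mulr0 -[RHS]W; last first.
  move=> z zT zy; have [->//|zx] := eqVneq z x; rewrite oh' fo (negPf zx) (negPf zy) mulr0 subr0.
  by rewrite hT ?mul0r// inE negb_or zx.
have abZ : (a x)%:Z * (res_deg x)%:Z = (b x)%:Z * (res_deg y)%:Z by rewrite -!PoszM ab.
rewrite !mulrDr addrAC; rewrite [X in X + _ + _](_ : _ = ord_at x h * ((b x)%:Z * (res_deg y)%:Z)).
  by ring.
by rewrite -abZ; ring.
Qed.

Section Real.
Variable R : realType.
Implicit Types (E : cp -> R) (s : ratR X R).

Definition supported T E := forall x, x \notin T -> E x = 0.

(** The list is a parameter because the same sum serves for slopes, whose support may be infinite.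
    For a divisor, all duplicate-free lists containing the support agree. *)
Definition degree T E : R := \sum_(x <- T) E x * (res_deg x)%:R.

Lemma degree_indep T T' E : uniq T -> uniq T' -> supported T E -> supported T' E ->
  degree T E = degree T' E.
Proof.
move=> uT uT' sT sT'; rewrite /degree.
have nz S : \sum_(x <- S) E x * (res_deg x)%:R =
    \sum_(x <- [seq x <- S | E x != 0]) E x * (res_deg x)%:R.
  rewrite big_filter [RHS]big_mkcond; apply: eq_bigr => x _ /=.
  by case: eqP => //= ->; rewrite mul0r.
rewrite (nz T) (nz T'); apply: perm_big; apply: uniq_perm; rewrite ?filter_uniq// => x.
rewrite !mem_filter; case: eqP => //= /eqP Ex.
have -> : x \in T by apply: contraR Ex => /sT ->.
by symmetry; apply: contraR Ex => /sT' ->.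
Qed.

Lemma degree_le_fun T E E' : (forall x, E x <= E' x) -> degree T E <= degree T E'.
Proof. by move=> EE; apply: ler_sum => x _; rewrite ler_wpM2r. Qed.

Lemma degreeD T E E' : degree T (fun x => E x + E' x) = degree T E + degree T E'.
Proof. by rewrite -big_split; apply: eq_bigr => x _; rewrite mulrDl. Qed.

Lemma degreeZ T (c : R) E : degree T (fun x => c * E x) = c * degree T E.
Proof. by rewrite /degree mulr_sumr; apply: eq_bigr => x _; rewrite mulrA. Qed.

Lemma degree_prdiv T h : h != 0 -> uniq T ->
  supported T (fun x => (ord_at x h)%:~R) -> degree T (fun x => (ord_at x h)%:~R) = 0.
Proof.
move=> h0 uT sT; have [y _] := closed_point_exists X_curve X_regular.
pose T1 := [seq x <- T | x != y].
have uT1 : uniq T1 by rewrite filter_uniq.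
have yT1 : y \notin T1 by rewrite mem_filter eqxx.
have sT1 x : x \notin T1 -> x != y -> ord_at x h = 0.
  rewrite mem_filter => + xy; rewrite xy /= => /sT /eqP.
  by rewrite intr_eq0 => /eqP.
rewrite (@degree_indep _ (y :: T1)) //=; [|by rewrite yT1|]; last first.
  by move=> x; rewrite inE negb_or => /andP[xy xT1]; rewrite sT1.
have := degree_principal_off h0 uT1 yT1 sT1 => /(congr1 (fun n : int => n%:~R : R)).
rewrite intrD rmorph_sum /= /degree big_cons => W.
rewrite addrC -[RHS]W intrM; congr (_ + _).
by apply: eq_bigr => x _; rewrite intrM.
Qed.

Lemma ratR_support s : exists T, uniq T /\
  forall af, af \in ratR_terms s -> supported T (fun x => (ord_at x af.2)%:~R).
Proof.
have /finite_seqP[T TE] := finite_support_seq X_curve X_regular [seq af.2 | af <- s].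
exists (undup T); split; first exact: undup_uniq.
move=> af afs x; rewrite mem_undup => xT; apply/eqP; rewrite intr_eq0.
apply: contraNT xT => ox; have : [set` T] x.
  rewrite -TE; exists af.2; split=> //; first exact: map_f.
  by have /allP := ratRP s; apply.
by [].
Qed.

Lemma divR_support s : exists T, uniq T /\ supported T (divR s).
Proof.
have [T [uT sT]] := ratR_support s; exists T; split=> // x xT.
by rewrite /divR big1_seq// => af /= afs; rewrite (sT _ afs)// mulr0.
Qed.

Lemma degree_divR T s : uniq T -> supported T (divR s) -> degree T (divR s) = 0.
Proof.
move=> uT sT; have [T0 [uT0 sT0]] := ratR_support s.
rewrite (@degree_indep _ T0) //; last first.
  by move=> x xT; rewrite /divR big1_seq// => af /= afs; rewrite (sT0 _ afs)// mulr0.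
rewrite /degree /divR; under eq_bigr do rewrite mulr_suml.
rewrite exchange_big big1_seq//= => af afs.
under eq_bigr do rewrite -mulrA.
rewrite -mulr_sumr; have := degree_prdiv _ uT0 (sT0 _ afs); rewrite /degree => ->; rewrite ?mulr0//.
by have /allP := ratRP s; apply.
Qed.

Lemma supported_cons y T E : supported T E -> supported (y :: [seq x <- T | x != y]) E.
Proof.
move=> sT x; rewrite inE negb_or mem_filter => /andP[xy]; rewrite xy /=; exact: sT.
Qed.

Lemma degree_cons y T E : uniq T -> supported T E ->
  degree T E = degree (y :: [seq x <- T | x != y]) E.
Proof.
move=> uT sT; apply: degree_indep => //; last exact: supported_cons.
by rewrite /= mem_filter eqxx filter_uniq.
Qed.

(** Real multiples of the functions f_x realise E away from y. At y the values agree because both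
    divisors have degree 0. *)
Lemma principal_of_degree0 T E : uniq T -> supported T E -> degree T E = 0 ->
  exists s, forall x, divR s x = E x.
Proof.
move=> uT sT dE; have [y _] := closed_point_exists X_curve X_regular.
have [f [a [b fP]]] := balanced_functions y.
pose T1 := [seq x <- T | x != y].
have uT1 : uniq T1 by rewrite filter_uniq.
have T1y x : x \in T1 -> x != y by rewrite mem_filter => /andP[].
pose t := [seq (E x / (a x)%:R, f x) | x <- T1].
have tP : all (fun af : R * F => af.2 != 0) t.
  by apply/allP => _ /mapP [x /T1y xy ->] /=; case: (fP _ xy).
exists (RatR tP); set s := RatR tP.
have off x : x != y -> divR s x = E x.
  move=> xy; rewrite /divR /= big_map.
  have [xT|xT] := boolP (x \in T1); last first.
    rewrite big1_seq ?sT//; first by move: xT; rewrite mem_filter xy.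
    move=> z /= zT; have [_ _ _ _ ->] := fP _ (T1y _ zT).
    have /negPf-> : x != z by apply: contraNneq xT => ->.
    by rewrite (negPf xy) mulr0.
  rewrite (bigD1_seq x)//= big1_seq; last first.
    move=> z /andP[zx zT]; have [_ _ _ _ ->] := fP _ (T1y _ zT).
    by rewrite eq_sym (negPf zx) (negPf xy) mulr0.
  have [_ a0 _ _ ->] := fP _ xy; rewrite eqxx addr0 mulfVK// pnatr_eq0.
  by rewrite -lt0n.
have [T2 [uT2 sT2]] := divR_support s.
pose T3 := y :: [seq x <- undup (T ++ T2) | x != y].
have uT3 : uniq T3 by rewrite /= mem_filter eqxx filter_uniq// undup_uniq.
have s1 : supported T3 E.
  by apply: supported_cons => x; rewrite mem_undup mem_cat negb_or => /andP[/sT].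
have s2 : supported T3 (divR s).
  by apply: supported_cons => x; rewrite mem_undup mem_cat negb_or => /andP[_ /sT2].
have d1 : degree T3 E = 0 by rewrite -dE; exact: degree_indep.
have d2 := degree_divR uT3 s2.
move=> x; have [->|] := eqVneq x y; last exact: off.
move: d2; rewrite -d1 /degree /T3 !big_cons => e.
have e' : \sum_(x0 <- [seq x <- undup (T ++ T2) | x != y]) divR s x0 * (res_deg x0)%:R =
   \sum_(x0 <- [seq x <- undup (T ++ T2) | x != y]) E x0 * (res_deg x0)%:R.
  by apply: eq_big_seq => z; rewrite mem_filter => /andP[zy _]; rewrite off.
move: e; rewrite e' => /addIr /mulIf; apply.
by rewrite pnatr_eq0 -lt0n res_deg_gt0.
Qed.

Definition sections_of (E : cp -> R) : set F :=
  [set s | s = 0 \/ s != 0 /\ forall x, - E x <= (ord_at x s)%:~R].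

Lemma indep_neq0 m (c : 'I_m -> F) : indep_mod (emb X) [set 0] c -> forall j, c j != 0.
Proof.
move=> ic j; apply/eqP => cj; have := ic (fun i => (i == j)%:R) _ j.
rewrite eqxx /lcomb (bigD1 j)//= cj mulr0 add0r big1 => [|i /negPf ->]; last first.
  by rewrite rmorph0 mul0r.
by move=> /(_ erefl) /eqP; rewrite oner_eq0.
Qed.

Lemma indep_mulr m (c : 'I_m -> F) g : g != 0 -> indep_mod (emb X) [set 0] c ->
  indep_mod (emb X) [set 0] (fun j => c j * g).
Proof.
move=> g0 ic d /= dE; apply: ic => /=; apply: (mulIf g0); rewrite mul0r -dE /lcomb mulr_suml.
by apply: eq_bigr => i _; rewrite mulrA.
Qed.

(** A product of the f_x with enough zeros turns all sections of E into functions whose poles lie at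
    y only and have bounded order, so [indep_pole_bound] applies. *)
Lemma sections_bounded T E : uniq T -> supported T E ->
  exists B, forall m (c : 'I_m -> F), (forall j, sections_of E (c j)) ->
  indep_mod (emb X) [set 0] c -> (m <= B)%N.
Proof.
move=> uT sT; have [y _] := closed_point_exists X_curve X_regular.
have [f [a [b fP]]] := balanced_functions y.
pose T1 := [seq x <- T | x != y].
have uT1 : uniq T1 by rewrite filter_uniq.
have T1y x : x \in T1 -> x != y by rewrite mem_filter => /andP[].
have /choice[N NP] x : exists N : nat, `|E x| <= N%:R.
  by exists (Num.truncn `|E x|).+1; rewrite ltW// truncnS_gt.
pose f' x := if x == y then 1 else f x.
have f'0 x : f' x != 0.
  by rewrite /f'; case: (eqVneq x y) => [_|/fP []//]; exact: oner_neq0.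
pose g := \prod_(x <- T1) f' x ^+ N x.
have g0 : g != 0 by rewrite prodf_seq_neq0; apply/allP => x _; rewrite expf_neq0.
have og z : ord_at z g = \sum_(x <- T1) ord_at z (f' x) *+ N x.
  rewrite (ord_at_prod X_curve X_regular); last by move=> x; rewrite expf_neq0.
  by apply: eq_bigr => x _; rewrite ord_atX.
pose M := (`|ord_at y g| + N y)%N.
exists (M.+1 * res_deg y)%N => m c cE ic.
have c0 := indep_neq0 ic.
apply: (indep_pole_bound X_curve X_regular (a := fun j => c j * g)); last exact: indep_mulr.
- move=> j z zy; right; rewrite ord_atM//.
  case: (cE j) => [cj|[_ /(_ z) cz]]; first by have := c0 j; rewrite cj eqxx.
  have of' x : x \in T1 -> ord_at z (f' x) = if z == x then (a x)%:Z else 0.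
    by move=> /T1y xy; have [_ _ _ _ fo] := fP _ xy; rewrite /f' (negPf xy) fo (negPf zy).
  have [zT|zT] := boolP (z \in T1).
    have -> : ord_at z g = (a z)%:Z *+ N z.
      rewrite og (bigD1_seq z)//= of'// eqxx big1_seq ?addr0// => x /andP[xz xT].
      by rewrite of'// eq_sym (negPf xz) mul0rn.
    have [_ a0 _ _ _] := fP _ zy.
    have : - (N z)%:Z <= ord_at z (c j).
      rewrite -(ler_int R) intrN; apply: le_trans cz.
      rewrite lerN2; apply: le_trans (NP z); exact: ler_norm.
    by rewrite -mulr_natr natz; move: (ord_at z _) => o; nia.
  have -> : ord_at z g = 0.
    rewrite og big1_seq// => x /= xT; rewrite of'//.
    have /negPf-> : z != x by apply: contraNneq zT => ->.
    by rewrite mul0rn.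
  rewrite addr0 -(ler_int R); move: cz; rewrite sT ?oppr0//.
  by move: zT; rewrite mem_filter zy.
- move=> j; right; rewrite ord_atM//.
  case: (cE j) => [cj|[_ /(_ y) cz]]; first by have := c0 j; rewrite cj eqxx.
  have : - (N y)%:Z <= ord_at y (c j).
    rewrite -(ler_int R) intrN; apply: le_trans cz.
    rewrite lerN2; apply: le_trans (NP y); exact: ler_norm.
  by rewrite /M; lia.
Qed.

(** Divided by the first of them, the functions have no poles, and only their residues at y are left
    to count. *)
Lemma indep_same_order y m (c : 'I_m -> F) (o : cp -> int) :
  (forall j x, ord_at x (c j) = o x) -> indep_mod (emb X) [set 0] c ->
  (m <= res_deg y)%N.
Proof.
case: m c => // m c oc ic; have c0 := indep_neq0 ic.
rewrite -[res_deg y]mul1n.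
have cV : (c ord0)^-1 != 0 by rewrite invr_eq0.
have reg z j : vge z 0 (c j * (c ord0)^-1).
  by right; rewrite ord_atM// ord_atV// !oc subrr.
apply: (@indep_pole_bound _ _ X_curve X_regular y 0 _ (fun j => c j * (c ord0)^-1)).
- by move=> j z _; exact: reg.
- by move=> j; exact: reg.
- exact: indep_mulr.
Qed.

Lemma exists_other_point y : exists w, w != y.
Proof.
have [pi pi0 pi1] := exists_uniformizer X_curve X_regular y.
apply: contrapT => none; have : ord_at y pi = 0.
  apply: ord_at_single => // x xy; exfalso; apply: none; by exists x.
by rewrite pi1.
Qed.

(** Moving n E to y requires rounding n E x / a_x down at each x, at a cost of at most b_x, so the
    total cost C is independent of n. The room left at y is filled with powers of one function f_w
    whose only pole is y; they are independent because f_w is transcendental. *)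
Lemma many_sections T E : uniq T -> supported T E -> 0 < degree T E ->
  exists c : R, 0 < c /\ exists n0 : nat, forall n, (n0 <= n)%N ->
  exists m (u : 'I_m -> F), [/\ c * n%:R <= m%:R,
    indep_mod (emb X) [set 0] u & forall j, sections_of (fun x => n%:R * E x) (u j)].
Proof.
move=> uT sT; have [y _] := closed_point_exists X_curve X_regular.
have [f [a [b fP]]] := balanced_functions y.
rewrite (degree_cons y uT sT) => dE.
pose T1 := [seq x <- T | x != y].
have uT1 : uniq T1 by rewrite filter_uniq.
have T1y x : x \in T1 -> x != y by rewrite mem_filter => /andP[].
have dy0 : 0 < (res_deg y)%:R :> R by rewrite ltr0n res_deg_gt0.
(* The coefficient at y once all of E has been moved there. *)
pose e := degree (y :: T1) E / (res_deg y)%:R.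
have e0 : 0 < e by rewrite divr_gt0.
have eE : e = E y + \sum_(x <- T1) E x / (a x)%:R * (b x)%:R.
  rewrite /e /degree big_cons mulrDl mulfK ?gt_eqF//; congr (_ + _).
  rewrite mulr_suml; apply: eq_big_seq => x /T1y xy.
  have [_ a0 _ ab _] := fP _ xy.
  have /(congr1 (fun n : nat => n%:R : R)) := ab; rewrite !natrM => abR.
  have aR : (a x)%:R != 0 :> R by rewrite pnatr_eq0 -lt0n.
  apply: (mulIf aR); rewrite [RHS]mulrAC mulfVK//.
  apply: (mulIf (lt0r_neq0 dy0)).
  rewrite -[RHS]mulrA -abR.
  by field; rewrite gt_eqF.
pose C : R := \sum_(x <- T1) (b x)%:R.
have C0 : 0 <= C by apply: sumr_ge0.
have [w wy] := exists_other_point y.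
have [fw0 aw0 bw0 _ fwo] := fP _ wy.
have bw : 0 < (b w)%:R :> R by rewrite ltr0n.
(* About (n e - C) / b_w powers of f_w fit; half the density e / b_w absorbs C and the rounding of m
   for large n. *)
exists (e / (2 * (b w)%:R)); split; first by rewrite divr_gt0// mulr_gt0.
exists (Num.truncn ((C + (b w)%:R) * 2 / e)).+1 => n nn0.
have nC : (C + (b w)%:R) * 2 <= n%:R * e.
  rewrite -ler_pdivrMr//; apply: ltW; apply: lt_le_trans (truncnS_gt _) _.
  by rewrite ler_nat.
pose k x := Num.floor (n%:R * E x / (a x)%:R).
pose f' x := if x == y then 1 else f x.
have f'0 x : f' x != 0.
  by rewrite /f'; case: (eqVneq x y) => [_|/fP []//]; exact: oner_neq0.
pose g := \prod_(x <- T1) f' x ^ (- k x).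
have g0 : g != 0 by rewrite prodf_seq_neq0; apply/allP => x _; rewrite expfz_neq0.
have og z : ord_at z g = - \sum_(x <- T1) ord_at z (f x) * k x.
  rewrite (ord_at_prod X_curve X_regular); last by move=> x; rewrite expfz_neq0.
  rewrite -sumrN; apply: eq_big_seq => x /T1y xy.
  by rewrite ord_atXz// mulrN /f' (negPf xy).
pose m := Num.truncn ((n%:R * e - C) / (b w)%:R).
exists m, (fun j => f w ^+ j * g).
have mC : m%:R * (b w)%:R <= n%:R * e - C.
  rewrite -ler_pdivlMr// Num.Theory.truncn_le.
  by rewrite divr_ge0 ?(ltW bw)// subr_ge0; nra.
split.
- have : (n%:R * e - C) / (b w)%:R < m.+1%:R by exact: truncnS_gt.
  rewrite ltr_pdivrMr// -natr1 => mlt; rewrite mulrAC ler_pdivrMr ?mulr_gt0//.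
  nra.
- apply: indep_mulr => // d dE0 j.
  have ow : ord_at y (f w) < 0 by rewrite fwo eq_sym (negPf wy) eqxx oppr_lt0 ltz_nat.
  pose q := \poly_(i < m) (if insub i is Some i' then d i' else 0).
  have qE : evalK q (f w) = 0.
    rewrite -[RHS]dE0 /evalK /lcomb (@horner_coef_wide _ m); last first.
      by rewrite size_map_poly size_poly.
    apply: eq_bigr => i _; rewrite coef_map coef_poly ltn_ord valK.
    by [].
  have q0 : q = 0.
    apply: contrapT => /eqP q0; have [] := evalK_pole X_curve X_regular fw0 ow q0.
    by rewrite qE eqxx.
  have /(congr1 (fun p : {poly K} => p`_j)) := q0; rewrite coef_poly ltn_ord coef0.
  by rewrite valK.
- move=> j; right; split; first by rewrite mulf_neq0// expf_neq0.
  move=> z; rewrite ord_atM ?expf_neq0// ord_atX// og fwo.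
  have [->|zy] := eqVneq z y.
    rewrite eq_sym (negPf wy).
    have -> : \sum_(x <- T1) ord_at y (f x) * k x = - \sum_(x <- T1) (b x)%:Z * k x.
      rewrite -sumrN; apply: eq_big_seq => x /T1y xy; have [_ _ _ _ ->] := fP _ xy.
      by rewrite eq_sym (negPf xy) eqxx mulNr.
    have -> : - (b w)%:Z *+ j = - ((b w)%:Z * j%:Z) by rewrite -mulr_natr natz mulNr.
    rewrite opprK intrD rmorph_sum /= intrN intrM.
    have kb : n%:R * \sum_(x <- T1) E x / (a x)%:R * (b x)%:R - C <=
        \sum_(x <- T1) ((b x)%:Z * k x)%:~R.
      rewrite mulr_sumr /C -sumrB; apply: ler_sum => x _; rewrite intrM.
      have : n%:R * E x / (a x)%:R - 1 <= (k x)%:~R.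
        by have := floorD1_gt (n%:R * E x / (a x)%:R); rewrite intrD -/(k x); lra.
      have : 0 <= (b x)%:R :> R by [].
      rewrite -[(Posz _)%:~R]/((b x)%:R); set B := (b x)%:R; set Q := _ / _ - 1.
      move=> B0 kQ; have := ler_wpM2l B0 kQ; rewrite /Q.
      by move=> H; apply: le_trans H; rewrite le_eqVlt; apply/orP; left; apply/eqP; ring.
    have jm : j%:R * (b w)%:R <= m%:R * (b w)%:R :> R.
      by rewrite ler_pM2r// ler_nat ltnW.
    have nE : n%:R * e = n%:R * E y + n%:R * \sum_(x <- T1) E x / (a x)%:R * (b x)%:R.
      by rewrite eE mulrDr.
    rewrite -[(Posz (b w))%:~R]/((b w)%:R) -[(Posz j)%:~R]/(j%:R).
    move: kb jm mC nE; set S1 := \sum_(x <- T1) _ / _ * _; set S2 := \sum_(x <- T1) _%:~R.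
    lra.
  have jz : 0 <= (if z == w then (a w)%:Z else 0) *+ j by rewrite mulrn_wge0//; case: ifP.
  have [zT|zT] := boolP (z \in T1).
    have -> : \sum_(x <- T1) ord_at z (f x) * k x = (a z)%:Z * k z.
      rewrite (bigD1_seq z)//= big1_seq ?addr0; last first.
        move=> x /andP[xz /T1y xy]; have [_ _ _ _ ->] := fP _ xy.
        by rewrite eq_sym (negPf xz) (negPf zy) mul0r.
      by have [_ _ _ _ ->] := fP _ zy; rewrite eqxx.
    have [_ a0 _ _ _] := fP _ zy.
    have aR : 0 < (a z)%:R :> R by rewrite ltr0n.
    have : (k z)%:~R <= n%:R * E z / (a z)%:R by exact: floor_le.
    rewrite ler_pdivlMr// intrD intrN intrM -[(Posz (a z))%:~R]/((a z)%:R).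
    have : 0 <= ((if z == w then (a w)%:Z else 0) *+ j)%:~R :> R by rewrite ler0z.
    lra.
  rewrite big1_seq ?oppr0 ?addr0; last first.
    move=> x /= xT; have xy := T1y _ xT; have [_ _ _ _ ->] := fP _ xy.
    have /negPf-> : z != x by apply: contraNneq zT => ->.
    by rewrite (negPf zy) mul0r.
  rewrite sT; first by rewrite mulr0 oppr0 ler0z.
  by move: zT; rewrite mem_filter zy.
Qed.

End Real.
End DivisorDegree.

(** * Green functions and their slopes *)

Section BerkovichTopology.
Variables (R : realType) (K : fieldType) (X : proj_scheme K).
Hypotheses (X_curve : has_dimension X 1) (X_regular : regular_scheme X).
Local Notation cp := (closed_point X).
Local Notation berk := (berk R X).
Implicit Types (x y : cp) (D E : cp -> R) (g h : berk -> R) (r t u : R).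

Lemma seg_branch x (t : \bar R) (t0 : (0 < t)%E) : seg x t = branch x t0.
Proof.
by rewrite /seg; case: {-}_ / idP => [t0'|//]; congr branch; exact: bool_irrelevance.
Qed.

Lemma seg_eta0 x (t : \bar R) : (t <= 0)%E -> seg x t = eta0 R X.
Proof.
by move=> t0; rewrite /seg; case: {-}_ / idP => // t0'; move: (lt_le_trans t0' t0); rewrite ltxx.
Qed.

Lemma seg_fin x t (t0 : 0 < t) : seg x t%:E = branch x (eqbRL (lte_fin 0 t) t0).
Proof. exact: seg_branch. Qed.

Lemma berkP (P : berk -> Prop) : P (eta0 R X) -> (forall x t, 0 < t -> P (seg x t%:E)) ->
  (forall x, P (seg x +oo%E)) -> forall xi, P xi.
Proof.
move=> P0 Pf Pi [//|x [t| |] t0]; last by exfalso; move: t0; rewrite ltNge leNye.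
  by rewrite -seg_branch; apply: Pf; rewrite -lte_fin.
by rewrite -seg_branch.
Qed.

Lemma center_seg x t : Defs.center (seg x t%:E : berk) = generic_point X.
Proof.
have [t0|t0] := ltP 0 t; last by rewrite seg_eta0.
by rewrite seg_fin.
Qed.

Lemma center_leaf x : Defs.center (seg x +oo%E : berk) = cpt x.
Proof. by rewrite (seg_branch _ (ltry 0)). Qed.

Lemma anE (U : set (Defs.point X)) (xi : berk) : an U xi = U (Defs.center xi).
Proof. by []. Qed.

Lemma not_leaf_seg x t : ~ is_leaf (seg x t%:E : berk).
Proof.
have [t0|t0] := ltP 0 t; last by rewrite seg_eta0.
by rewrite seg_fin.
Qed.

Lemma log_abs_seg (s : ratR X R) x t : 0 < t ->
  fine (log_abs s (seg x t%:E)) = - (t * divR s x).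
Proof. by move=> t0; rewrite seg_fin. Qed.

Lemma an_ext_seg h x t : an_ext h (seg x t%:E) = (h (seg x t%:E))%:E.
Proof.
have [t0|t0] := ltP 0 t; last by rewrite seg_eta0.
by rewrite seg_fin.
Qed.

Lemma an_ext_leaf h x : an_ext h (seg x +oo%E) = lim ((h (seg x r%:E))%:E @[r --> +oo%R]).
Proof. by rewrite (seg_branch _ (ltry 0)). Qed.

Lemma generic_mem (V : set (Defs.point X)) : open V -> V !=set0 -> V (generic_point X).
Proof. by rewrite zariski_openE => Vo [y /Vo[s [_ sV]]]; apply: sV. Qed.

Lemma within_continuous_open (A : set berk) h (p : berk) : {within A, continuous h} -> A p ->
  forall e, 0 < e -> exists Q, [/\ berk_open Q, Q p & forall q, Q q -> A q -> `|h q - h p| < e].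
Proof.
move=> ch Ap e e0; have : nbhs (p : subspace A) [set q | `|h p - h q| < e].
  by have /cvgrPdist_lt := ch p; apply.
rewrite /nbhs /= -(nbhs_subspace_in Ap) => /=.
rewrite /within /= => nA; have : nbhs p [set q | A q -> `|h p - h q| < e] by exact: nA.
rewrite nbhsE => -[Q [Qo Qp] QA]; exists Q; split => // q Oq Aq.
by rewrite distrC; exact: QA.
Qed.

(** Continuity at the root of the tree: a neighbourhood of [eta0] contains whole branches outside a
    finite set and an initial piece of each remaining one. *)
Definition small_near_root g :=
  (forall e, 0 < e -> exists T : seq cp, forall x, x \notin T -> forall u, 0 < u ->
     `|g (seg x u%:E) - g (eta0 R X)| < e) /\
  (forall x e, 0 < e -> exists2 d, 0 < d & forall u, 0 < u -> u < d ->
     `|g (seg x u%:E) - g (eta0 R X)| < e).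

(** Continuity of g + log|f| at the leaf x, for f a local equation of D there: on the branch log|f|
    is - u D x, and l is the value at the leaf. *)
Definition asymptotic D g := forall x, exists l, forall e, 0 < e ->
  exists2 M, 0 < M & forall u, M < u -> `|g (seg x u%:E) - u * D x - l| < e.

(* What the proof uses of an adelic divisor. *)
Definition tame D g := [/\ exists T, supported T D, small_near_root g & asymptotic D g].

Lemma tameD D D' g g' : tame D g -> tame D' g' -> tame (D + D') (g + g').
Proof.
move=> [[T sT] [g1 g2] g3] [[T' sT'] [g1' g2'] g3']; split.
- exists (T ++ T') => x; rewrite mem_cat negb_or => /andP[xT xT'].
  by rewrite /GRing.add /= sT// sT'// addr0.
- split.
    move=> e e0; have [S SP] := g1 _ (divr_gt0 e0 (ltr0n R 2)).
    have [S' S'P] := g1' _ (divr_gt0 e0 (ltr0n R 2)).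
    exists (S ++ S') => x; rewrite mem_cat negb_or => /andP[xS xS'] u u0.
    have := SP x xS u u0; have := S'P x xS' u u0.
    rewrite [(g + g') _]/GRing.add /= [(g + g') (eta0 R X)]/GRing.add /= !ltr_norml; lra.
  move=> x e e0; have [d d0 dP] := g2 x _ (divr_gt0 e0 (ltr0n R 2)).
  have [d' d0' dP'] := g2' x _ (divr_gt0 e0 (ltr0n R 2)).
  exists (Num.min d d'); first by rewrite lt_min d0 d0'.
  move=> u u0; rewrite lt_min => /andP[ud ud'].
  have := dP u u0 ud; have := dP' u u0 ud'.
  rewrite [(g + g') _]/GRing.add /= [(g + g') (eta0 R X)]/GRing.add /= !ltr_norml; lra.
- move=> x; have [l lP] := g3 x; have [l' lP'] := g3' x; exists (l + l') => e e0.
  have [M M0 MP] := lP _ (divr_gt0 e0 (ltr0n R 2)).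
  have [M' M0' MP'] := lP' _ (divr_gt0 e0 (ltr0n R 2)).
  exists (Num.max M M'); first by rewrite lt_max M0.
  move=> u; rewrite gt_max => /andP[uM uM'].
  have := MP u uM; have := MP' u uM'.
  rewrite [(g + g') _]/GRing.add /= [(D + D') _]/GRing.add /= mulrDr !ltr_norml; lra.
Qed.

Lemma tame0 : tame 0 0.
Proof.
split; first by exists [::].
  split=> [e e0|x e e0]; first by exists [::] => x _ u u0; rewrite subrr normr0.
  by exists 1 => // u _ _; rewrite subrr normr0.
move=> x; exists 0 => e e0; exists 1 => // u _.
by rewrite [(0 : cp -> R) x]/GRing.zero /= mulr0 !subr0 normr0.
Qed.

Lemma tameMn D g n : tame D g -> tame (D *+ n) (g *+ n).
Proof.
move=> tD; elim: n => [|n IHn]; first by rewrite !mulr0n; exact: tame0.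
by rewrite !mulrS; exact: tameD.
Qed.

Lemma divisor_local_equation D x : Defs.divisors R D ->
  exists (U : set (Defs.point X)) (f : ratR X R),
  [/\ open U, U (cpt x) & local_equation D U f].
Proof.
move=> [n [a [E [Ed DE]]]].
have /choice[C CP] i : exists C : cartier X, mult C = E i.
  by have [C _ <-] := Ed i; exists C.
have tP : all (fun af : R * ffield X => af.2 != 0)
    [seq (a i, loc_eqn (C i) (cpt x)) | i <- enum 'I_n].
  by apply/allP => _ /mapP [i _ ->]; exact: loc_eqn_neq0.
have : nbhs (cpt x) [set y | forall i : 'I_n,
    is_unit (stalk y) (loc_eqn (C i) (cpt x) / loc_eqn (C i) y)].
  have W := @filter_forall (Defs.point X) 'I_n (fun i => [set y : Defs.point X |
    is_unit (stalk y) (loc_eqn (C i) (cpt x) / loc_eqn (C i) y)]) (nbhs (cpt x)) (nbhs_filter _).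
  by apply: W => i; exact: loc_eqn_glue.
rewrite nbhsE => -[U [Uo Ux] UP]; exists U, (RatR tP); split => // y Uy.
rewrite DE /divR /= big_map big_enum /=; apply: eq_bigr => i _; congr (_ * _%:~R).
have l0 p : loc_eqn (C i) p != 0 := loc_eqn_neq0 (C i) p.
have /(is_unitE X_curve X_regular) := UP _ Uy i.
rewrite mulf_neq0 ?invr_eq0// => /(_ isT).
rewrite (ord_atM X_curve X_regular) ?invr_eq0// (ord_atV X_curve X_regular)//.
by move=> /eqP; rewrite subr_eq0 -CP /mult => /eqP ->.
Qed.

Lemma adelic_tame D g : adelic D g -> tame D g.
Proof.
move=> [Ddiv [[V [Vo V0 cV]] geq]]; split.
- have /finite_seqP[T TE] := divisors_finite X_curve X_regular Ddiv.
  exists T => x xT; apply/eqP; apply: contraNT xT => Dx.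
  by have : [set` T] x by rewrite -TE.
- have root := within_continuous_open cV (generic_mem Vo V0 : an V (eta0 R X)).
  have inV x u : an V (seg x u%:E).
    by rewrite anE center_seg; exact: generic_mem.
  split=> [e /root[Q [[_ Qf] Oeta QP]]|x e /root[Q [[Qo _] Oeta QP]]].
    have /finite_seqP[T TE] := Qf Oeta; exists T => x xT u u0.
    apply: QP => //; have xO : range (seg x) `<=` Q.
      by apply: contrapT => nx; move/negP: xT; apply; have : [set` T] x by rewrite -TE.
    by apply: xO; exists u%:E.
  have : nbhs (0%:E : \bar R) (seg x @^-1` Q).
    by apply: open_nbhs_nbhs; split; [exact: Qo|rewrite /= seg_eta0].
  move=> /nbhs_EFin /nbhs_ballP[d d0 dO]; exists d => // u u0 ud.
  by apply: QP => //; apply: (dO u); rewrite /ball /= sub0r normrN gtr0_norm.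
- move=> x; have [U [f [Uo Ux fE]]] := divisor_local_equation x Ddiv.
  have [phi [cphi phiE]] := geq U f Uo fE.
  have Uleaf : an U (seg x +oo%E : berk) by rewrite anE center_leaf.
  have inU u : an U (seg x u%:E).
    by rewrite anE center_seg; apply: generic_mem => //; exists (cpt x).
  exists (phi (seg x +oo%E)) => e e0.
  have [Q [[Qo _] Ql QP]] := within_continuous_open cphi Uleaf e0.
  have : nbhs (+oo%E : \bar R) (seg x @^-1` Q).
    by apply: open_nbhs_nbhs; split; [exact: Qo|].
  move=> [M [_ MO]]; exists (Num.max M 1); first by rewrite lt_max ltr01 orbT.
  move=> u; rewrite gt_max => /andP[uM u1].
  have u0 : 0 < u by apply: lt_trans u1.
  have Ou : Q (seg x u%:E) by apply: MO; rewrite lte_fin.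
  have := QP _ Ou (inU u); rewrite phiE//; last exact: not_leaf_seg.
  by rewrite log_abs_seg// (fE x Ux).
Qed.

(** Affine on every branch. At a leaf [fine] turns the parameter +oo into 0, so the value is e, as
    continuity requires where E x = 0. *)
Definition tent E e : berk -> R := fun xi =>
  if xi is branch x t _ then E x * fine t + e else e.

Lemma tent_seg E e x u : 0 <= u -> tent E e (seg x u%:E) = E x * u + e.
Proof.
rewrite le_eqVlt => /orP[/eqP <-|u0]; first by rewrite seg_eta0//= mulr0 add0r.
by rewrite seg_fin.
Qed.

Lemma tent_continuous T E e (U : set (Defs.point X)) : supported T E ->
  (forall x, U (cpt x) -> E x = 0) -> {within an U, continuous (tent E e)}.
Proof.
move=> sT EU; apply/continuousP => B oB; apply/open_subspaceP.
(* Leaves with E x nonzero lie outside [an U] and are left out, since the tent need not be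
   continuous there. *)
pose S := [set xi | tent E e xi \in B /\ forall x, xi = seg x +oo%E :> berk -> E x = 0].
exists S.
  split=> [x|[eB _]]; last first.
    have : finite_set [set` T] by exact: finite_seq.
    apply: sub_finite_set => x nx /=; apply: contrapT => /negP xT; apply: nx.
    have Ex : E x = 0 by exact: sT.
    move=> _ [t _ <-] /=; have [t0|t0] := leP t 0%E.
      by rewrite seg_eta0//; split => // y; rewrite (seg_branch _ (ltry 0)).
    rewrite (seg_branch _ t0) /S /= Ex mul0r add0r; split => // y.
    by rewrite (seg_branch _ (ltry 0)) => -[<-].
  have [Ex|Ex] := eqVneq (E x) 0.
    have const (t : \bar R) : tent E e (seg x t) = e.
      have [t0|t0] := leP t 0%E; first by rewrite seg_eta0.
      by rewrite (seg_branch _ t0) /= Ex mul0r add0r.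
    have good (t : \bar R) y : seg x t = seg y +oo%E :> berk -> E y = 0.
      have [t0|t0] := leP t 0%E.
        by rewrite seg_eta0// (seg_branch _ (ltry 0)).
      by rewrite (seg_branch _ t0) (seg_branch _ (ltry 0)) => -[<-].
    have [eB|eB] := boolP (e \in B).
      rewrite (_ : _ @^-1` _ = setT); first exact: openT.
      by apply/seteqP; split=> // t _; rewrite /S /= const; split=> // y /good.
    rewrite (_ : _ @^-1` _ = set0); first exact: open0.
    by apply/seteqP; split=> // t; rewrite /S /= const => -[]; rewrite (negPf eB).
  pose q (r : R) := E x * Num.max r 0 + e.
  have cq : continuous q.
    move=> r; apply: cvgD; last exact: cvg_cst.
    apply: cvgM; first exact: cvg_cst.
    by apply: continuous_max; [exact: cvg_id|exact: cvg_cst].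
  have qE r : tent E e (seg x r%:E) = q r.
    rewrite /q; have [r0|r0] := leP r 0; first by rewrite seg_eta0//= mulr0 add0r.
    by rewrite tent_seg// ltW.
  have notleaf r y : seg x r%:E = seg y +oo%E :> berk -> E y = 0.
    have [r0|r0] := leP r 0; first by rewrite seg_eta0// (seg_branch _ (ltry 0)).
    by rewrite seg_fin (seg_branch _ (ltry 0)) => -[].
  rewrite openE => -[r| |] /= [tB nl].
  - suff W : nbhs r [set r' | S (seg x r'%:E)] by exact: W.
    have : nbhs r (q @^-1` B).
      by apply: cq; apply: open_nbhs_nbhs; split=> //; rewrite -qE; exact/set_mem.
    apply: filterS => r' /= r'B; split; first by rewrite qE; exact/mem_set.
    by move=> y; exact: notleaf.
  - by move/eqP: Ex; case; exact: nl.
  - suff W : exists M, M \is Num.real /\ forall t : \bar R, (t < M%:E)%E -> S (seg x t) by exact: W.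
    exists 0; split => // t t0; move: tB; rewrite /S /= !seg_eta0 ?leNye ?(ltW t0)// => eB.
    by split => // y; rewrite (seg_branch _ (ltry 0)).
apply/seteqP; split=> xi [] /=; first by move=> [/set_mem].
move=> Bxi Uxi; split => //; split; first exact/mem_set.
by move=> x xiE; apply: EU; move: Uxi; rewrite xiE anE center_leaf.
Qed.

Lemma open_cofinite (T : seq cp) : open [set p : Defs.point X | forall x, x \in T -> p <> cpt x].
Proof.
elim: T => [|x T IHT].
  by rewrite (_ : [set _ | _] = setT) //; [exact: openT|apply/seteqP; split].
rewrite (_ : [set _ | _] = (~` [set cpt x]) `&` [set p | forall x, x \in T -> p <> cpt x]).
  by apply: openI => //; rewrite openC; exact: cptP.
apply/seteqP; split=> p /= pT.
  by split=> [|y yT]; apply: pT; rewrite inE ?eqxx// yT orbT.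
by move=> y; rewrite inE => /orP[/eqP ->|]; [exact: pT.1|exact: pT.2].
Qed.

Lemma tent_adelic y c e : adelic (fun x => c * (x == y)%:R) (tent (fun x => c * (x == y)%:R) e).
Proof.
set E := fun x : cp => c * (x == y)%:R.
have sE : supported [:: y] E.
  by move=> x; rewrite inE /E => /negPf ->; rewrite mulr0.
split.
  have [C [_ Cm]] := exists_point_cartier X_curve X_regular y.
  exists 1%N, (fun=> c), (fun=> mult C); split; first by exists C.
  by move=> x; rewrite big_ord1 Cm /E; case: (x == y).
split.
  exists [set p | forall x, x \in [:: y] -> p <> cpt x]; split.
  - exact: open_cofinite.
  - exists (generic_point X) => x _ gx; apply: (closed_stalk_neqT X_curve (x := x)).
    by rewrite -gx.
  - apply: tent_continuous sE _ => x /= xy; rewrite /E.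
    by case: eqP => [xyE|]; [exfalso; apply: (xy y); rewrite ?inE// xyE|rewrite mulr0].
move=> U f Uo fE.
have [T [_ sT]] := divR_support X_curve X_regular f.
(* Adding log|f| tilts each branch by - ord_x(f): the sum is again a tent, flat over U. *)
exists (tent (fun x => E x - divR f x) e); split.
  apply: (@tent_continuous (y :: T)) => [x|x Ux]; last by rewrite fE ?subrr.
  by rewrite inE negb_or => /andP[xy xT]; rewrite sE ?inE// sT// subr0.
apply: berkP => [_ _|x t t0 _ _|x _ nl] /=.
- by rewrite addr0.
- by rewrite log_abs_seg// !tent_seg ?ltW//; ring.
- by exfalso; apply: nl; rewrite (seg_branch _ (ltry 0)).
Qed.

End BerkovichTopology.

(** * The total slope through finite samples *)

Section MuTotal.
Variables (R : realType) (K : fieldType) (X : proj_scheme K).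
Hypotheses (X_curve : has_dimension X 1) (X_regular : regular_scheme X).
Local Notation cp := (closed_point X).
Local Notation berk := (berk R X).
Implicit Types (x y : cp) (g : berk -> R) (r u : R) (S T : seq cp).

Definition slope g x u : R := g (seg x u%:E) / u.

Lemma mu_le_slope g x u : 0 < u -> (mu g x <= (slope g x u)%:E)%E.
Proof. by move=> u0; apply: ereal_inf_lbound; exists u. Qed.

Lemma slope_lt_mu g x r : (mu g x < r%:E)%E -> exists2 u, 0 < u & slope g x u < r.
Proof. by move=> /ereal_inf_lt[_ [u u0 <-]]; rewrite lte_fin => ur; exists u. Qed.

Lemma mu_ge g x r : (forall u, 0 < u -> r <= slope g x u) -> (r%:E <= mu g x)%E.
Proof. by move=> rP; apply: le_ereal_inf_tmp => _ [u u0 <-]; rewrite lee_fin; exact: rP. Qed.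

Lemma mu_lty g x : (mu g x < +oo)%E.
Proof. by apply: le_lt_trans (mu_le_slope g x ltr01) _; rewrite ltry. Qed.

Let deg x : R := (res_deg x)%:R.

Let deg_gt0 x : 0 < deg x.
Proof. by rewrite /deg ltr0n res_deg_gt0. Qed.

(** The slope at parameter u is at most C / u, and u may be taken arbitrarily large. *)
Lemma mu_bounded_le0 g x (C : R) : (forall u, 0 < u -> g (seg x u%:E) <= C) -> (mu g x <= 0)%E.
Proof.
move=> gC; rewrite leNgt; apply/negP => mu0.
have [r r0 rmu] : exists2 r, 0 < r & (r%:E <= mu g x)%E.
  move: mu0 (mu_lty g x); case: (mu g x) => // s; rewrite lte_fin => s0 _.
  by exists s.
pose u := (`|C| + 1) / r.
have u0 : 0 < u by rewrite divr_gt0// ltr_wpDl.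
have := le_trans rmu (mu_le_slope g x u0); rewrite lee_fin /slope ler_pdivlMr//.
have ru : r * u = `|C| + 1 by rewrite /u mulrC divfK// gt_eqF.
rewrite ru; have := gC u u0; have := ler_norm C; lra.
Qed.

(** The positive parts sum over S to a real P, so a lower bound r bounds the sum N of the negative
    parts by P - r. Hence no slope is -oo, and as N is a supremum of finite sums, the bound can be
    tested on finite lists containing S. *)
Lemma mu_tot_realP g S r : uniq S -> (forall x, x \notin S -> (mu g x <= 0)%E) ->
  (r%:E <= mu_tot g)%E <-> exists m : cp -> R, (forall x, mu g x = (m x)%:E) /\
     forall T, uniq T -> {subset S <= T} -> r <= degree T m.
Proof.
move=> uS Sneg; pose m0 := (fun x => mu g x * (res_deg x)%:R%:E)%E.
have mN x : x \notin S -> (m0 x <= 0)%E.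
  by move=> xS; rewrite /m0 mule_le0_ge0 ?Sneg// lee_fin ler0n.
pose p x := fine (m0^\+ x)%E.
have m0y x : (m0 x < +oo)%E.
  rewrite /m0; have := mu_lty g x; case: (mu g x) => // [s _|_]; first by rewrite -EFinM ltry.
  by rewrite mulNyr gtr0_sg ?mul1e//; exact: deg_gt0.
have pE x : (m0^\+ x)%E = (p x)%:E.
  rewrite /p fineK//; have := m0y x; rewrite fin_numE funeposE.
  by case: (m0 x) => //= [s|] _; rewrite ?maxNye// -EFin_max.
have p0 x : 0 <= p x by rewrite -lee_fin -pE funepos_ge0.
have pS x : x \notin S -> p x = 0.
  by move=> xS; rewrite /p funeposE max_r ?mN.
pose P := \sum_(x <- S) p x.
have PE : \esum_(x in [set: cp]) (m0^\+ x)%E = P%:E.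
  transitivity (\esum_(x in [set` S]) (m0^\+ x)%E).
    rewrite [RHS]esum_mkcond; apply: eq_esum => x _.
    case: ifPn => //; rewrite notin_setE /= => /negP xS.
    by rewrite pE pS.
  rewrite esum_fset; [|exact: finite_seq|by move=> x _; exact: funepos_ge0].
  by rewrite -fsbig_seq// -sumEFin; apply: eq_bigr => x _; rewrite pE.
pose N := \esum_(x in [set: cp]) (m0^\- x)%E.
have totE : mu_tot g = (P%:E - N)%E by rewrite /mu_tot -/m0 PE.
have N0 : (0 <= N)%E by apply: esum_ge0 => x _; exact: funeneg_ge0.
have dp T (m : cp -> R) : uniq T -> {subset S <= T} -> (forall x, mu g x = (m x)%:E) ->
    (\sum_(x <- T) (m0^\- x)%E = (P - degree T m)%:E)%E.
  move=> uT ST mE; have -> : P = \sum_(x <- T) p x.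
    rewrite /P [RHS](bigID (mem S)) /= [X in _ + X]big1 ?addr0 => [|x /pS //].
    rewrite -[RHS]big_filter; apply: perm_big; apply: uniq_perm; rewrite ?filter_uniq// => x.
    by rewrite mem_filter; case: (boolP (x \in S)) => //= /ST.
  rewrite /degree -sumrB -sumEFin; apply: eq_bigr => x _.
  rewrite /p funenegE funeposE /m0 mE -EFinM -EFinN -!EFin_max/=.
  congr EFin; move: (m x * _) => v; case: (leP (- v) 0); case: (leP v 0); lra.
rewrite totE; split=> [rPN|[m [mE mT]]].
  have Nle : (N <= (P - r)%:E)%E.
    by move: rPN N0; case: (N) => // s; rewrite -EFinB !lee_fin; lra.
  have ge_N T : uniq T -> (\sum_(x <- T) (m0^\- x)%E <= N)%E.
    move=> uT; apply: esum_ge; exists [set` T]; last by rewrite -fsbig_seq.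
    by split=> //; exact: finite_seq.
  have mur x : mu g x \is a fin_num.
    rewrite fin_numE (lt_eqF (mu_lty g x)) andbT; apply/eqP => mux.
    have := le_trans (ge_N [:: x] isT) Nle; rewrite big_seq1 funenegE /m0 mux.
    by rewrite mulNyr gtr0_sg ?mul1e//; exact: deg_gt0.
  exists (fun x => fine (mu g x)); split=> [x|T uT ST]; first by rewrite fineK.
  have := le_trans (ge_N T uT) Nle; rewrite (dp T (fun x => fine (mu g x))) //.
    by rewrite lee_fin; lra.
  by move=> x; rewrite fineK.
suff Nle : (N <= (P - r)%:E)%E.
  by move: Nle N0; case: (N) => // s; rewrite -EFinB !lee_fin; lra.
apply: ge_ereal_sup => _ [A [finA _] <-].
have /finite_seqP[s sE] := finA; pose T := undup (s ++ S).
have uT : uniq T by exact: undup_uniq.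
have ST : {subset S <= T} by move=> x xS; rewrite mem_undup mem_cat xS orbT.
have sA : A = [set` undup s] by rewrite sE; apply/seteqP; split=> x /=; rewrite mem_undup.
rewrite sA -fsbig_seq ?undup_uniq//.
apply: (@le_trans _ _ (\sum_(x <- T) (m0^\- x)%E)%E); last first.
  by rewrite (dp T m)// lee_fin lerB// mT.
rewrite [leRHS](bigID (mem (undup s))) /= -[leLHS]adde0; apply: leeD; last first.
  by apply: sume_ge0 => x _; exact: funeneg_ge0.
rewrite -[leRHS]big_filter le_eqVlt; apply/orP; left; apply/eqP; apply: perm_big.
apply: uniq_perm; rewrite ?filter_uniq ?undup_uniq// => x.
by rewrite mem_filter !mem_undup mem_cat; case: (x \in s).
Qed.

(** Slopes are infima, so they may be replaced by arbitrary values g(u) / u, one per branch; a slope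
    -oo would let one such value sink below any bound. The resulting condition is linear in g. *)
Lemma mu_totP g S r : uniq S -> (forall x, x \notin S -> (mu g x <= 0)%E) ->
  (r%:E <= mu_tot g)%E <-> forall T, uniq T -> {subset S <= T} ->
     forall u : cp -> R, (forall x, 0 < u x) -> r <= degree T (fun x => slope g x (u x)).
Proof.
move=> uS Sneg; split.
  move=> /(mu_tot_realP _ uS Sneg)[m [mE mT]] T uT ST u u0.
  apply: le_trans (mT T uT ST) _; apply: degree_le_fun => x.
  by rewrite -lee_fin -mE mu_le_slope.
move=> H; apply/(mu_tot_realP _ uS Sneg).
have mur x : mu g x \is a fin_num.
  rewrite fin_numE (lt_eqF (mu_lty g x)) andbT; apply/eqP => mux.
  pose T := x :: [seq z <- S | z != x].
  have uT : uniq T by rewrite /= mem_filter eqxx filter_uniq.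
  have ST : {subset S <= T}.
    by move=> z zS; rewrite inE mem_filter zS andbT; case: (z == x).
  pose B := \sum_(z <- [seq z <- S | z != x]) slope g z 1 * deg z.
  have [u u0 uP] : exists2 u, 0 < u & slope g x u < (r - B) / deg x.
    by apply: slope_lt_mu; rewrite mux ltNyr.
  have := H T uT ST (fun z => if z == x then u else 1) _.
  rewrite /degree big_cons eqxx => W.
  have {W} := W _; rewrite (_ : \sum_(z <- _) _ = B); last first.
    by apply: eq_big_seq => z; rewrite mem_filter => /andP[/negPf ->].
  move=> W; have {}W : r <= slope g x u * deg x + B by apply: W => z; case: ifP.
  by move: uP; rewrite ltr_pdivlMr//; lra.
exists (fun x => fine (mu g x)); split=> [x|T uT ST]; first by rewrite fineK.
rewrite leNgt; apply/negP => dlt.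
pose De := degree T (fun _ : cp => 1 : R).
have De0 : 0 <= De by apply: sumr_ge0 => x _; rewrite mul1r.
(* An excess e on each branch of T raises the degree by e De, less than the gap; the 1 keeps the
   denominator positive. *)
pose e := (r - degree T (fun x => fine (mu g x))) / (De + 1).
have e0 : 0 < e by rewrite divr_gt0 ?subr_gt0// ltr_wpDl.
have /choice[u uP] x : exists u, 0 < u /\ slope g x u < fine (mu g x) + e.
  have [|u u0 uP] := @slope_lt_mu g x (fine (mu g x) + e); last by exists u.
  by rewrite EFinD fineK// -[ltLHS]adde0 lteD2lE// lte_fin.
have := H T uT ST u (fun x => (uP x).1).
apply/negP; rewrite -ltNge.
apply: (@le_lt_trans _ _ (degree T (fun x => fine (mu g x) + e * 1))).
  by apply: degree_le_fun => x; rewrite mulr1 ltW//; exact: (uP x).2.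
rewrite degreeD degreeZ -/De.
have : e * (De + 1) = r - degree T (fun x => fine (mu g x)).
  by rewrite /e divfK// gt_eqF// ltr_wpDl.
lra.
Qed.

Lemma mu_tot_fin g S r : uniq S -> (forall x, x \notin S -> (mu g x <= 0)%E) ->
  (r%:E <= mu_tot g)%E -> forall x, mu g x = (fine (mu g x))%:E.
Proof.
by move=> uS Sneg /(mu_tot_realP _ uS Sneg)[m [mE _]] x; rewrite mE.
Qed.

Lemma mu_tot_degree g S r : uniq S -> (forall x, x \notin S -> (mu g x <= 0)%E) ->
  (r%:E <= mu_tot g)%E -> forall T, uniq T -> {subset S <= T} ->
  r <= degree T (fun x => fine (mu g x)).
Proof.
move=> uS Sneg /(mu_tot_realP _ uS Sneg)[m [mE mT]] T uT ST.
apply: le_trans (mT T uT ST) _; apply: degree_le_fun => x.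
by rewrite mE.
Qed.

End MuTotal.

(** A nonnegative integral is a supremum over the simple functions below, hence monotone without
    measurability. This serves for the dimension of the filtration as a function of t. *)
Lemma le_integral_ge0 (d : measure_display) (T : measurableType d) (R : realType)
    (mu : {measure set T -> \bar R}) (D : set T) (f1 f2 : T -> \bar R) :
  (forall x, D x -> (0 <= f1 x)%E) -> (forall x, D x -> (f1 x <= f2 x)%E) ->
  (\int[mu]_(x in D) f1 x <= \int[mu]_(x in D) f2 x)%E.
Proof.
move=> f10 f12; rewrite integral_mkcond [leRHS]integral_mkcond.
have f1D x : (0 <= (f1 \_ D) x)%E.
  by rewrite patchE; case: ifPn => // /set_mem; exact: f10.
have f12D x : ((f1 \_ D) x <= (f2 \_ D) x)%E.
  by rewrite !patchE; case: ifPn => // /set_mem; exact: f12.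
have f2D x : (0 <= (f2 \_ D) x)%E by exact: le_trans (f12D x).
rewrite !ge0_integralTE//; apply: ereal_sup_le => _ [h hf <-].
by exists h => // x; exact: le_trans (f12D x).
Qed.

Lemma integral_step (R : realType) (k t : R) : 0 <= t -> 0 <= k ->
  (\int[lebesgue_measure]_(t' in `[0%R, +oo[) (k * \1_(`[0%R, t]) t')%:E)%E = (k * t)%:E.
Proof.
move=> t0 k0; under eq_integral do rewrite EFinM.
rewrite ge0_integralZl//=; last first.
  by apply/measurable_EFinP/measurable_indic.

rewrite integral_indic// (_ : _ `&` _ = `[0%R, t]%classic).
  rewrite /= lebesgue_measure_itv /= lte_fin. case: ltP => [_|t0'];
    first by rewrite -EFinB subr0 -EFinM.
  by rewrite (le_anti (_ : t <= 0 <= t)) ?mulr0 ?mule0// t0' t0.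
apply/seteqP; split=> z /=; rewrite !in_itv /= ?andbT; first by case.
by move=> /andP[z0 zt]; split; rewrite ?z0.
Qed.

Section LimSup.
Variable R : realType.
Implicit Type u : (\bar R)^nat.

Lemma limn_esup_gt0 u (c : R) n0 : 0 < c -> (forall n, (n0 <= n)%N -> (c%:E <= u n)%E) ->
  (0 < limn_esup u)%E.
Proof.
move=> c0 uc; apply: (@lt_le_trans _ _ c%:E); first by rewrite lte_fin.
apply: le_ereal_inf_tmp => _ [V [N _ NV] <-]; apply: le_ereal_sup_tmp.
exists (u (maxn N n0)); last by apply: uc; exact: leq_maxr.
by exists (maxn N n0) => //; apply: NV; exact: leq_maxl.
Qed.

Lemma limn_esup_le0 u (C : R) : 0 <= C -> (forall n, (0 < n)%N -> (u n <= (C / n%:R)%:E)%E) ->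
  (limn_esup u <= 0)%E.
Proof.
move=> C0 uC; apply/lee_addgt0Pr => e e0; rewrite add0e.
pose N := (Num.truncn (C / e)).+1.
apply: (@le_trans _ _ (ereal_sup [set u x | x in [set n | (N <= n)%N]])).
  apply: ereal_inf_lbound; exists [set n | (N <= n)%N] => //.
  by exists N.
apply: ge_ereal_sup => _ [n Nn <-]; have n0 : (0 < n)%N by apply: leq_trans Nn.
apply: le_trans (uC n n0) _; rewrite lee_fin ler_pdivrMr ?ltr0n// mulrC -ler_pdivrMr//.
by apply: le_trans (ltW (Num.Theory.truncnS_gt _)) _; rewrite ler_nat.
Qed.

End LimSup.

(** * Volumes *)

Section Volumes.
Variables (R : realType) (K : fieldType) (X : proj_scheme K).
Hypotheses (X_curve : has_dimension X 1) (X_regular : regular_scheme X).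
Hypothesis X_pic : dim_PicQ X 1.
Local Notation F := (ffield X).
Local Notation cp := (closed_point X).
Local Notation berk := (berk R X).
Implicit Types (x y : cp) (D E : cp -> R) (g : berk -> R) (r t u : R) (S T : seq cp) (s : F).

Lemma mulrn_pointwise (A : Type) (f : A -> R) n a : (f *+ n) a = n%:R * f a.
Proof.
elim: n => [|n IHn]; first by rewrite mulr0n mul0r.
by rewrite mulrS [LHS]/(f a + (f *+ n) a) IHn -natr1 mulrDl mul1r addrC.
Qed.

Lemma effective_supported T D : supported T D -> (forall x, 0 <= D x) -> effective D.
Proof.
(* Points of multiplicity 0 are dropped, as effectivity asks for positive coefficients. *)
move=> sT D0; pose T' := [seq x <- undup T | D x != 0].
have [y0 _] := closed_point_exists X_curve X_regular.
have /choice[E EP] x := exists_point_cartier X_curve X_regular x.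
exists (size T'), (fun i => D (nth y0 T' i)), (fun i => E (nth y0 T' i)); split.
- move=> i; rewrite lt_neqAle D0 andbT eq_sym.
  by have := mem_nth y0 (ltn_ord i); rewrite mem_filter => /andP[].
- by move=> i; case: (EP (nth y0 T' i)).
- move=> x; transitivity (\sum_(z <- T') D z * (mult (E z) x)%:~R); last first.
    by rewrite (big_nth y0) big_mkord.
  have mE z : mult (E z) x = (x == z)%:Z by case: (EP z).
  have [xT|xT] := boolP (x \in T').
    rewrite (bigD1_seq x) ?filter_uniq ?undup_uniq//= mE eqxx mulr1 big1 ?addr0//.
    by move=> z zx; rewrite mE eq_sym (negPf zx) mulr0.
  rewrite big1_seq; last first.
    move=> z /= zT; rewrite mE; have /negPf-> : x != z by apply: contraNneq xT => ->.
    by rewrite mulr0.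
  move: xT; rewrite mem_filter mem_undup negb_and negbK => /orP[/eqP //|]; exact: sT.
Qed.

Lemma abs_an_seg s x u : s != 0 -> 0 < u ->
  abs_an s (seg x u%:E) = expR (- (u * (ord_at x s)%:~R)).
Proof. by move=> s0 u0; rewrite seg_fin /abs_an (negPf s0). Qed.

Lemma filt_bound D g t s : filt D g t s -> s != 0 ->
  (forall x u, 0 < u -> t <= u * (ord_at x s)%:~R + g (seg x u%:E)) /\ t <= g (eta0 R X).
Proof.
move=> [_ +] s0; rewrite /sup_norm (negPf s0) => sn.
have bound xi : (an_ext (fun xi => (abs_an s xi * expR (- g xi))%R) xi <= (expR (- t))%:E)%E.
  by apply: le_trans sn; apply: ereal_sup_ubound; exists xi.
split=> [x u u0|].
  have := bound (seg x u%:E); rewrite an_ext_seg lee_fin abs_an_seg// -expRD ler_expR.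
  lra.
have := bound (eta0 R X); rewrite /= lee_fin /abs_an (negPf s0) mul1r ler_expR; lra.
Qed.

(** This gives the existence of the limit in [an_ext] at a leaf: it is finite where the slope at
    infinity is 0, and +oo where it is positive. *)
Lemma asymptotic_cvg D g x (c : R) : asymptotic D g -> 0 <= D x + c ->
  (exists l : R, u * c + g (seg x u%:E) @[u --> +oo%R] --> l) \/
  u * c + g (seg x u%:E) @[u --> +oo%R] --> +oo%R.
Proof.
move=> /(_ x)[l lP]; rewrite le_eqVlt => /orP[/eqP Dc|Dc]; [left|right].
  exists l; apply/cvgrPdist_lt => e e0; have [M _ MP] := lP e e0.
  exists M; split; first exact: num_real.
  move=> u Mu; rewrite distrC.
  have -> : u * c + g (seg x u%:E) - l = g (seg x u%:E) - u * D x - l.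
    have -> : c = - D x by lra.
    by ring.
  exact: MP.
apply/cvgryPge => A; have [M M0 MP] := lP 1 ltr01.
exists (Num.max M ((A - l + 1) / (D x + c))); split; first exact: num_real.
move=> u; rewrite gt_max => /andP[uM uA]; have := MP u uM.
rewrite ltr_norml => /andP[h1 _]; move: uA; rewrite ltr_pdivrMr//; lra.
Qed.

(** A function bounded below has nonnegative slope at infinity. Thus the norm inequality along the
    branches already forces D + (s) to be effective. *)
Lemma asymptotic_ge D g x (c t : R) : asymptotic D g ->
  (forall u, 0 < u -> t <= u * c + g (seg x u%:E)) -> 0 <= D x + c.
Proof.
move=> /(_ x)[l lP] tP; rewrite leNgt; apply/negP => Dc.
have [M M0 MP] := lP 1 ltr01.
pose u := Num.max (M + 1) ((`|l| + `|t| + 2) / - (D x + c)).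
have uM : M < u by rewrite lt_max ltrDl ltr01.
have u0 : 0 < u by exact: lt_trans uM.
have uA : (`|l| + `|t| + 2) <= u * - (D x + c).
  by rewrite -ler_pdivrMr ?oppr_gt0// le_max lexx orbT.
have := MP u uM; rewrite ltr_norml => /andP[_ h2].
have := tP u u0; have := ler_norm l; have := ler_norm (- t); rewrite normrN; lra.
Qed.

Lemma filt_mem D g t s : tame D g -> s != 0 ->
  (forall x u, 0 < u -> t <= u * (ord_at x s)%:~R + g (seg x u%:E)) ->
  t <= g (eta0 R X) -> filt D g t s.
Proof.
move=> [[T sT] _ gasy] s0 tP teta; split.
  right; split=> //; have /finite_seqP[T' T'E] := finite_ord_support X_curve X_regular s0.
  apply: (@effective_supported (T ++ T')).
    move=> x; rewrite mem_cat negb_or => /andP[xT xT'].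
    have ox : ord_at x s = 0.
      by apply/eqP; apply: contraNT xT' => ox; have : [set` T'] x by rewrite -T'E.
    by rewrite [LHS]/(D x + (ord_at x s)%:~R) (sT x xT) ox mulr0z; exact: addr0.
  by move=> x; apply: (asymptotic_ge gasy) => u; exact: tP.
rewrite /sup_norm (negPf s0); apply: ge_ereal_sup => _ [xi _ <-]; move: xi; apply: berkP.
- by rewrite /= /abs_an (negPf s0) mul1r lee_fin ler_expR; lra.
- move=> x u u0; rewrite an_ext_seg abs_an_seg// -expRD lee_fin ler_expR.
  by have := tP x u u0; lra.
move=> x; rewrite an_ext_leaf.
pose q u := u * (ord_at x s)%:~R + g (seg x u%:E).
have near0 : \forall u \near +oo%R, (0 : R) < u.
  by exists 0; split=> //; exact: num_real.
have hq : \forall u \near +oo%R, expR (- q u) =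
    abs_an s (seg x u%:E) * expR (- g (seg x u%:E)).
  by apply: filterS near0 => u u0; rewrite abs_an_seg// -expRD /q opprD.
have Dord : 0 <= D x + (ord_at x s)%:~R.
  by apply: (asymptotic_ge gasy) => u; exact: tP.
have [L cL] : exists L : R, expR (- q u) @[u --> +oo%R] --> L.
  have [[l ql]|qy] := asymptotic_cvg gasy Dord.
    exists (expR (- l)); exact: cvg_comp (cvgN ql) (@continuous_expR R (- l)).
  by exists 0; exact: cvg_comp qy (@cvgr_expR R).
apply: lime_le.
  apply/cvg_ex; exists L%:E; apply: cvg_EFin; first by near=> u.
  by apply: cvg_trans cL; apply: near_eq_cvg.
apply: filterS near0 => u u0; rewrite abs_an_seg// -expRD lee_fin ler_expR.
by have := tP x u u0; lra.
Unshelve. all: by end_near.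
Qed.

Lemma zero_subspace : ksubspace (emb X) [set 0].
Proof.
split=> // [a b -> ->|c a ->]; first by rewrite /= addr0.
by rewrite /= mulr0.
Qed.

Lemma kdim_ge (V : set F) B m (c : 'I_m -> F) :
  (forall n (a : 'I_n -> F), (forall j, V (a j)) -> indep_mod (emb X) [set 0] a -> (n <= B)%N) ->
  (forall j, V (c j)) -> indep_mod (emb X) [set 0] c -> (m <= kdim V)%N.
Proof.
move=> VB cV ic; rewrite /kdim; case: xgetP => [n _ [b [_ _ bg]]|none].
  exact: (indep_mod_le zero_subspace bg cV ic).
have [n _ qn] := quot_dim_exists zero_subspace VB.
by case: (none n).
Qed.

Lemma kdim_le (V : set F) B :
  (forall n (a : 'I_n -> F), (forall j, V (a j)) -> indep_mod (emb X) [set 0] a -> (n <= B)%N) ->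
  (kdim V <= B)%N.
Proof. by move=> VB; rewrite /kdim; case: xgetP => // n _ [b [Vb ib _]]; exact: (VB n b). Qed.

Lemma kdim_trivial (V : set F) : (forall s, V s -> s = 0) -> kdim V = 0%N.
Proof.
move=> V0; apply/eqP; rewrite -leqn0; apply: kdim_le => -[//|n] a Va ia.
by have := indep_neq0 ia ord0; rewrite (V0 _ (Va ord0)) eqxx.
Qed.

Lemma deg_plus_ge D g (k : R) t : 0 <= t -> 0 <= k ->
  (forall t', 0 <= t' -> t' <= t -> k <= (kdim (filt D g t'))%:R) ->
  ((k * t)%:E <= deg_plus D g)%E.
Proof.
move=> t0 k0 kP; rewrite /deg_plus.
rewrite -integral_step//.
apply: le_integral_ge0 => t'; rewrite /= in_itv /= andbT => t'0.
  by rewrite lee_fin mulr_ge0.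
rewrite lee_fin indicE; have [|] := boolP (_ \in _); last by rewrite mulr0.
by rewrite inE /= in_itv /= => /andP[_ t't]; rewrite mulr1; exact: kP.
Qed.

Lemma deg_plus_le D g (B : nat) t : 0 <= t ->
  (forall t', 0 <= t' -> (kdim (filt D g t') <= B)%N) ->
  (forall t', t < t' -> kdim (filt D g t') = 0%N) ->
  (deg_plus D g <= (B%:R * t)%:E)%E.
Proof.
move=> t0 BP tP; rewrite /deg_plus.
rewrite -integral_step//.
apply: le_integral_ge0 => t'; rewrite /= in_itv /= andbT => t'0.
  by rewrite lee_fin.
rewrite lee_fin indicE; have [_|nt] := boolP (_ \in _).
  by rewrite mulr1 ler_nat; exact: BP.
rewrite tP ?mulr0// ltNge; apply: contra nt => t't.
by rewrite inE /= in_itv /= t'0.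
Qed.

End Volumes.

(** * Bigness and the total slope *)

Section Positivity.
Variables (R : realType) (K : fieldType) (X : proj_scheme K).
Hypotheses (X_curve : has_dimension X 1) (X_regular : regular_scheme X).
Hypothesis X_pic : dim_PicQ X 1.
Local Notation F := (ffield X).
Local Notation cp := (closed_point X).
Local Notation berk := (berk R X).
Implicit Types (x y z : cp) (D E : cp -> R) (g : berk -> R) (r t u : R) (S T : seq cp).

Lemma tame_bounded D g : tame D g -> exists S C, uniq S /\
  forall x, x \notin S -> forall u, 0 < u -> g (seg x u%:E) <= C.
Proof.
move=> [_ [g1 _] _]; have [S SP] := g1 1 ltr01.
exists (undup S), (g (eta0 R X) + 1); split; first exact: undup_uniq.
by move=> x; rewrite mem_undup => xS u u0; have := SP x xS u u0; rewrite ltr_norml; lra.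
Qed.

Lemma tame_mu_le0 D g : tame D g -> exists S, uniq S /\
  forall x, x \notin S -> (mu g x <= 0)%E.
Proof.
move=> /tame_bounded[S [C [uS SC]]]; exists S; split=> // x xS.
exact: mu_bounded_le0 (SC x xS).
Qed.

(** On the branch of x one has g(u) >= r u; let u tend to 0. *)
Lemma root_ge0 D g x r : tame D g -> (r%:E <= mu g x)%E -> 0 <= g (eta0 R X).
Proof.
move=> [_ [_ g2] _] rmu; rewrite leNgt; apply/negP => g0.
have e0 : 0 < - g (eta0 R X) / 2 by lra.
have [d d0 dP] := g2 x _ e0.
pose u := Num.min (d / 2) (- g (eta0 R X) / (4 * (`|r| + 1))).
have r1 : 0 < `|r| + 1 by rewrite ltr_wpDl.
have u0 : 0 < u by rewrite lt_min divr_gt0//= divr_gt0 ?mulr_gt0// oppr_gt0.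
have ud : u < d by rewrite gt_min; apply/orP; left; lra.
have ur : u * (4 * (`|r| + 1)) <= - g (eta0 R X).
  by rewrite -ler_pdivlMr ?mulr_gt0// ge_min lexx orbT.
have := le_trans rmu (mu_le_slope g x u0); rewrite lee_fin /slope ler_pdivlMr// => h1.
have := dP u u0 ud; rewrite ltr_norml => /andP[_ h2].
have h3 : - (u * `|r|) <= r * u.
  by rewrite -mulrN mulrC ler_wpM2r ?(ltW u0)// lerNl; have := ler_norm (- r); rewrite normrN.
have u1 := ltW u0; have : 0 <= u * `|r| by rewrite mulr_ge0.
nra.
Qed.

Lemma degree_delta T z r : uniq T -> z \in T ->
  degree T (fun x => r * (x == z)%:R) = r * (res_deg z)%:R.
Proof.
move=> uT zT; rewrite /degree (bigD1_seq z)//= eqxx mulr1 big1_seq ?addr0//.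
by move=> x /andP[/negPf -> _]; rewrite mulr0 mul0r.
Qed.

(** Every sampled slope at x is at least E x, and E has the same degree on all lists containing its
    support. *)
Lemma mu_tot_ge g S T E : uniq S -> (forall x, x \notin S -> (mu g x <= 0)%E) ->
  uniq T -> supported T E -> (forall x u, 0 < u -> u * E x <= g (seg x u%:E)) ->
  ((degree T E)%:E <= mu_tot g)%E.
Proof.
move=> uS Sneg uT sT Eg.
have uS' : uniq (undup (S ++ T)) by exact: undup_uniq.
apply/(mu_totP X_curve X_regular _ uS').
  by move=> x; rewrite mem_undup mem_cat negb_or => /andP[/Sneg].
move=> T' uT' sub u u0; rewrite (degree_indep uT uT' sT); last first.
  move=> x xT'; apply: sT; apply: contra xT' => xT.
  by apply: sub; rewrite mem_undup mem_cat xT orbT.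
by apply: degree_le_fun => x; rewrite /slope ler_pdivlMr// mulrC Eg.
Qed.

Lemma filt_sections D g t s : tame D g -> filt D g t s -> sections_of D s.
Proof.
move=> [_ _ gasy] fs; have [->|s0] := eqVneq s 0; [by left|right].
split=> // x; have [sb _] := filt_bound fs s0.
by have := asymptotic_ge gasy (sb x); lra.
Qed.

Lemma filt_bounded D g : tame D g -> exists B, forall t n (a : 'I_n -> F),
  (forall j, filt D g t (a j)) -> indep_mod (emb X) [set 0] a -> (n <= B)%N.
Proof.
move=> tD; have [[T sT] _ _] := tD.
have sT' : supported (undup T) D by move=> x; rewrite mem_undup; exact: sT.
have [B BP] := sections_bounded X_curve X_regular X_pic (undup_uniq T) sT'.
exists B => t n a fa; apply: BP => j; exact: filt_sections (fa j).
Qed.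

Lemma exists_small T (d : cp -> R) : (forall x, 0 < d x) ->
  exists2 u, 0 < u & forall x, x \in T -> u <= d x.
Proof.
move=> d0; elim: T => [|x T [u u0 uT]]; first by exists 1.
exists (Num.min (d x) u); first by rewrite lt_min d0.
move=> z; rewrite inE => /orP[/eqP ->|/uT zu]; first by rewrite ge_min lexx.
by rewrite ge_min zu orbT.
Qed.

(* For t0 small, g - t0 still dominates a divisor of positive degree. *)
Lemma big_of_positive D g S r : tame D g -> 0 < g (eta0 R X) ->
  uniq S -> (forall x, x \notin S -> (mu g x <= 0)%E) ->
  0 < r -> (r%:E <= mu_tot g)%E -> big_adelic D g.
Proof.
move=> tD g0 uS Sneg r0 rmu; have [_ [g1 g2] _] := tD.
(* Half the value at the root: g stays above gam near the root and on all branches outside a finite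
   list. *)
pose gam := g (eta0 R X) / 2; have gam0 : 0 < gam by rewrite divr_gt0.
have [T1 T1P] := g1 gam gam0.
pose T := undup (S ++ T1); have uT : uniq T by exact: undup_uniq.
have ST : {subset S <= T} by move=> x xS; rewrite mem_undup mem_cat xS.
pose m x := fine (mu g x).
have mE x : mu g x = (m x)%:E by exact: (mu_tot_fin X_curve X_regular uS Sneg rmu).
have degm : r <= degree T m by exact: (mu_tot_degree X_curve X_regular uS Sneg rmu).
have mg x u : 0 < u -> u * m x <= g (seg x u%:E).
  move=> u0; have := mu_le_slope g x u0; rewrite mE lee_fin /slope ler_pdivlMr//.
  by rewrite mulrC.
have /choice[d dP] x : exists d, 0 < d /\ forall u, 0 < u -> u < d -> gam < g (seg x u%:E).
  have [d d0 dP] := g2 x gam gam0; exists d; split=> // u u0 ud.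
  by have := dP u u0 ud; rewrite ltr_norml /gam; lra.
have m1 x : 0 < `|m x| + 1 by rewrite ltr_wpDl.
have dm0 x : 0 < Num.min (d x) (gam / 2 / (`|m x| + 1)).
  by rewrite lt_min (dP x).1 !divr_gt0.
(* Before u0, g exceeds gam while u m(x) is at most gam / 2; from u0 on, lowering the slope by t0 /
   u0 lowers u m(x) by at least t0. Either way there is room for t0. *)
have [u0 u00 u0P] := exists_small T dm0.
pose De := degree T (fun _ : cp => 1 : R).
have De0 : 0 <= De by apply: sumr_ge0 => x _; rewrite mul1r.
(* The second bound keeps the loss of degree (t0 / u0) De below r. *)
pose t0 := Num.min (gam / 2) (r * u0 / (2 * (De + 1))).
have De1 : 0 < De + 1 by rewrite ltr_wpDl.
have t00 : 0 < t0 by rewrite lt_min !divr_gt0 ?mulr_gt0.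
have t0gam : t0 <= gam / 2 by rewrite ge_min lexx.
have t0De : t0 * (2 * (De + 1)) <= r * u0.
  by rewrite -ler_pdivlMr ?mulr_gt0// ge_min lexx orbT.
pose E x := if x \in T then m x + - (t0 / u0) * 1 else 0.
have sE : supported T E by move=> x /negPf xT; rewrite /E xT.
have degE : 0 < degree T E.
  have -> : degree T E = degree T (fun x => m x + - (t0 / u0) * 1).
    by apply: eq_big_seq => x xT; rewrite /E xT.
  rewrite degreeD degreeZ -/De mulNr subr_gt0; apply: lt_le_trans degm.
  rewrite mulrAC ltr_pdivrMr//.
  have ru : 0 < r * u0 by rewrite mulr_gt0.
  have : 0 <= t0 * De by rewrite mulr_ge0// ltW.
  nra.
have Eg x u : 0 < u -> u * E x <= g (seg x u%:E) - t0.
  move=> up; rewrite /E; case: ifPn => xT; last first.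
    have xT1 : x \notin T1 by apply: contra xT => xT1; rewrite mem_undup mem_cat xT1 orbT.
    by have := T1P x xT1 u up; rewrite mulr0 ltr_norml /gam in t0gam *; lra.
  rewrite mulr1; have := u0P x xT; rewrite le_min => /andP[u0d u0m].
  have q0 : 0 < t0 / u0 by rewrite divr_gt0.
  have [uu0|uu0] := ltP u u0.
    have gg := (dP x).2 u up (lt_le_trans uu0 u0d).
    have h1 : u0 * (`|m x| + 1) <= gam / 2 by rewrite -ler_pdivlMr.
    have h2 : u * m x <= u0 * `|m x|.
      apply: (@le_trans _ _ (u * `|m x|)); first by rewrite ler_wpM2l ?ler_norm// ltW.
      by rewrite ler_wpM2r// ltW.
    have h3 : 0 < u * (t0 / u0) by rewrite mulr_gt0.
    lra.
  have h1 := mg x u up.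
  have h2 : t0 <= u * (t0 / u0) by rewrite mulrA ler_pdivlMr// mulrC ler_wpM2r// ltW.
  lra.
have [c [c0 [n0 many]]] := many_sections X_curve X_regular X_pic uT sE degE.
have c2 : 0 < 2 * c * t0 by rewrite !mulr_gt0.
apply: (limn_esup_gt0 (n0 := n0.+1) c2) => n nn0.
have np : 0 < n%:R :> R by rewrite ltr0n; apply: leq_trans nn0.
have [k [a [ck ia aE]]] := many n (ltnW nn0).
have tDn := tameMn n tD.
have [B BP] := filt_bounded tDn.
have a0 := indep_neq0 ia.
(* Sections of n E lie in the filtration up to level n t0, and at least c n of them are independent;
   this makes the volume at least 2 c t0. *)
have dge : ((c * n%:R * (n%:R * t0))%:E <= deg_plus (D *+ n)%R (g *+ n)%R)%E.
  apply: deg_plus_ge; [by rewrite mulr_ge0 ?ltW|by rewrite mulr_ge0 ?ltW|].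
  move=> t t1 t2; apply: le_trans ck _; rewrite ler_nat.
  apply: (kdim_ge (B := B) _ _ ia) => [|j]; first exact: BP.
  apply: (filt_mem X_curve X_regular tDn (a0 j)) => [x u up|].
    rewrite mulrn_pointwise; case: (aE j) => [aj|[_ /(_ x) aj]].
      by have := a0 j; rewrite aj eqxx.
    have h1 := ler_wpM2l (ltW up) aj.
    have h2 := ler_wpM2l (ltW np) (Eg x u up).
    have h3 : u * (n%:R * E x) = n%:R * (u * E x) by ring.
    move: h1 h2; rewrite mulrN mulrBr h3; lra.
  rewrite mulrn_pointwise; apply: (le_trans t2); rewrite ler_wpM2l ?ltW//.
  by rewrite /gam in t0gam; lra.
apply: le_trans (lee_wpmul2r _ dge); last by rewrite lee_fin invr_ge0 divr_ge0// exprn_ge0// ltW.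
rewrite -EFinM lee_fin le_eqVlt; apply/orP; left; apply/eqP.
by field; rewrite gt_eqF.
Qed.

Lemma not_big D g (C : R) : 0 <= C -> (forall n, (0 < n)%N ->
   (deg_plus (D *+ n)%R (g *+ n)%R <= (C * n%:R)%:E)%E) -> ~ big_adelic D g.
Proof.
move=> C0 dC; apply/negP; rewrite -leNgt; apply: (limn_esup_le0 (C := 2 * C)).
  by rewrite mulr_ge0.
move=> n n0; have np : 0 < n%:R :> R by rewrite ltr0n.
apply: le_trans (lee_wpmul2r _ (dC n n0)) _.
  by rewrite lee_fin invr_ge0 divr_ge0// exprn_ge0// ltW.
rewrite -EFinM lee_fin le_eqVlt; apply/orP; left; apply/eqP.
by field; rewrite gt_eqF.
Qed.

(** Without a nonzero section at some positive level, the integrand of [deg_plus] vanishes for t > 0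
    and the volume is zero. The norm of such a section at the root bounds g there from below. *)
Lemma root_gt0_of_big D g : tame D g -> big_adelic D g -> 0 < g (eta0 R X) /\
  exists n t s, [/\ (0 < n)%N, 0 < t, s != 0 & filt (D *+ n) (g *+ n) t s].
Proof.
move=> tD bD.
have [n [t [s [n0 t0 s0 fs]]]] : exists n t s,
    [/\ (0 < n)%N, 0 < t, s != 0 & filt (D *+ n) (g *+ n) t s].
  apply: contrapT => none; apply: (not_big (C := 0)) bD => // n n0; rewrite mul0r.
  have [B BP] := filt_bounded (tameMn n tD).
  rewrite -[0](mulr0 B%:R); apply: deg_plus_le => // [t _|t t0]; first by apply: kdim_le; exact: BP.
  apply: kdim_trivial => s fs; apply: contrapT => /eqP s0; apply: none.
  by exists n, t, s.
split; last by exists n, t, s.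
have [_] := filt_bound fs s0; rewrite mulrn_pointwise => tg.
by rewrite -(pmulr_rgt0 _ (_ : 0 < n%:R)) ?ltr0n//; exact: lt_le_trans tg.
Qed.

(* If the total slope vanished, all the sections in the filtration of nD would
   have the same divisor, so that the volume would be zero. *)
Lemma mu_tot_gt0_of_big D g S : tame D g -> uniq S ->
  (forall x, x \notin S -> (mu g x <= 0)%E) -> big_adelic D g ->
  exists2 r, 0 < r & (r%:E <= mu_tot g)%E.
Proof.
move=> tD uS Sneg bD; have [g0 [n1 [t1 [s1 [n10 t10 s10 fs1]]]]] := root_gt0_of_big tD bD.
have supp (s : F) : s != 0 -> exists T, uniq T /\ supported T (fun x => (ord_at x s)%:~R : R).
  move=> s0; have /finite_seqP[T TE] := finite_ord_support X_curve X_regular s0.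
  exists (undup T); split=> [|x]; first exact: undup_uniq.
  rewrite mem_undup => xT; apply/eqP; rewrite intr_eq0; apply: contraNT xT => ox.
  by have : [set` T] x by rewrite -TE.
(* For t >= 0 the divisor - (s) / n, of degree 0, lies below g. *)
have low n t s x u : (0 < n)%N -> 0 <= t -> s != 0 -> filt (D *+ n) (g *+ n) t s -> 0 < u ->
    u * (- n%:R^-1 * (ord_at x s)%:~R) <= g (seg x u%:E).
  move=> n0 t0 s0 fs u0; have [/(_ x u u0) + _] := filt_bound fs s0.
  rewrite mulrn_pointwise => h; have np : 0 < n%:R :> R by rewrite ltr0n.
  rewrite mulNr mulrN lerNl -(ler_pM2l np).
  have -> : n%:R * (u * (n%:R^-1 * (ord_at x s)%:~R)) = u * (ord_at x s)%:~R :> R.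
    by field; rewrite gt_eqF.
  rewrite mulrN; lra.
have mu0 : (0%:E <= mu_tot g)%E.
  have [T [uT sT]] := supp s1 s10.
  have <- : degree T (fun x => - n1%:R^-1 * (ord_at x s1)%:~R) = 0 :> R.
    by rewrite degreeZ degree_prdiv ?mulr0.
  apply: (mu_tot_ge uS Sneg uT) => [x xT|x u u0]; first by rewrite sT ?mulr0.
  exact: (low _ _ _ _ _ n10 (ltW t10) s10 fs1).
apply: contrapT => none.
pose m x := fine (mu g x).
have mE x : mu g x = (m x)%:E by exact: (mu_tot_fin X_curve X_regular uS Sneg mu0).
have mg x u : 0 < u -> u * m x <= g (seg x u%:E).
  move=> u0; have := mu_le_slope g x u0; rewrite mE lee_fin /slope ler_pdivlMr//.
  by rewrite mulrC.
(* Were - (s) / n smaller than the slope m at one x, raising it there to m x would give a divisor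
   below g of positive degree. *)
have same n t s x : (0 < n)%N -> 0 <= t -> s != 0 -> filt (D *+ n) (g *+ n) t s ->
    - n%:R^-1 * (ord_at x s)%:~R = m x.
  move=> n0 t0 s0 fs.
  have mo z : - n%:R^-1 * (ord_at z s)%:~R <= m z.
    rewrite -lee_fin -mE; apply: mu_ge => u u0; rewrite /slope ler_pdivlMr// mulrC.
    exact: low fs u0.
  apply: contrapT => neq; apply: none.
  have rx : 0 < m x - - n%:R^-1 * (ord_at x s)%:~R.
    by rewrite subr_gt0 lt_neqAle mo andbT; apply/eqP.
  exists ((m x - - n%:R^-1 * (ord_at x s)%:~R) * (res_deg x)%:R).
    by rewrite mulr_gt0// ltr0n res_deg_gt0.
  have [T [uT sT]] := supp s s0.
  pose T' := undup (x :: T); have uT' : uniq T' by exact: undup_uniq.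
  have sT' : supported T' (fun z => (ord_at z s)%:~R : R).
    by move=> z; rewrite mem_undup inE negb_or => /andP[_ /sT].
  have xT' : x \in T' by rewrite mem_undup inE eqxx.
  rewrite -(degree_delta _ uT' xT') -[X in (X%:E <= _)%E]add0r.
  have <- : degree T' (fun z => - n%:R^-1 * (ord_at z s)%:~R) = 0 :> R.
    by rewrite degreeZ degree_prdiv ?mulr0.
  rewrite -degreeD; apply: (mu_tot_ge uS Sneg uT') => [z zT'|z u u0].
    rewrite sT'// mulr0 add0r; have /negPf-> : z != x by apply: contraNneq zT' => ->.
    by rewrite mulr0.
  have [->|zx] := eqVneq z x; last by rewrite mulr0 addr0; exact: low fs u0.
  by rewrite mulr1 addrC subrK; exact: mg.
have [y _] := closed_point_exists X_curve X_regular.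
(* Dimensions are at most [kappa(y):K] and vanish beyond level n g(eta_0), so [deg_plus] grows only
   linearly. *)
apply: (not_big (C := (res_deg y)%:R * g (eta0 R X))) bD.
  by rewrite mulr_ge0// ltW.
move=> n n0; rewrite -mulrA; have np : 0 < n%:R :> R by rewrite ltr0n.
apply: deg_plus_le; first by rewrite mulr_ge0 ?ltW.
  move=> t t0; apply: kdim_le => -[//|k] a fa ia.
  have a0 := indep_neq0 ia.
  apply: (indep_same_order X_curve X_regular y (o := fun x => ord_at x (a ord0))) ia => j x.
  apply: (@intr_inj R); have nV : - n%:R^-1 != 0 :> R by rewrite oppr_eq0 invr_eq0 gt_eqF.
  apply: (mulfI nV).
  by rewrite (same n t _ x n0 t0 (a0 j) (fa j)) (same n t _ x n0 t0 (a0 ord0) (fa ord0)).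
move=> t tg; apply: kdim_trivial => s fs; apply: contrapT => /eqP s0.
have [_] := filt_bound fs s0; rewrite mulrn_pointwise leNgt; apply/negP.
by rewrite negbK mulrC.
Qed.

End Positivity.

(** * Criteria for pseudo-effectivity and the Dirichlet property *)

Section MainParts.
Variables (R : realType) (K : fieldType) (X : proj_scheme K).
Hypotheses (X_curve : has_dimension X 1) (X_regular : regular_scheme X).
Hypothesis X_pic : dim_PicQ X 1.
Local Notation cp := (closed_point X).
Local Notation berk := (berk R X).
Implicit Types (x y z : cp) (D E : cp -> R) (g : berk -> R) (r t u : R) (S T : seq cp).

(** Sampled at the same points, slopes add: a positive lower bound r for the total slope of g'
    remains one for g + g'. At the root, g is nonnegative and g' positive. *)
Lemma pseudo_effective_of_mu_tot D g : tame D g -> (0%:E <= mu_tot g)%E ->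
  pseudo_effective D g.
Proof.
move=> tD mu0 D' g' aD' bD'.
have tD' := adelic_tame X_curve X_regular aD'.
have [S [uS Sneg]] := tame_mu_le0 tD.
have [S' [uS' Sneg']] := tame_mu_le0 tD'.
have [g'0 _] := root_gt0_of_big X_curve X_regular X_pic tD' bD'.
have [r r0 rmu] := mu_tot_gt0_of_big X_curve X_regular X_pic tD' uS' Sneg' bD'.
have tDD := tameD tD tD'.
have [S2 [uS2 Sneg2]] := tame_mu_le0 tDD.
have [y _] := closed_point_exists X_curve X_regular.
have g0 : 0 <= g (eta0 R X).
  have mE := mu_tot_fin X_curve X_regular uS Sneg mu0 y.
  by apply: (root_ge0 (x := y) (r := fine (mu g y)) tD); rewrite -mE.
apply: (big_of_positive X_curve X_regular X_pic tDD _ uS2 Sneg2 r0).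
  exact: ltr_wpDl.
pose S3 := undup (S ++ S' ++ S2).
have uS3 : uniq S3 by exact: undup_uniq.
apply/(mu_totP X_curve X_regular r uS3).
  by move=> x; rewrite mem_undup !mem_cat !negb_or => /and3P[_ _ /Sneg2].
move=> T uT sub u u0.
have h1 := (mu_totP X_curve X_regular 0 uS Sneg).1 mu0 T uT _ u u0.
have h2 := (mu_totP X_curve X_regular r uS' Sneg').1 rmu T uT _ u u0.
have -> : degree T (fun x => slope (g + g') x (u x)) =
    degree T (fun x => slope g x (u x)) + degree T (fun x => slope g' x (u x)).
  by rewrite -degreeD; apply: eq_bigr => x _; rewrite -mulrDl.
rewrite -[r]add0r lerD//.
  by apply: h1 => x xS; apply: sub; rewrite mem_undup !mem_cat xS.
by apply: h2 => x xS; apply: sub; rewrite mem_undup !mem_cat xS orbT.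
Qed.

(* A tent of small slope d along one branch and small height e is big, so that
   a negative total slope would survive its addition. *)
Lemma mu_tot_of_pseudo_effective D g : tame D g -> pseudo_effective D g ->
  (0%:E <= mu_tot g)%E.
Proof.
move=> tD peD; have [S0 [C [uS0 S0C]]] := tame_bounded tD.
have [y _] := closed_point_exists X_curve X_regular.
(* With y in S, the tent is constant on the branches outside S, where g + g' therefore stays bounded
   above. *)
pose S := undup (y :: S0); have uS : uniq S by exact: undup_uniq.
have SC x : x \notin S -> forall u, 0 < u -> g (seg x u%:E) <= C.
  by rewrite mem_undup inE negb_or => /andP[_]; exact: S0C.
have Sneg x : x \notin S -> (mu g x <= 0)%E by move=> /SC; exact: mu_bounded_le0.
apply/(mu_totP X_curve X_regular 0 uS Sneg) => T uT ST u u0.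
rewrite leNgt; apply/negP => neg.
have yS : y \in S by rewrite mem_undup inE eqxx.
have dy : 0 < (res_deg y)%:R :> R by rewrite ltr0n res_deg_gt0.
pose A := - degree T (fun x => slope g x (u x)).
have A0 : 0 < A by rewrite oppr_gt0.
pose Q := degree T (fun x => (u x)^-1).
have Q0 : 0 <= Q by apply: sumr_ge0 => x _; rewrite mulr_ge0// invr_ge0 ltW.
have Q1 : 0 < Q + 1 by rewrite ltr_wpDl.
(* To the sampled degree - A the tent adds d [kappa(y):K] + e Q, at most A / 3 + A / 3, so the sum
   stays negative. *)
pose d := A / (3 * (res_deg y)%:R); pose e := A / (3 * (Q + 1)).
have d0 : 0 < d by rewrite divr_gt0// mulr_gt0.
have e0 : 0 < e by rewrite divr_gt0// mulr_gt0.
pose D' := fun x : cp => d * (x == y)%:R; pose g' : berk -> R := tent D' e.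
have aD' : adelic D' g' by exact: tent_adelic.
have tD' := adelic_tame X_curve X_regular aD'.
have g'E x v : 0 < v -> g' (seg x v%:E) = D' x * v + e.
  by move=> v0; rewrite /g' tent_seg// ltW.
have bD' : big_adelic D' g'.
  have [S' [uS' Sneg']] := tame_mu_le0 tD'.
  have dd0 : 0 < degree [:: y] D' by rewrite degree_delta ?inE// mulr_gt0.
  apply: (big_of_positive X_curve X_regular X_pic tD' _ uS' Sneg' dd0); first exact: e0.
  apply: (mu_tot_ge X_curve X_regular uS' Sneg') => // [x|x v v0].
    by rewrite inE /D' => /negPf ->; rewrite mulr0.
  by rewrite g'E// mulrC lerDl ltW.
have bDD := peD D' g' aD' bD'; have tDD := tameD tD tD'.
have ggE x v : 0 < v -> (g + g') (seg x v%:E) = g (seg x v%:E) + (D' x * v + e).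
  by move=> v0; rewrite -g'E.
have Sneg2 x : x \notin S -> (mu (g + g')%R x <= 0)%E.
  move=> xS; apply: (mu_bounded_le0 (C := C + e)) => v v0.
  have xy : x != y by apply: contraNneq xS => ->.
  by rewrite ggE// /D' (negPf xy) mulr0 mul0r add0r lerD2r; exact: SC.
have [r r0 rmu] := mu_tot_gt0_of_big X_curve X_regular X_pic tDD uS Sneg2 bDD.
have := (mu_totP X_curve X_regular r uS Sneg2).1 rmu T uT ST u u0.
have -> : degree T (fun x => slope (g + g') x (u x)) =
    degree T (fun x => slope g x (u x)) + (degree T D' + e * Q).
  rewrite -degreeZ -!degreeD; apply: eq_bigr => x _; congr (_ * _).
  rewrite /slope ggE// !mulrDl; congr (_ + (_ + _)).
  by rewrite mulfK// gt_eqF.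
rewrite degree_delta//; last exact: ST.
have -> : d * (res_deg y)%:R = A / 3 by rewrite /d; field; rewrite gt_eqF.
have : e * (Q + 1) = A / 3 by rewrite /e; field; rewrite gt_eqF.
rewrite /A; lra.
Qed.

Lemma sub_log_seg g (s : ratR X R) x u : 0 < u ->
  (g - (fun xi => fine (log_abs s xi))) (seg x u%:E) = u * divR s x + g (seg x u%:E).
Proof.
move=> u0; rewrite [LHS]/(g (seg x u%:E) - fine (log_abs s (seg x u%:E))).
by rewrite log_abs_seg// opprK addrC.
Qed.

(** On each branch effectivity reads g(u) / u >= - ord_x(s), a bound that vanishes off the support
    of s and has total degree 0. *)
Lemma mu_of_dirichlet D g : tame D g -> dirichlet D g ->
  finite_set [set x | ~ (0 <= mu g x)%E] /\ (0%:E <= mu_tot g)%E.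
Proof.
move=> tD [s [_ gs]]; have [S [uS Sneg]] := tame_mu_le0 tD.
have [T [uT sT]] := divR_support X_curve X_regular s.
have low x u : 0 < u -> u * ((-1) * divR s x) <= g (seg x u%:E).
  move=> u0; have := gs (seg x u%:E); rewrite an_ext_seg sub_log_seg// lee_fin.
  by rewrite mulN1r mulrN; lra.
split.
  apply: (sub_finite_set _ (finite_seq T)) => x /= neg.
  apply: contrapT => /negP xT; apply: neg; apply: mu_ge => u u0.
  by have := low x u u0; rewrite sT// !mulr0 /slope => h; rewrite divr_ge0// ltW.
have <- : degree T (fun x => (-1) * divR s x) = 0.
  by rewrite degreeZ (degree_divR X_curve X_regular X_pic uT sT) mulr0.
apply: (mu_tot_ge X_curve X_regular uS Sneg uT) => [x xT|]; last exact: low.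
by rewrite sT// mulr0.
Qed.

Lemma dirichlet_of_mu D g : tame D g ->
  finite_set [set x | ~ (0 <= mu g x)%E] -> (0%:E <= mu_tot g)%E -> dirichlet D g.
Proof.
move=> tD /finite_seqP[N NE] mu0; have [[TD sTD] _ gasy] := tD.
have [S [uS Sneg]] := tame_mu_le0 tD.
have [y _] := closed_point_exists X_curve X_regular.
pose m x := fine (mu g x).
have mE x : mu g x = (m x)%:E by exact: (mu_tot_fin X_curve X_regular uS Sneg mu0).
have mg x u : 0 < u -> u * m x <= g (seg x u%:E).
  move=> u0; have := mu_le_slope g x u0; rewrite mE lee_fin /slope ler_pdivlMr//.
  by rewrite mulrC.
pose T := undup (y :: S ++ N); have uT : uniq T by exact: undup_uniq.
have yT : y \in T by rewrite mem_undup inE eqxx.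
have ST : {subset S <= T} by move=> x xS; rewrite mem_undup inE mem_cat xS orbT.
have m0 x : x \notin T -> m x = 0.
  rewrite mem_undup inE mem_cat !negb_or => /and3P[_ xS xN]; apply/eqP.
  rewrite -eqe -mE eq_le Sneg//=; apply: contrapT => neg; move/negP: xN; apply.
  by have : [set` N] x by rewrite -NE.
have dm := mu_tot_degree X_curve X_regular uS Sneg mu0 uT ST.
have dy : 0 < (res_deg y)%:R :> R by rewrite ltr0n res_deg_gt0.
(* Removing the whole degree of m at the single point y gives E <= m of degree 0, so that - E is the
   divisor of some s. *)
pose c := degree T m / (res_deg y)%:R.
have c0 : 0 <= c by rewrite divr_ge0// ltW.
pose E x := m x + - c * (x == y)%:R.
have Em x : E x <= m x by rewrite /E mulNr gerBl mulr_ge0.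
have sE : supported T (fun x => (-1) * E x).
  move=> x xT; rewrite /E m0// add0r; have /negPf-> : x != y by apply: contraNneq xT => ->.
  by rewrite !mulr0.
have dE : degree T (fun x => (-1) * E x) = 0.
  rewrite degreeZ /E degreeD degree_delta//.
  have -> : - c * (res_deg y)%:R = - degree T m by rewrite mulNr /c divfK// gt_eqF.
  by rewrite subrr mulr0.
have [s sP] := principal_of_degree0 X_curve X_regular X_pic uT sE dE.
have {}sP x : divR s x = - E x by rewrite sP mulN1r.
have low x u : 0 < u -> 0 <= u * divR s x + g (seg x u%:E).
  move=> u0; rewrite sP mulrN addrC subr_ge0; apply: le_trans (mg x u u0).
  by rewrite ler_wpM2l ?Em// ltW.
exists s; split.
  apply: (effective_supported X_curve X_regular (T := TD ++ T)).
    move=> x; rewrite mem_cat negb_or => /andP[xD xT].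
    rewrite [LHS]/(D x + divR s x) sTD// sP -mulN1r sE//; exact: addr0.
  by move=> x; apply: (asymptotic_ge gasy) => u u0; exact: low.
apply: berkP => [|x u u0|x].
- rewrite /= lee_fin; suff : 0 <= g (eta0 R X) - 0 by [].
  by rewrite subr0; apply: (root_ge0 (x := y) (r := m y) tD); rewrite mE.
- by rewrite an_ext_seg sub_log_seg// lee_fin low.
rewrite an_ext_leaf.
have near0 : \forall u \near +oo%R, (0 : R) < u.
  by exists 0; split=> //; exact: num_real.
apply: lime_ge; last first.
  by apply: filterS near0 => u u0; rewrite sub_log_seg// lee_fin low.
have eq0 : \forall u \near +oo%R, (u * divR s x + g (seg x u%:E))%:E =
    ((g - (fun xi => fine (log_abs s xi))) (seg x u%:E))%:E.
  by apply: filterS near0 => u u0; rewrite sub_log_seg.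
have Dx : 0 <= D x + divR s x.
  by apply: (asymptotic_ge gasy) => u u0; exact: low.
have [[l ql]|qy] := asymptotic_cvg gasy Dx; apply/cvg_ex.
  exists l%:E; apply: cvg_trans (near_eq_cvg eq0) _.
  by apply: cvg_EFin => //; near=> u.
exists +oo%E; apply: cvg_trans (near_eq_cvg eq0) _.
by apply/cvgeryP.
Unshelve. all: by end_near.
Qed.

End MainParts.

Theorem theorem1p2 (R : realType) (K : fieldType) (X : proj_scheme K)
    (X_curve : has_dimension X 1) (X_regular : regular_scheme X)
    (X_pic : dim_PicQ X 1)
    (D : closed_point X -> R) (g : berk R X -> R)
    (Dg_adelic : adelic D g) (D_big : big_divisor D) :
  [/\ finite_set [set x : closed_point X | ~ (mu g x <= 0)%E],
      pseudo_effective D g <-> (0 <= mu_tot g)%E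
    & dirichlet D g <->
        finite_set [set x : closed_point X | ~ (0 <= mu g x)%E] /\
        (0 <= mu_tot g)%E].
Proof.
have tD := adelic_tame X_curve X_regular Dg_adelic; split.
- have [S [_ Sneg]] := tame_mu_le0 tD.
  apply: (sub_finite_set _ (finite_seq S)) => x /= neg.
  by apply: contrapT => /negP /Sneg.
- split; first exact: mu_tot_of_pseudo_effective.
  exact: pseudo_effective_of_mu_tot.
- split; first exact: mu_of_dirichlet.
  by move=> [fin mu0]; exact: dirichlet_of_mu.
Qed.
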